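(* For $0<\alpha<1$, the function $\varphi_\alpha(\theta)=\theta+\arg h_\alpha'(e^{i\theta})$ maps the interval $(0,\pi]$ onto $(\pi(1-\alpha),\pi]$ homeomorphically. Furthermore, for $0\le t\le\pi$, the following hold. (i) Suppose $\alpha=0$. Then $Q_0(0)=1/2$ and $Q_0(t)=-\infty$ for $0<t\le\pi$. (ii) Suppose $0<\alpha<1/2$. Then $$Q_\alpha(t)=\begin{cases}\operatorname{Re}\left[e^{i(t-\theta_0)}k_\alpha(e^{i\theta_0})\right], & 0\le t<\alpha\pi,\ \theta_0=\varphi_\alpha^{-1}(\pi-t),\\ (2\alpha-1)^{-1}\cos(\alpha\pi), & t=\alpha\pi,\\ -\infty, & \alpha\pi<t\le\pi.\end{cases}$$ (iii) Suppose $\alpha=1/2$. Then $$Q_{1/2}(t)=\begin{cases}\operatorname{Re}\left[e^{i(t-\theta_0)}k_{1/2}(e^{i\theta_0})\right], & 0\le t<\pi/2,\ \theta_0=\varphi_{1/2}^{-1}(\pi-t),\\ -\pi/2, & t=\pi/2,\\ -\infty, & \pi/2<t\le\pi.\end{cases}$$ (iv) Suppose $1/2<\alpha<1$. Then $$Q_\alpha(t)=\begin{cases}\operatorname{Re}\left[e^{i(t-\theta_0)}k_\alpha(e^{i\theta_0})\right], & 0\le t<\alpha\pi,\ \theta_0=\varphi_\alpha^{-1}(\pi-t),\\ (2\alpha-1)^{-1}\cos t, & \alpha\pi\le t\le\pi.\end{cases}$$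
   Context: $\mathbb{D}=\{z\in\mathbb{C}:|z|<1\}$. For $0\le\alpha<1$, $\mathcal{K}(\alpha)$ (convex functions of order $\alpha$) is the set of analytic functions $f$ on $\mathbb{D}$ with $f(0)=0$, $f'(0)=1$ and $\operatorname{Re}\left(1+\frac{zf''(z)}{f'(z)}\right)>\alpha$ for all $z\in\mathbb{D}$. The function $k_\alpha$ is given by $k_\alpha(z)=(1-2\alpha)^{-1}\left[(1-z)^{2\alpha-1}-1\right]$ if $\alpha\neq 1/2$ and $k_{1/2}(z)=-\log(1-z)$ (principal branches), and $h_\alpha(z)=k_\alpha(z)/z$; both extend analytically across $\partial\mathbb{D}\setminus\{1\}$. For $0\le\alpha<1$ and $t\in\mathbb{R}$, $$Q_\alpha(t)=\inf_{f\in\mathcal{K}(\alpha),\,z\in\mathbb{D}}\operatorname{Re}\left[e^{it}\frac{f(z)}{z}\right],$$ where $f(z)/z$ is given the value $1$ at $z=0$. The branch of $\arg h_\alpha'(e^{i\theta})$ for $0<\theta\le\pi$ is the continuous one for which $\arg h_\alpha'(-1)=0$ (note $h_\alpha'(-1)>0$), so that $\varphi_\alpha(\pi)=\pi$. *)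

(* Defs.v *)
(* Stdlib reals with Coquelicot. *)
From Stdlib Require Import Reals.
From Coquelicot Require Import Coquelicot.
Open Scope R_scope.

Definition cis (theta : R) : C := (cos theta, sin theta).

(* Principal argument, with values in (-PI, PI]; meaningful for z <> 0 only. *)
Definition Carg (z : C) : R :=
  if Rle_dec 0 (Im z) then acos (Re z / Cmod z) else - acos (Re z / Cmod z).

Definition Clog (z : C) : C := (ln (Cmod z), Carg z).

Definition Cexp (z : C) : C := (RtoC (exp (Re z)) * cis (Im z))%C.

(* Principal branch of z ^ a for real a. *)
Definition Cpowr (z : C) (a : R) : C := Cexp (RtoC a * Clog z)%C.

Definition unit_disc (z : C) : Prop := Cmod z < 1.

Definition analytic_on (D : C -> Prop) (f : C -> C) : Prop :=
  forall z, D z -> ex_derive (K := C_AbsRing) (V := C_NormedModule) f z.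

(* The non-vanishing of f' is implicit in the quotient z f''(z) / f'(z);
   it is stated explicitly because division by zero is total here. *)
Definition convex_of_order (alpha : R) (f : C -> C) : Prop :=
  analytic_on unit_disc f /\
  f (RtoC 0) = RtoC 0 /\
  C_derive f (RtoC 0) = RtoC 1 /\
  forall z, unit_disc z ->
    C_derive f z <> RtoC 0 /\
    Re (RtoC 1 + z * C_derive (C_derive f) z / C_derive f z)%C > alpha.

(* z |-> f(z)/z, completed by the value 1 at the origin. *)
Definition div_id (f : C -> C) (z : C) : C :=
  if Ceq_dec z (RtoC 0) then RtoC 1 else (f z / z)%C.

Definition k (alpha : R) (z : C) : C :=
  if Req_EM_T alpha (1 / 2) then (- Clog (RtoC 1 - z))%C
  else (RtoC (/ (1 - 2 * alpha)) *
        (Cpowr (RtoC 1 - z) (2 * alpha - 1) - RtoC 1))%C.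

(* The principal branches in [k] are analytic off the ray [1, +oo), so this
   formula is also the analytic extension of h_alpha across the unit circle
   minus the point 1. *)
Definition h (alpha : R) : C -> C := div_id (k alpha).

(* The infimum is taken in the extended reals. *)
Definition Q (alpha t : R) : Rbar :=
  Glb_Rbar (fun x : R => exists (f : C -> C) (z : C),
    convex_of_order alpha f /\ unit_disc z /\
    x = Re (cis t * div_id f z)%C).

Definition Ioc (a b x : R) : Prop := a < x <= b.

(* [a theta] is the continuous branch of arg h_alpha'(e^{i theta}) on (0, PI]
   that vanishes at PI. *)
Definition is_arg_branch (alpha : R) (a : R -> R) : Prop :=
  continuous_on (Ioc 0 PI) a /\
  a PI = 0 /\
  forall theta, Ioc 0 PI theta ->
    C_derive (h alpha) (cis theta) <> RtoC 0 /\
    C_derive (h alpha) (cis theta) =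
      (RtoC (Cmod (C_derive (h alpha) (cis theta))) * cis (a theta))%C.

Definition phi (a : R -> R) (theta : R) : R := theta + a theta.

Definition maps_homeomorphically (A B : R -> Prop) (f : R -> R) : Prop :=
  continuous_on A f /\
  exists g : R -> R,
    continuous_on B g /\
    (forall x, A x -> B (f x) /\ g (f x) = x) /\
    (forall y, B y -> A (g y) /\ f (g y) = y).

(* Main.v *)
(** Write [p = 2 - 2 alpha], so that [k' = (1 - z)^(-p)] and
    [h(z) = int_0^1 (1 - s z)^(-p) ds].

    Lower bound: if [f] is convex of order [alpha], then on a smaller disc the
    Poisson-Herglotz formula makes [log f'] a mean of the functions
    [- p log (1 - v z)], [|v| < 1].  By Euler's Beta integral the product of powers
    [(1 - v_1 z)^(-a) (1 - v_2 z)^(-b)] is a mean of functions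
    [(1 - v z)^(-a-b)], hence [f'] lies in the closed convex hull of the
    functions [(1 - v z)^(-p)], and [f(z)/z = int_0^1 f'(s z) ds] is a limit of
    convex combinations of values of [h] in the disc.  So [Q_alpha(t)] is the
    infimum of [Re (e^(it) h)] over the disc, which by the minimum principle is
    determined by the boundary values and by the behaviour at [1].

    Boundary: [z h'(z) = p z (1 - z)^(-p) Y(z)] with
    [Y(z) = int_0^1 (1 - u) (1 - u z)^(-2 alpha) du], whence
    [phi = PI (1 - alpha) + alpha theta + arg Y].  Put [X = (1 - z) Y]; then
    [phi' = Re (1/X) - 1], and [W = Re X - |X|^2] satisfies a linear differential
    equation along the circle with source term [- (p+1) Im Y < 0]; as [W > 0] at
    [-1], it is positive on the whole upper half circle and [phi] increases.  Finally
    [d/dtheta Re (e^(it) h(e^(i theta))) = - |h'| sin (t + phi)] locates the minimum. *)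

Require Import Defs.
From Stdlib Require Import Reals Lra Lia Classical ClassicalEpsilon.
From Coquelicot Require Import Coquelicot.
Open Scope R_scope.

(** * Continuity and differentiation of complex-valued functions *)

(** The obstacle in the lower bound is that a mean sits inside an exponential: f' is the exponential
    of a mean of logarithms, while a convex hull is linear. A convex combination of two exponents
    with weights l and 1 - l turns the exponential of order c into a product of exponentials of
    orders c l and c (1 - l). So it suffices that the hull of order a times the hull of order b lies
    in the hull of order a + b, for all positive orders at once; this dictates the form of
    [exponentiable]. Infinite means are reached as uniform limits of finite ones. For fixed z
    everything is a function of s in [0, 1], with f'(s z) in place of f', so that uniform
    approximation passes directly to f(z)/z. On the boundary, [W] arises because phi' = Re (1/X) - 1
    = W / |X|^2. The minimum principle cannot be used on the unit circle itself, as h may be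
    unbounded at 1; smaller circles are used, with a bound that is uniform near 1. There h - k tends
    to 0, and k is explicit in the modulus and argument of 1 - z. *)

Lemma C_ext (z w : C) : Re z = Re w -> Im z = Im w -> z = w.
Proof. destruct z, w; simpl; intros -> ->; reflexivity. Qed.

Lemma norm_C_R (z : C) : @norm R_AbsRing C_R_NormedModule z = Cmod z.
Proof. symmetry; apply Cmod_norm. Qed.

Lemma Cmod_minus_sym (z w : C) : Cmod (z - w)%C = Cmod (w - z)%C.
Proof. rewrite <- Cmod_opp. f_equal. ring. Qed.

Lemma Cmod_triangle_minus (x y : C) : Cmod (x - y)%C <= Cmod x + Cmod y.
Proof. unfold Cminus. rewrite <- (Cmod_opp y). apply Cmod_triangle. Qed.

Lemma Cmod_triangle_rev (x y : C) : Cmod x - Cmod y <= Cmod (x - y)%C.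
Proof.
  replace x with ((x - y) + y)%C at 1 by ring.
  generalize (Cmod_triangle (x - y) y); lra.
Qed.

Lemma im_le_Cmod (z : C) : Rabs (Im z) <= Cmod z.
Proof. generalize (Rmax_Cmod z), (Rmax_r (Rabs (fst z)) (Rabs (snd z))). unfold Im; lra. Qed.

Lemma Cmod_le_Re_Im (z : C) : Cmod z <= Rabs (Re z) + Rabs (Im z).
Proof.
  replace z with (RtoC (Re z) + Ci * RtoC (Im z))%C
    by (apply C_ext; destruct z; simpl; ring).
  eapply Rle_trans; [apply Cmod_triangle|].
  rewrite Cmod_mult, Cmod_Ci, !Cmod_R.
  destruct z; simpl; rewrite Rmult_0_l, Rmult_1_l, !Rmult_0_r.
  rewrite ?Rmult_0_l, ?Rmult_1_l, ?Rminus_0_r, ?Rplus_0_r, ?Rplus_0_l; lra.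
Qed.

Section Continuity.
Context {T : UniformSpace}.
Implicit Types (f g : T -> C) (x : T).

Lemma continuous_C_AbsRing f x :
  continuous (U := C_UniformSpace) f x <->
  continuous (U := AbsRing_UniformSpace C_AbsRing) f x.
Proof.
  split; intros H P HP; apply H; [apply locally_C | apply locally_C]; exact HP.
Qed.

Lemma continuous_C_eps f x :
  continuous (U := C_UniformSpace) f x <->
  forall eps : R, 0 < eps -> locally x (fun y => Cmod (f y - f x)%C < eps).
Proof.
  rewrite continuous_C_AbsRing. unfold continuous.
  rewrite filterlim_locally. split.
  - intros H eps Heps. exact (H (mkposreal eps Heps)).
  - intros H eps. exact (H eps (cond_pos eps)).
Qed.

Lemma continuous_C_ext f g x :
  (forall y, f y = g y) -> continuous f x -> continuous g x.
Proof. intros H. apply continuous_ext. exact H. Qed.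

Lemma continuous_Cplus f g x :
  continuous f x -> continuous g x -> continuous (fun y => f y + g y)%C x.
Proof. intros Hf Hg. exact (continuous_plus (V := C_R_NormedModule) f g x Hf Hg). Qed.

Lemma continuous_Copp f x : continuous f x -> continuous (fun y => - f y)%C x.
Proof. intros Hf. exact (continuous_opp (V := C_R_NormedModule) f x Hf). Qed.

Lemma continuous_Cminus f g x :
  continuous f x -> continuous g x -> continuous (fun y => f y - g y)%C x.
Proof. intros Hf Hg. apply continuous_Cplus; [|apply continuous_Copp]; assumption. Qed.

Lemma continuous_Cmult f g x :
  continuous f x -> continuous g x -> continuous (fun y => f y * g y)%C x.
Proof.
  rewrite !continuous_C_AbsRing. intros Hf Hg.
  exact (continuous_mult (K := C_AbsRing) f g x Hf Hg).
Qed.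

Lemma continuous_Re f x : continuous f x -> continuous (fun y => Re (f y)) x.
Proof.
  intros Hf. apply (continuous_comp f (fun z : R * R => fst z)); [exact Hf|].
  destruct (f x); apply continuous_fst.
Qed.

Lemma continuous_Im f x : continuous f x -> continuous (fun y => Im (f y)) x.
Proof.
  intros Hf. apply (continuous_comp f (fun z : R * R => snd z)); [exact Hf|].
  destruct (f x); apply continuous_snd.
Qed.

Lemma continuous_C_pair f x :
  continuous (fun y => Re (f y)) x -> continuous (fun y => Im (f y)) x ->
  continuous f x.
Proof.
  intros H1 H2. apply continuous_C_eps. intros eps Heps.
  assert (E : forall u : T -> R, continuous u x ->
    locally x (fun y => Rabs (u y - u x) < eps / 2)).
  { intros u Hu. unfold continuous in Hu. rewrite filterlim_locally in Hu.
    assert (He : 0 < eps / 2) by lra. exact (Hu (mkposreal _ He)). }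
  generalize (filter_and _ _ (E _ H1) (E _ H2)). apply filter_imp.
  intros y [Ha Hb]. eapply Rle_lt_trans; [apply Cmod_le_Re_Im|].
  unfold Cminus; rewrite re_plus, im_plus, re_opp, im_opp.
  unfold Rminus in Ha, Hb; lra.
Qed.

Lemma continuous_RtoC (u : T -> R) x :
  continuous u x -> continuous (fun y => RtoC (u y)) x.
Proof.
  intros Hu. apply continuous_C_pair; simpl; [exact Hu | apply continuous_const].
Qed.

Lemma continuous_Cinv f x :
  f x <> RtoC 0 -> continuous f x -> continuous (fun y => / f y)%C x.
Proof.
  intros Hn Hf.
  assert (Hd : continuous (fun y => / (Re (f y) ^ 2 + Im (f y) ^ 2)) x).
  { apply (continuous_comp (fun y => Re (f y) ^ 2 + Im (f y) ^ 2) Rinv).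
    - apply (continuous_plus (V := R_NormedModule)); simpl.
      + apply (continuous_mult (K := R_AbsRing) (fun y => Re (f y)) (fun y => Re (f y) * 1)).
        * now apply continuous_Re.
        * apply (continuous_mult (K := R_AbsRing) (fun y => Re (f y)) (fun _ => 1)).
          now apply continuous_Re. apply continuous_const.
      + apply (continuous_mult (K := R_AbsRing) (fun y => Im (f y)) (fun y => Im (f y) * 1)).
        * now apply continuous_Im.
        * apply (continuous_mult (K := R_AbsRing) (fun y => Im (f y)) (fun _ => 1)).
          now apply continuous_Im. apply continuous_const.
    - apply continuous_Rinv. intros H0. apply Hn.
      rewrite <- Cmod2_alt in H0. apply Cmod_eq_0.
      destruct (Req_dec (Cmod (f x)) 0) as [H|H]; [exact H|].
      exfalso. apply (pow_nonzero _ 2) in H. contradiction. }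
  apply continuous_C_pair.
  - apply (continuous_mult (K := R_AbsRing) (fun y => Re (f y))
      (fun y => / (Re (f y) ^ 2 + Im (f y) ^ 2))); [now apply continuous_Re | exact Hd].
  - apply (continuous_mult (K := R_AbsRing) (fun y => - Im (f y))
      (fun y => / (Re (f y) ^ 2 + Im (f y) ^ 2))); [|exact Hd].
    apply (continuous_opp (V := R_NormedModule) (fun y => Im (f y))).
    now apply continuous_Im.
Qed.

End Continuity.

Lemma continuous_C_id (z : C) : continuous (fun w : C => w) z.
Proof. apply continuous_id. Qed.

(* Differentiability in Caratheodory's form, with respect to a complex or
   ([i = RtoC]) a real variable. *)
Definition der {T : UniformSpace} (i : T -> C) (f : T -> C) (x : T) (l : C) : Prop :=
  exists d : T -> C, continuous d x /\ d x = l /\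
    locally x (fun y => f y = f x + d y * (i y - i x))%C.

Notation cder := (@der C_UniformSpace (fun z => z)).
Notation rder := (@der R_UniformSpace RtoC).

Section Derivatives.
Context {T : UniformSpace} (i : T -> C).
Implicit Types (f g : T -> C) (x : T) (l m : C).

(** In Caratheodory's form the rules of calculus are algebra together with continuity of [d]; this
    little-o form is the one to prove when a derivative comes from an estimate, and the one that
    matches [is_derive]. *)
Lemma der_eps f x l :
  der i f x l <->
  (forall eps, 0 < eps -> locally x (fun y =>
     Cmod (f y - f x - l * (i y - i x))%C <= eps * Cmod (i y - i x)%C)).
Proof.
  split.
  - intros (d & Hd & Hl & H) eps Heps.
    apply continuous_C_eps with (eps := eps) in Hd; [|exact Heps].
    generalize (filter_and _ _ H Hd). apply filter_imp. intros y [-> Hy].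
    replace (f x + d y * (i y - i x) - f x - l * (i y - i x))%C
      with ((d y - d x) * (i y - i x))%C by (rewrite Hl; ring).
    rewrite Cmod_mult. apply Rmult_le_compat_r; [apply Cmod_ge_0 | lra].
  - intros H.
    (* The difference quotient, with the value [l] wherever [i y = i x], which is what makes it
       continuous at [x]. *)
    exists (fun y => if Ceq_dec (i y) (i x) then l else (f y - f x) / (i y - i x))%C.
    split; [|split].
    + apply continuous_C_eps. intros eps Heps.
      destruct (Ceq_dec (i x) (i x)) as [_|n]; [|now elim n].
      assert (He : 0 < eps / 2) by lra.
      generalize (H _ He). apply filter_imp. intros y Hy.
      destruct (Ceq_dec (i y) (i x)) as [Hi|Hi].
      * replace (l - l)%C with (RtoC 0) by ring. rewrite Cmod_0. lra.
      * assert (Hi' : (i y - i x <> 0)%C) by now apply Cminus_eq_contra.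
        replace ((f y - f x) / (i y - i x) - l)%C
          with ((f y - f x - l * (i y - i x)) / (i y - i x))%C by (field; exact Hi').
        rewrite Cmod_div by exact Hi'.
        assert (0 < Cmod (i y - i x)%C) by now apply Cmod_gt_0.
        apply Rle_lt_trans with (eps / 2); [|lra].
        apply Rmult_le_reg_r with (Cmod (i y - i x)%C); [assumption|].
        unfold Rdiv at 1. rewrite Rmult_assoc, Rinv_l by lra. lra.
    + destruct (Ceq_dec (i x) (i x)) as [_|n]; [reflexivity | now elim n].
    + assert (He : 0 < 1) by lra.
      generalize (H _ He). apply filter_imp. intros y Hy.
      destruct (Ceq_dec (i y) (i x)) as [Hi|Hi].
      * rewrite Hi in *.
        replace (i x - i x)%C with (RtoC 0) in * by ring.
        rewrite Cmod_0, Cmult_0_r in Hy. rewrite Cmult_0_r.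
        assert (Hz : (f y - f x - 0)%C = RtoC 0).
        { apply Cmod_eq_0. apply Rle_antisym; [lra | apply Cmod_ge_0]. }
        replace (f y) with (f x + (f y - f x - 0))%C by ring. now rewrite Hz.
      * field. now apply Cminus_eq_contra.
Qed.

Lemma der_continuous f x l : continuous i x -> der i f x l -> continuous f x.
Proof.
  intros Hi (d & Hd & Hl & H).
  apply continuous_ext_loc with (fun y => f x + d y * (i y - i x))%C.
  - revert H; apply filter_imp. now intros y ->.
  - apply continuous_Cplus; [apply continuous_const|].
    apply continuous_Cmult; [exact Hd|].
    apply continuous_Cminus; [exact Hi | apply continuous_const].
Qed.

Lemma der_ext_loc f g x l :
  locally x (fun y => f y = g y) -> der i f x l -> der i g x l.
Proof.
  intros He (d & Hd & Hl & H). exists d; split; [exact Hd|split; [exact Hl|]].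
  pose proof (locally_singleton _ _ He) as Hx. simpl in Hx.
  generalize (filter_and _ _ He H). apply filter_imp.
  intros y [<- ->]. now rewrite Hx.
Qed.

Lemma der_ext f g x l : (forall y, f y = g y) -> der i f x l -> der i g x l.
Proof. intros H. apply der_ext_loc. now apply filter_forall. Qed.

Lemma der_eq f x l m : der i f x l -> l = m -> der i f x m.
Proof. now intros H <-. Qed.

Lemma der_const (c : C) x : der i (fun _ => c) x (RtoC 0).
Proof.
  exists (fun _ => RtoC 0). split; [apply continuous_const|split; [reflexivity|]].
  apply filter_forall. intros y. ring.
Qed.

Lemma der_var x : der i i x (RtoC 1).
Proof.
  exists (fun _ => RtoC 1). split; [apply continuous_const|split; [reflexivity|]].
  apply filter_forall. intros y. ring.
Qed.

Lemma der_plus f g x l m :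
  der i f x l -> der i g x m -> der i (fun y => f y + g y)%C x (l + m)%C.
Proof.
  intros (d & Hd & Hl & H) (e & He & Hm & H').
  exists (fun y => d y + e y)%C.
  split; [now apply continuous_Cplus|split; [now rewrite Hl, Hm|]].
  generalize (filter_and _ _ H H'). apply filter_imp. intros y [-> ->]. ring.
Qed.

Lemma der_mult f g x l m :
  continuous i x ->
  der i f x l -> der i g x m ->
  der i (fun y => f y * g y)%C x (l * g x + f x * m)%C.
Proof.
  intros Hi Hf Hg. assert (Hgc := der_continuous _ _ _ Hi Hg).
  destruct Hf as (d & Hd & Hl & H), Hg as (e & He & Hm & H').
  exists (fun y => d y * g y + f x * e y)%C.
  split; [|split; [now rewrite Hl, Hm|]].
  - apply continuous_Cplus; apply continuous_Cmult; trivial. apply continuous_const.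
  - generalize (filter_and _ _ H H'). apply filter_imp. intros y [-> Hy].
    replace (g x) with (g y - e y * (i y - i x))%C by (rewrite Hy; ring). ring.
Qed.

Lemma der_scal (c : C) f x l :
  der i f x l -> der i (fun y => c * f y)%C x (c * l)%C.
Proof.
  intros (d & Hd & Hl & H). exists (fun y => c * d y)%C.
  split; [|split; [now rewrite Hl|]].
  - apply continuous_Cmult; [apply continuous_const | exact Hd].
  - revert H; apply filter_imp. intros y ->. ring.
Qed.

Lemma der_opp f x l : der i f x l -> der i (fun y => - f y)%C x (- l)%C.
Proof.
  intros H. apply der_ext with (fun y => - (1) * f y)%C; [intros; ring|].
  eapply der_eq; [apply der_scal; exact H | ring].
Qed.

Lemma der_minus f g x l m :
  der i f x l -> der i g x m -> der i (fun y => f y - g y)%C x (l - m)%C.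
Proof. intros Hf Hg. apply der_plus; [exact Hf | now apply der_opp]. Qed.

Lemma continuous_C_neq_0 f x :
  continuous f x -> f x <> RtoC 0 -> locally x (fun y => f y <> RtoC 0).
Proof.
  intros Hc Hn. apply Cmod_gt_0 in Hn.
  apply continuous_C_eps with (eps := Cmod (f x)) in Hc; [|exact Hn].
  revert Hc; apply filter_imp. intros y Hy H0.
  rewrite H0, Cmod_minus_sym in Hy.
  replace (f x - 0)%C with (f x) in Hy by ring. lra.
Qed.

Lemma der_inv f x l :
  continuous i x -> f x <> RtoC 0 ->
  der i f x l -> der i (fun y => / f y)%C x (- l / (f x * f x))%C.
Proof.
  intros Hi Hn Hf. assert (Hc := der_continuous _ _ _ Hi Hf).
  destruct Hf as (d & Hd & Hl & H).
  exists (fun y => - (d y * (/ f y * / f x)))%C.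
  split; [|split].
  - apply continuous_Copp, continuous_Cmult; [exact Hd|].
    apply continuous_Cmult; [now apply continuous_Cinv | apply continuous_const].
  - rewrite Hl. field. exact Hn.
  - generalize (filter_and _ _ H (continuous_C_neq_0 _ _ Hc Hn)).
    apply filter_imp. intros y [Hy Hyn].
    replace (/ f y)%C with (/ f x - (f y - f x) * (/ f y * / f x))%C at 1
      by (field; split; assumption).
    rewrite Hy at 1. ring.
Qed.

Lemma der_div f g x l m :
  continuous i x -> g x <> RtoC 0 ->
  der i f x l -> der i g x m ->
  der i (fun y => f y / g y)%C x ((l * g x - f x * m) / (g x * g x))%C.
Proof.
  intros Hi Hn Hf Hg. eapply der_eq.
  - apply (der_mult f (fun y => / g y)%C); [exact Hi | exact Hf |].
    apply der_inv; eassumption.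
  - field. exact Hn.
Qed.

(** The inner function may depend on a real or a complex variable, so one chain rule yields both
    [rder_comp] and [cder_comp]. *)
Lemma der_comp (F : C -> C) f x l m :
  continuous i x ->
  cder F (f x) m -> der i f x l -> der i (fun y => F (f y)) x (m * l)%C.
Proof.
  intros Hi (e & He & Hm & H') Hf. assert (Hc := der_continuous _ _ _ Hi Hf).
  destruct Hf as (d & Hd & Hl & H).
  exists (fun y => e (f y) * d y)%C.
  split; [|split; [now rewrite Hl, Hm|]].
  - apply continuous_Cmult; [|exact Hd]. now apply continuous_comp.
  - generalize (filter_and _ _ H (Hc _ H')). apply filter_imp.
    intros y [Hy ->].
    replace (f y - f x)%C with (d y * (i y - i x))%C by (rewrite Hy; ring). ring.
Qed.

End Derivatives.

Lemma cder_is_derive (f : C -> C) (z l : C) :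
  cder f z l <-> is_derive (K := C_AbsRing) (V := C_NormedModule) f z l.
Proof.
  rewrite der_eps. split.
  - intros H. split; [apply is_linear_scal_l|].
    intros x Hx.
    apply (is_filter_lim_locally_unique (V := AbsRing_NormedModule C_AbsRing)) in Hx.
    subst x. intros eps. apply locally_C.
    generalize (H eps (cond_pos eps)); apply filter_imp; intros y Hy.
    rewrite (Cmult_comm l) in Hy; exact Hy.
  - intros [_ H] eps Heps.
    specialize (H z (fun P HP => HP) (mkposreal eps Heps)).
    apply locally_C in H. revert H. apply filter_imp. intros y Hy.
    rewrite (Cmult_comm l). exact Hy.
Qed.

Lemma rder_is_derive (f : R -> C) (x : R) (l : C) :
  rder f x l <-> is_derive (K := R_AbsRing) (V := C_R_NormedModule) f x l.
Proof.
  assert (E' : forall y, @norm R_AbsRing C_R_NormedModule (minus (minus (f y) (f x)) (scal (minus y x) l))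
                = Cmod (f y - f x - l * (RtoC y - RtoC x))%C).
  { intros y. rewrite norm_C_R. f_equal.
    change (f y - f x - @scal _ C_R_ModuleSpace (y - x)%R l
      = f y - f x - l * (RtoC y - RtoC x))%C.
    rewrite scal_R_Cmult, RtoC_minus. ring. }
  rewrite der_eps. split.
  - intros H. split; [apply is_linear_scal_l|].
    intros x' Hx. apply (is_filter_lim_locally_unique (V := R_NormedModule)) in Hx. subst x'.
    intros eps. generalize (H eps (cond_pos eps)); apply filter_imp; intros y Hy.
    eapply Rle_trans; [right; exact (E' y)|].
    rewrite <- RtoC_minus, Cmod_R in Hy. rewrite <- RtoC_minus. exact Hy.
  - intros [_ H] eps Heps.
    specialize (H x (fun P HP => HP) (mkposreal eps Heps)).
    revert H. apply filter_imp. intros y Hy.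
    eapply Rle_trans; [right; symmetry; exact (E' y)|].
    rewrite <- RtoC_minus, Cmod_R. exact Hy.
Qed.

Lemma cder_unique (f : C -> C) (z l m : C) : cder f z l -> cder f z m -> l = m.
Proof.
  rewrite !cder_is_derive. intros H1 H2.
  rewrite <- (is_C_derive_unique _ _ _ H1). exact (is_C_derive_unique _ _ _ H2).
Qed.

Lemma cder_C_derive (f : C -> C) (z l : C) : cder f z l -> C_derive f z = l.
Proof. rewrite cder_is_derive. apply is_C_derive_unique. Qed.

Lemma cder_continuous (f : C -> C) (z l : C) : cder f z l -> continuous f z.
Proof. apply der_continuous, continuous_C_id. Qed.

Lemma continuous_RtoC_id (x : R) : continuous RtoC x.
Proof. apply (continuous_RtoC (T := R_UniformSpace) (fun y => y)), continuous_id. Qed.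

Lemma rder_continuous (f : R -> C) (x : R) (l : C) : rder f x l -> continuous f x.
Proof. apply der_continuous, continuous_RtoC_id. Qed.

Lemma rder_RtoC (u : R -> R) (x d : R) :
  is_derive u x d -> rder (fun y => RtoC (u y)) x (RtoC d).
Proof.
  intros [_ H]. apply der_eps. intros eps Heps.
  specialize (H x (fun P HP => HP) (mkposreal eps Heps)).
  revert H. apply filter_imp. intros y Hy.
  rewrite <- !RtoC_minus, <- RtoC_mult, <- RtoC_minus, !Cmod_R.
  rewrite (Rmult_comm d). exact Hy.
Qed.

Lemma rder_pair (f : R -> C) (x a b : R) :
  is_derive (fun t => Re (f t)) x a -> is_derive (fun t => Im (f t)) x b ->
  rder f x (a, b).
Proof.
  intros Ha Hb.
  apply der_ext with (fun t => RtoC (Re (f t)) + Ci * RtoC (Im (f t)))%C.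
  { intros t. destruct (f t). apply C_ext; simpl; ring. }
  eapply der_eq.
  - apply der_plus; [apply rder_RtoC, Ha | apply der_scal, rder_RtoC, Hb].
  - apply C_ext; simpl; ring.
Qed.

Lemma rder_Re (f : R -> C) (x : R) (l : C) :
  rder f x l -> is_derive (fun t => Re (f t)) x (Re l).
Proof.
  rewrite der_eps. intros H. split; [apply is_linear_scal_l|].
  intros x' Hx. apply (is_filter_lim_locally_unique (V := R_NormedModule)) in Hx. subst x'.
  intros eps. generalize (H eps (cond_pos eps)); apply filter_imp; intros y Hy.
  rewrite <- RtoC_minus, Cmod_R in Hy.
  eapply Rle_trans; [|exact Hy]. eapply Rle_trans; [|apply re_le_Cmod].
  right. change (Rabs (Re (f y) - Re (f x) - (y - x) * Re l)
    = Rabs (Re (f y - f x - l * RtoC (y - x))%C)).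
  f_equal. unfold Cminus. rewrite !re_plus, !re_opp, re_scal_r. ring.
Qed.

Lemma rder_Im (f : R -> C) (x : R) (l : C) :
  rder f x l -> is_derive (fun t => Im (f t)) x (Im l).
Proof.
  rewrite der_eps. intros H. split; [apply is_linear_scal_l|].
  intros x' Hx. apply (is_filter_lim_locally_unique (V := R_NormedModule)) in Hx. subst x'.
  intros eps. generalize (H eps (cond_pos eps)); apply filter_imp; intros y Hy.
  rewrite <- RtoC_minus, Cmod_R in Hy.
  eapply Rle_trans; [|exact Hy]. eapply Rle_trans; [|apply im_le_Cmod].
  right. change (Rabs (Im (f y) - Im (f x) - (y - x) * Im l)
    = Rabs (Im (f y - f x - l * RtoC (y - x))%C)).
  f_equal. unfold Cminus. rewrite !im_plus, !im_opp, im_scal_r. ring.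
Qed.

Lemma rder_comp (F : C -> C) (f : R -> C) (x : R) (l m : C) :
  cder F (f x) m -> rder f x l -> rder (fun t => F (f t)) x (m * l)%C.
Proof. apply der_comp, continuous_RtoC_id. Qed.

Lemma cder_comp (F f : C -> C) (z l m : C) :
  cder F (f z) m -> cder f z l -> cder (fun w => F (f w)) z (m * l)%C.
Proof. apply der_comp, continuous_C_id. Qed.

Lemma rder_line (z w : C) (x : R) :
  rder (fun t => z + RtoC t * w)%C x w.
Proof.
  eapply der_eq.
  - apply der_plus; [apply der_const|].
    apply (der_mult RtoC RtoC (fun _ => w)); [apply continuous_RtoC_id| |apply der_const].
    apply der_var.
  - ring.
Qed.

Lemma continuous_line (z w : C) (x : R) : continuous (fun t => z + RtoC t * w)%C x.
Proof. eapply rder_continuous, rder_line. Qed.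

Lemma locally_C_Cmod (z : C) (P : C -> Prop) :
  @locally C_UniformSpace z P <->
  exists d, 0 < d /\ forall w, Cmod (w - z)%C < d -> P w.
Proof.
  rewrite locally_C. split.
  - intros [d H]. exists d. split; [apply cond_pos | exact H].
  - intros (d & Hd & H). exists (mkposreal d Hd). exact H.
Qed.

Lemma locally_R_Rabs (x : R) (P : R -> Prop) :
  @locally R_UniformSpace x P <->
  exists d, 0 < d /\ forall y, Rabs (y - x) < d -> P y.
Proof.
  split.
  - intros [d H]. exists d. split; [apply cond_pos | exact H].
  - intros (d & Hd & H). exists (mkposreal d Hd). exact H.
Qed.

Lemma continuous_Cmod_comp {T : UniformSpace} (f : T -> C) (x : T) :
  continuous f x -> continuous (fun y => Cmod (f y)) x.
Proof.
  intros H. apply (continuous_comp f Cmod); [exact H|].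
  apply (filterlim_ext (fun z : C => @norm R_AbsRing C_R_NormedModule z)).
  { intros; apply norm_C_R. }
  rewrite <- norm_C_R. apply (filterlim_norm (V := C_R_NormedModule)).
Qed.

(** * Integrals of complex-valued functions *)

Definition CInt (f : R -> C) (a b : R) : C := @RInt C_R_CompleteNormedModule f a b.
Notation ex_CInt := (@ex_RInt C_R_NormedModule).

Lemma ex_CInt_continuous (f : R -> C) (a b : R) :
  (forall x, Rmin a b <= x <= Rmax a b -> continuous f x) -> ex_CInt f a b.
Proof. apply (ex_RInt_continuous (V := C_R_CompleteNormedModule)). Qed.

Lemma CInt_correct (f : R -> C) (a b : R) :
  ex_CInt f a b -> @is_RInt C_R_NormedModule f a b (CInt f a b).
Proof. apply (RInt_correct (V := C_R_CompleteNormedModule)). Qed.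

Lemma CInt_unique (f : R -> C) (a b : R) (l : C) :
  @is_RInt C_R_NormedModule f a b l -> CInt f a b = l.
Proof. apply (is_RInt_unique (V := C_R_CompleteNormedModule)). Qed.

Lemma CInt_ext (f g : R -> C) (a b : R) :
  (forall x, Rmin a b < x < Rmax a b -> f x = g x) -> CInt f a b = CInt g a b.
Proof. apply (RInt_ext (V := C_R_CompleteNormedModule)). Qed.

Lemma CInt_plus (f g : R -> C) (a b : R) :
  ex_CInt f a b -> ex_CInt g a b ->
  CInt (fun t => f t + g t)%C a b = (CInt f a b + CInt g a b)%C.
Proof. apply (RInt_plus (V := C_R_CompleteNormedModule)). Qed.

Lemma ex_CInt_plus (f g : R -> C) (a b : R) :
  ex_CInt f a b -> ex_CInt g a b -> ex_CInt (fun t => f t + g t)%C a b.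
Proof. apply (ex_RInt_plus (V := C_R_NormedModule)). Qed.

Lemma CInt_Chasles (f : R -> C) (a b c : R) :
  ex_CInt f a b -> ex_CInt f b c -> (CInt f a b + CInt f b c = CInt f a c)%C.
Proof. apply (RInt_Chasles (V := C_R_CompleteNormedModule)). Qed.

Lemma is_RInt_Re_Im (f : R -> C) (a b : R) (l : C) :
  @is_RInt C_R_NormedModule f a b l <->
  is_RInt (fun t => Re (f t)) a b (Re l) /\ is_RInt (fun t => Im (f t)) a b (Im l).
Proof.
  split.
  - intros H. split.
    + apply (is_RInt_fct_extend_fst (U := R_NormedModule) (V := R_NormedModule) f); exact H.
    + apply (is_RInt_fct_extend_snd (U := R_NormedModule) (V := R_NormedModule) f); exact H.
  - intros [H1 H2]. destruct l as [x y].
    apply (is_RInt_fct_extend_pair (U := R_NormedModule) (V := R_NormedModule) f); assumption.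
Qed.

(** [C] is integrated as a real normed module, so linearity over complex scalars is not inherited;
    it is recovered from real and imaginary parts. *)
Lemma is_CInt_scal (c : C) (f : R -> C) (a b : R) (l : C) :
  @is_RInt C_R_NormedModule f a b l ->
  @is_RInt C_R_NormedModule (fun t => c * f t)%C a b (c * l)%C.
Proof.
  rewrite !is_RInt_Re_Im. intros [H1 H2]. split.
  - apply is_RInt_ext with (fun t => Re c * Re (f t) - Im c * Im (f t)).
    { intros t _. now rewrite re_mult. }
    rewrite re_mult.
    apply (is_RInt_minus (V := R_NormedModule)); apply (is_RInt_scal (V := R_NormedModule)); assumption.
  - apply is_RInt_ext with (fun t => Re c * Im (f t) + Im c * Re (f t)).
    { intros t _. now rewrite im_mult. }
    rewrite im_mult.
    apply (is_RInt_plus (V := R_NormedModule)); apply (is_RInt_scal (V := R_NormedModule)); assumption.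
Qed.

Lemma ex_CInt_scal (c : C) (f : R -> C) (a b : R) :
  ex_CInt f a b -> ex_CInt (fun t => c * f t)%C a b.
Proof. intros [l H]. exists (c * l)%C. now apply is_CInt_scal. Qed.

Lemma CInt_scal (c : C) (f : R -> C) (a b : R) :
  ex_CInt f a b -> CInt (fun t => c * f t)%C a b = (c * CInt f a b)%C.
Proof. intros H. apply CInt_unique, is_CInt_scal, CInt_correct, H. Qed.

Lemma CInt_minus (f g : R -> C) (a b : R) :
  ex_CInt f a b -> ex_CInt g a b ->
  CInt (fun t => f t - g t)%C a b = (CInt f a b - CInt g a b)%C.
Proof. apply (RInt_minus (V := C_R_CompleteNormedModule)). Qed.

Lemma ex_CInt_minus (f g : R -> C) (a b : R) :
  ex_CInt f a b -> ex_CInt g a b -> ex_CInt (fun t => f t - g t)%C a b.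
Proof. apply (ex_RInt_minus (V := C_R_NormedModule)). Qed.

Lemma CInt_const (c : C) (a b : R) : CInt (fun _ => c) a b = (RtoC (b - a) * c)%C.
Proof.
  unfold CInt. rewrite (RInt_const (V := C_R_CompleteNormedModule)).
  apply (scal_R_Cmult (b - a) c).
Qed.

Lemma ex_CInt_const (c : C) (a b : R) : ex_CInt (fun _ => c) a b.
Proof. apply (ex_RInt_const (V := C_R_NormedModule)). Qed.

Lemma CInt_Re (f : R -> C) (a b : R) :
  ex_CInt f a b -> Re (CInt f a b) = RInt (fun t => Re (f t)) a b.
Proof.
  intros H. apply CInt_correct, is_RInt_Re_Im in H. symmetry.
  apply (is_RInt_unique (V := R_CompleteNormedModule)), H.
Qed.

Lemma CInt_Im (f : R -> C) (a b : R) :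
  ex_CInt f a b -> Im (CInt f a b) = RInt (fun t => Im (f t)) a b.
Proof.
  intros H. apply CInt_correct, is_RInt_Re_Im in H. symmetry.
  apply (is_RInt_unique (V := R_CompleteNormedModule)), H.
Qed.

Lemma ex_CInt_Re (f : R -> C) (a b : R) :
  ex_CInt f a b -> ex_RInt (fun t => Re (f t)) a b.
Proof. intros [l H]. apply is_RInt_Re_Im in H. eexists; apply H. Qed.

Lemma CInt_RtoC (u : R -> R) (a b : R) :
  ex_RInt u a b -> CInt (fun t => RtoC (u t)) a b = RtoC (RInt u a b).
Proof.
  intros H. apply CInt_unique, is_RInt_Re_Im. simpl. split.
  - exact (RInt_correct (V := R_CompleteNormedModule) u a b H).
  - generalize (is_RInt_const (V := R_NormedModule) a b 0).
    change (scal (b - a) 0) with ((b - a) * 0). now rewrite Rmult_0_r.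
Qed.

Lemma CInt_norm_le (f : R -> C) (a b M : R) :
  a <= b -> ex_CInt f a b -> (forall x, a <= x <= b -> Cmod (f x) <= M) ->
  Cmod (CInt f a b) <= (b - a) * M.
Proof.
  intros Hab He H. rewrite <- norm_C_R.
  apply (norm_RInt_le_const (V := C_R_NormedModule) f a b); [exact Hab| |now apply CInt_correct].
  intros x Hx. rewrite norm_C_R. now apply H.
Qed.

Lemma CInt_norm_le_fun (f : R -> C) (u : R -> R) (a b : R) :
  a <= b -> ex_CInt f a b -> ex_RInt u a b ->
  (forall x, a <= x <= b -> Cmod (f x) <= u x) ->
  Cmod (CInt f a b) <= RInt u a b.
Proof.
  intros Hab He Hu H. rewrite <- norm_C_R.
  apply (norm_RInt_le (V := C_R_NormedModule) f u a b); [exact Hab| |now apply CInt_correct|].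
  - intros x Hx. rewrite norm_C_R. now apply H.
  - exact (RInt_correct (V := R_CompleteNormedModule) u a b Hu).
Qed.

Lemma CInt_rder (f df : R -> C) (a b : R) :
  (forall x, Rmin a b <= x <= Rmax a b -> rder f x (df x)) ->
  (forall x, Rmin a b <= x <= Rmax a b -> continuous df x) ->
  CInt df a b = (f b - f a)%C.
Proof.
  intros H1 H2. apply CInt_unique.
  apply (is_RInt_derive (V := C_R_CompleteNormedModule) f df a b); [|exact H2].
  intros x Hx. apply rder_is_derive. now apply H1.
Qed.

Lemma CInt_point (f : R -> C) (a : R) : CInt f a a = RtoC 0.
Proof. apply (RInt_point (V := C_R_CompleteNormedModule)). Qed.

(** Multiplying by [u] on the left, instead of dividing on the right, keeps the degenerate case
    [u = 0] true; [seg_split] meets it when the dividing point is an end of the segment. *)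
Lemma CInt_comp_lin (f : R -> C) (u v a b : R) :
  ex_CInt f (u * a + v) (u * b + v) ->
  (RtoC u * CInt (fun t => f (u * t + v)%R) a b)%C = CInt f (u * a + v) (u * b + v).
Proof.
  intros H. destruct (Req_dec u 0) as [->|Hu].
  { rewrite Cmult_0_l, !Rmult_0_l, CInt_point. reflexivity. }
  assert (Hu' : RtoC u <> RtoC 0) by (intros E; apply Hu, RtoC_inj, E).
  assert (Hi := CInt_correct _ _ _ H).
  apply (is_RInt_comp_lin (V := C_R_NormedModule)) in Hi.
  apply (is_CInt_scal (/ u)) in Hi.
  rewrite (CInt_unique (fun t => f (u * t + v)) a b (/ u * CInt f (u * a + v) (u * b + v))%C).
  - field. exact Hu'.
  - eapply (is_RInt_ext (V := C_R_NormedModule)); [|exact Hi].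
    intros x _. simpl. rewrite scal_R_Cmult. field. exact Hu'.
Qed.

(** * Goursat's theorem on a disc *)

(** The line integral of [f] along the segment from [a] to [b]. *)
Definition seg (f : C -> C) (a b : C) : C :=
  ((b - a) * CInt (fun t => f (a + RtoC t * (b - a))%C) 0 1)%C.

Definition cball (rho : R) (z : C) : Prop := Cmod z <= rho.

Lemma cball_segment (rho : R) (a b : C) (t : R) :
  0 <= t <= 1 -> cball rho a -> cball rho b -> cball rho (a + RtoC t * (b - a))%C.
Proof.
  unfold cball. intros Ht Ha Hb.
  replace (a + RtoC t * (b - a))%C with (RtoC (1 - t) * a + RtoC t * b)%C
    by (rewrite RtoC_minus; ring).
  eapply Rle_trans; [apply Cmod_triangle|].
  rewrite !Cmod_mult, !Cmod_R, !Rabs_pos_eq by lra. nra.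
Qed.

Section Segments.
Variables (rho : R) (f : C -> C).
Hypothesis f_cont : forall z, cball rho z -> continuous f z.

Lemma continuous_segment (a b : C) (t : R) :
  0 <= t <= 1 -> cball rho a -> cball rho b ->
  continuous (fun t => f (a + RtoC t * (b - a))%C) t.
Proof.
  intros Ht Ha Hb.
  apply (continuous_comp (fun t => (a + RtoC t * (b - a))%C) f).
  - apply continuous_line.
  - apply f_cont, cball_segment; assumption.
Qed.

Lemma ex_CInt_segment (a b : C) (u v : R) :
  0 <= u <= 1 -> 0 <= v <= 1 -> cball rho a -> cball rho b ->
  ex_CInt (fun t => f (a + RtoC t * (b - a))%C) u v.
Proof.
  intros Hu Hv Ha Hb. apply ex_CInt_continuous. intros t Ht.
  apply continuous_segment; [|assumption|assumption].
  unfold Rmin, Rmax in Ht; destruct (Rle_dec u v); lra.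
Qed.

Lemma seg_split (a b : C) (m : R) :
  0 <= m <= 1 -> cball rho a -> cball rho b ->
  (seg f a (a + RtoC m * (b - a)) + seg f (a + RtoC m * (b - a)) b = seg f a b)%C.
Proof.
  intros Hm Ha Hb. unfold seg.
  rewrite <- (CInt_Chasles (fun t => f (a + RtoC t * (b - a))%C) 0 m 1) by (apply ex_CInt_segment; trivial; lra).
  set (g := fun t => f (a + RtoC t * (b - a))%C).
  replace (CInt (fun t => f (a + RtoC t * (a + RtoC m * (b - a) - a))%C) 0 1)
    with (CInt (fun t => g (m * t + 0)) 0 1).
  2:{ apply CInt_ext. intros t _. unfold g. f_equal. rewrite Rplus_0_r, RtoC_mult. ring. }
  replace (CInt (fun t => f (a + RtoC m * (b - a) + RtoC t * (b - (a + RtoC m * (b - a))))%C) 0 1)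
    with (CInt (fun t => g ((1 - m) * t + m)) 0 1).
  2:{ apply CInt_ext. intros t _. unfold g. f_equal.
      rewrite RtoC_plus, RtoC_mult, RtoC_minus. ring. }
  assert (E1 := CInt_comp_lin g m 0 0 1). assert (E2 := CInt_comp_lin g (1 - m) m 0 1).
  replace (m * 0 + 0) with 0 in E1 by ring. replace (m * 1 + 0) with m in E1 by ring.
  replace ((1 - m) * 0 + m) with m in E2 by ring. replace ((1 - m) * 1 + m) with 1 in E2 by ring.
  rewrite <- E1, <- E2 by (apply ex_CInt_segment; trivial; lra).
  rewrite RtoC_minus. ring.
Qed.

Lemma seg_rev (a b : C) :
  cball rho a -> cball rho b -> seg f b a = (- seg f a b)%C.
Proof.
  intros Ha Hb. unfold seg.
  set (g := fun t => f (a + RtoC t * (b - a))%C).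
  replace (CInt (fun t => f (b + RtoC t * (a - b))%C) 0 1)
    with (CInt (fun t => g (-1 * t + 1)) 0 1).
  2:{ apply CInt_ext. intros t _. unfold g. f_equal.
      rewrite RtoC_plus, RtoC_mult. ring. }
  assert (E1 := CInt_comp_lin g (-1) 1 0 1).
  replace (-1 * 0 + 1) with 1 in E1 by ring. replace (-1 * 1 + 1) with 0 in E1 by ring.
  assert (E2 := CInt_Chasles g 0 1 0). rewrite CInt_point in E2.
  rewrite <- E1 in E2 by (apply ex_CInt_segment; trivial; lra).
  set (J := CInt (fun t => g (-1 * t + 1)) 0 1) in *.
  assert (E3 : CInt g 0 1 = J).
  { replace J with (CInt g 0 1 - (CInt g 0 1 + (-1) * J))%C by ring.
    rewrite E2 by (apply ex_CInt_segment; trivial; lra). ring. }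
  rewrite <- E3. ring.
Qed.

Lemma seg_norm_le (a b : C) (M : R) :
  cball rho a -> cball rho b ->
  (forall t, 0 <= t <= 1 -> Cmod (f (a + RtoC t * (b - a))%C) <= M) ->
  Cmod (seg f a b) <= Cmod (b - a)%C * M.
Proof.
  intros Ha Hb H. unfold seg. rewrite Cmod_mult.
  apply Rmult_le_compat_l; [apply Cmod_ge_0|].
  replace M with ((1 - 0) * M) by ring.
  apply CInt_norm_le; [lra | apply ex_CInt_segment; trivial; lra | exact H].
Qed.

Lemma seg_primitive (F : C -> C) (a b : C) :
  cball rho a -> cball rho b ->
  (forall z, cball rho z -> cder F z (f z)) -> seg f a b = (F b - F a)%C.
Proof.
  intros Ha Hb HF. unfold seg. rewrite <- CInt_scal by (apply ex_CInt_segment; trivial; lra).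
  rewrite (CInt_rder (fun t => F (a + RtoC t * (b - a))%C)).
  - f_equal; [f_equal; ring | f_equal; f_equal; ring].
  - intros x Hx. rewrite Rmin_left, Rmax_right in Hx by lra.
    eapply der_eq; [apply rder_comp; [apply HF, cball_segment; assumption | apply rder_line]|].
    ring.
  - intros x Hx. rewrite Rmin_left, Rmax_right in Hx by lra.
    apply continuous_Cmult; [apply continuous_const | now apply continuous_segment].
Qed.

Definition tri (a b c : C) : C := (seg f a b + seg f b c + seg f c a)%C.

(** Written as a point of the parametrised segment, so that [seg_split] applies with m = 1/2. *)
Definition mid (a b : C) : C := (a + RtoC (/ 2) * (b - a))%C.

Lemma cball_mid (a b : C) : cball rho a -> cball rho b -> cball rho (mid a b).
Proof. intros. apply cball_segment; trivial; lra. Qed.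

Lemma tri_split (a b c : C) :
  cball rho a -> cball rho b -> cball rho c ->
  tri a b c = (tri a (mid a b) (mid c a) + tri (mid a b) b (mid b c)
    + tri (mid c a) (mid b c) c + tri (mid b c) (mid c a) (mid a b))%C.
Proof.
  intros Ha Hb Hc.
  assert (Hab := cball_mid _ _ Ha Hb). assert (Hbc := cball_mid _ _ Hb Hc).
  assert (Hca := cball_mid _ _ Hc Ha). unfold tri.
  assert (Hm : 0 <= / 2 <= 1) by lra.
  rewrite <- (seg_split a b (/ 2)), <- (seg_split b c (/ 2)), <- (seg_split c a (/ 2)) by assumption.
  fold (mid a b) (mid b c) (mid c a).
  rewrite (seg_rev (mid a b) (mid c a)), (seg_rev (mid b c) (mid a b)),
    (seg_rev (mid c a) (mid b c)) by assumption.
  ring.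
Qed.

End Segments.

Lemma geometric_Cauchy_limit (u : nat -> R) (d : R) :
  (forall n, Rabs (u (S n) - u n) <= d / 2 ^ n) ->
  exists l, forall n, Rabs (u n - l) <= 2 * d / 2 ^ n.
Proof.
  intros H.
  assert (Hp : forall n, 0 < 2 ^ n) by (intros; apply pow_lt; lra).
  assert (Hd : 0 <= d).
  { generalize (H 0%nat) (Rabs_pos (u 1%nat - u 0%nat)). simpl. lra. }
  (* The exact geometric tail: dropping the subtracted term would break the induction on [m]. *)
  assert (Hc : forall n m, Rabs (u (n + m)%nat - u n) <= 2 * d / 2 ^ n - 2 * d / 2 ^ (n + m)).
  { intros n m. induction m as [|m IH].
    - rewrite Nat.add_0_r, Rminus_diag, Rabs_R0. lra.
    - rewrite Nat.add_succ_r. specialize (H (n + m)%nat).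
      replace (u (S (n + m)) - u n) with ((u (S (n + m)) - u (n + m)%nat) + (u (n + m)%nat - u n)) by ring.
      eapply Rle_trans; [apply Rabs_triang|].
      replace (2 * d / 2 ^ S (n + m)) with (d / 2 ^ (n + m))
        by (simpl; field; apply Rgt_not_eq, Hp).
      replace (2 * d / 2 ^ (n + m)) with (d / 2 ^ (n + m) + d / 2 ^ (n + m)) in IH
        by (field; apply Rgt_not_eq, Hp).
      lra. }
  assert (Hc' : forall n m, (n <= m)%nat -> Rabs (u m - u n) <= 2 * d / 2 ^ n).
  { intros n m Hnm. replace m with (n + (m - n))%nat by lia.
    eapply Rle_trans; [apply Hc|].
    assert (0 <= 2 * d / 2 ^ (n + (m - n))).
    { apply Rmult_le_pos; [lra | left; apply Rinv_0_lt_compat, Hp]. }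
    lra. }
  destruct (Rcomplete.R_complete u) as [l Hl].
  { intros eps Heps.
    destruct (pow_lt_1_zero (/ 2) ltac:(rewrite Rabs_pos_eq; lra) (eps / (4 * d + 1))
      ltac:(apply Rdiv_lt_0_compat; lra)) as [N HN].
    assert (Hk : 4 * d / 2 ^ N < eps).
    { specialize (HN N (Nat.le_refl _)).
      rewrite Rabs_pos_eq, pow_inv in HN by (apply pow_le; lra).
      apply Rmult_lt_compat_l with (r := 4 * d + 1) in HN; [|lra].
      replace ((4 * d + 1) * (eps / (4 * d + 1))) with eps in HN by (field; lra).
      assert (0 < / 2 ^ N) by apply Rinv_0_lt_compat, Hp. unfold Rdiv; nra. }
    exists N. intros n m Hn Hm. unfold Rdist.
    replace (u n - u m) with ((u n - u N) - (u m - u N)) by ring.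
    eapply Rle_lt_trans; [apply Rabs_triang|]. rewrite Rabs_Ropp.
    pose proof (Hc' N n Hn). pose proof (Hc' N m Hm).
    replace (4 * d / 2 ^ N) with (2 * d / 2 ^ N + 2 * d / 2 ^ N) in Hk by (field; apply Rgt_not_eq, Hp).
    lra. }
  exists l. intros n. apply Rnot_lt_le. intros Hlt.
  set (e := Rabs (u n - l) - 2 * d / 2 ^ n).
  destruct (Hl e) as [N HN]; [unfold e; lra|].
  specialize (HN (max n N) (Nat.le_max_r _ _)). unfold Rdist in HN.
  pose proof (Hc' n (max n N) (Nat.le_max_l _ _)) as H1.
  assert (Rabs (u n - l) <= Rabs (u (max n N) - u n) + Rabs (u (max n N) - l)).
  { replace (u n - l) with (- (u (max n N) - u n) + (u (max n N) - l)) by ring.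
    eapply Rle_trans; [apply Rabs_triang|]. rewrite Rabs_Ropp. lra. }
  unfold e in HN. lra.
Qed.

Lemma geometric_Cauchy_limit_C (u : nat -> C) (d : R) :
  (forall n, Cmod (u (S n) - u n)%C <= d / 2 ^ n) ->
  exists l, forall n, Cmod (u n - l)%C <= 4 * d / 2 ^ n.
Proof.
  intros H.
  destruct (geometric_Cauchy_limit (fun n => Re (u n)) d) as [x Hx].
  { intros n. eapply Rle_trans; [|apply H]. eapply Rle_trans; [|apply re_le_Cmod].
    unfold Cminus. rewrite re_plus, re_opp. apply Rle_refl. }
  destruct (geometric_Cauchy_limit (fun n => Im (u n)) d) as [y Hy].
  { intros n. eapply Rle_trans; [|apply H]. eapply Rle_trans; [|apply im_le_Cmod].
    unfold Cminus. rewrite im_plus, im_opp. apply Rle_refl. }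
  exists (x, y). intros n. eapply Rle_trans; [apply Cmod_le_Re_Im|].
  unfold Cminus. rewrite re_plus, re_opp, im_plus, im_opp. simpl.
  specialize (Hx n). specialize (Hy n). unfold Rminus in Hx, Hy.
  replace (4 * d / 2 ^ n) with (2 * d / 2 ^ n + 2 * d / 2 ^ n)
    by (field; apply pow_nonzero; lra). lra.
Qed.

Lemma half_power_small (d eps : R) : 0 <= d -> 0 < eps -> exists n, d / 2 ^ n < eps.
Proof.
  intros Hd Heps.
  destruct (pow_lt_1_zero (/ 2) ltac:(rewrite Rabs_pos_eq; lra) (eps / (d + 1))
    ltac:(apply Rdiv_lt_0_compat; lra)) as [N HN].
  exists N. specialize (HN N (Nat.le_refl _)).
  rewrite Rabs_pos_eq, pow_inv in HN by (apply pow_le; lra).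
  apply Rmult_lt_compat_l with (r := d + 1) in HN; [|lra].
  replace ((d + 1) * (eps / (d + 1))) with eps in HN by (field; lra).
  assert (0 < / 2 ^ N) by (apply Rinv_0_lt_compat, pow_lt; lra). unfold Rdiv; nra.
Qed.

Section Goursat.
Variables (rho : R) (f : C -> C).
Hypothesis f_der : forall z, cball rho z -> exists l, cder f z l.

Let f_cont : forall z, cball rho z -> continuous f z.
Proof. intros z Hz. destruct (f_der z Hz) as [l Hl]. eapply cder_continuous, Hl. Qed.

Let triangle := (C * C * C)%type.
Let T (t : triangle) : C := let '(a, b, c) := t in tri f a b c.
Let inside (t : triangle) : Prop :=
  let '(a, b, c) := t in cball rho a /\ cball rho b /\ cball rho c.
Let sides (d : R) (t : triangle) : Prop :=
  let '(a, b, c) := t in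
  Cmod (b - a)%C <= d /\ Cmod (c - b)%C <= d /\ Cmod (a - c)%C <= d.
Let first (t : triangle) : C := let '(a, _, _) := t in a.

Ltac half H x y :=
  apply (H x y); [unfold mid; rewrite RtoC_inv by lra; field | assumption].

(** Goursat's bisection: one of the four half-size triangles carries at least a quarter of the
    integral. The condition [inside t] stands under the existential so that choice yields a total
    map on triangles, which can be iterated. *)
Lemma quarter_triangle (t : triangle) : exists t' : triangle, inside t ->
  inside t' /\ Cmod (T t) <= 4 * Cmod (T t') /\
  forall d, sides d t -> sides (d / 2) t' /\ Cmod (first t' - first t)%C <= d.
Proof.
  destruct t as [[a b] c].
  set (t1 := (a, mid a b, mid c a)). set (t2 := (mid a b, b, mid b c)).
  set (t3 := (mid c a, mid b c, c)). set (t4 := (mid b c, mid c a, mid a b)).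
  assert (Hh : forall x y w : C, (2 * w = y - x)%C -> forall d, Cmod (y - x)%C <= d -> Cmod w <= d / 2).
  { intros x y w Hw d Hd. rewrite <- Hw, Cmod_mult, Cmod_R, Rabs_pos_eq in Hd by lra. lra. }
    assert (Hs : forall d, sides d (a, b, c) -> forall t', t' = t1 \/ t' = t2 \/ t' = t3 \/ t' = t4 ->
    sides (d / 2) t' /\ Cmod (first t' - a)%C <= d).
  { intros d (H1 & H2 & H3).
    assert (Hd : 0 <= d) by (generalize (Cmod_ge_0 (b - a)%C); lra).
    assert (H1' : Cmod (a - b)%C <= d) by (rewrite Cmod_minus_sym; exact H1).
    assert (H2' : Cmod (b - c)%C <= d) by (rewrite Cmod_minus_sym; exact H2).
    assert (H3' : Cmod (c - a)%C <= d) by (rewrite Cmod_minus_sym; exact H3).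
    assert (Hhalf : forall w, Cmod w <= d / 2 -> Cmod w <= d) by (intros; lra).
    intros t' [-> | [-> | [-> | ->]]]; unfold sides, first, t1, t2, t3, t4;
      (split; [split; [|split]|]);
      try (first [half Hh a b | half Hh b a | half Hh a c | half Hh c a | half Hh b c | half Hh c b]);
      try (apply Hhalf; first [half Hh a b | half Hh a c]).
    - replace (a - a)%C with (RtoC 0) by ring. rewrite Cmod_0. exact Hd.
    - replace (mid b c - a)%C with ((mid a b - a) + (mid b c - mid a b))%C by ring.
      eapply Rle_trans; [apply Cmod_triangle|].
      assert (Cmod (mid a b - a)%C <= d / 2) by half Hh a b.
      assert (Cmod (mid b c - mid a b)%C <= d / 2) by half Hh a c.
      lra. }
  assert (Hex : inside (a, b, c) -> exists t', (t' = t1 \/ t' = t2 \/ t' = t3 \/ t' = t4) /\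
    Cmod (T (a, b, c)) <= 4 * Cmod (T t')).
  { intros (Ha & Hb & Hc). apply NNPP. intros Hno.
    assert (Hlt : forall t', t' = t1 \/ t' = t2 \/ t' = t3 \/ t' = t4 ->
      4 * Cmod (T t') < Cmod (T (a, b, c))).
    { intros t' Ht'. apply Rnot_le_lt. intros Hle. apply Hno. exists t'. tauto. }
    assert (L1 := Hlt t1 ltac:(tauto)). assert (L2 := Hlt t2 ltac:(tauto)).
    assert (L3 := Hlt t3 ltac:(tauto)). assert (L4 := Hlt t4 ltac:(tauto)).
    assert (E : T (a, b, c) = (T t1 + T t2 + T t3 + T t4)%C)
      by (apply (tri_split rho f f_cont); assumption).
    assert (Cmod (T (a, b, c)) <= Cmod (T t1) + Cmod (T t2) + Cmod (T t3) + Cmod (T t4)).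
    { rewrite E. eapply Rle_trans; [apply Cmod_triangle|]. apply Rplus_le_compat_r.
      eapply Rle_trans; [apply Cmod_triangle|]. apply Rplus_le_compat_r. apply Cmod_triangle. }
    lra. }
  destruct (classic (inside (a, b, c))) as [Hin|Hin].
  - destruct (Hex Hin) as (t' & Ht' & HT). exists t'. intros (Ha & Hb & Hc).
    split; [|split; [exact HT|]].
    + destruct Ht' as [-> | [-> | [-> | ->]]]; simpl; repeat split; trivial; now apply cball_mid.
    + intros d Hd. now apply Hs.
  - exists t1. intros; contradiction.
Qed.

Lemma tri_zero (a b c : C) :
  cball rho a -> cball rho b -> cball rho c -> tri f a b c = RtoC 0.
Proof.
  intros Ha Hb Hc.
  set (next := fun t => proj1_sig (constructive_indefinite_description _ (quarter_triangle t))).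
  assert (Hnext : forall t, _) by
    exact (fun t => proj2_sig (constructive_indefinite_description _ (quarter_triangle t))).
  fold next in Hnext. simpl in Hnext.
  set (t := fun n => Nat.iter n next (a, b, c)).
  assert (Hin : forall n, inside (t n)).
  { induction n as [|n IH]; [simpl; tauto|]. apply Hnext, IH. }
  set (d := Cmod (b - a)%C + Cmod (c - b)%C + Cmod (a - c)%C).
  assert (Hd : 0 <= d).
  { unfold d. generalize (Cmod_ge_0 (b - a)%C) (Cmod_ge_0 (c - b)%C) (Cmod_ge_0 (a - c)%C). lra. }
  assert (Hsides : forall n, sides (d / 2 ^ n) (t n)).
  { induction n as [|n IH].
    - simpl. unfold d. generalize (Cmod_ge_0 (b - a)%C) (Cmod_ge_0 (c - b)%C) (Cmod_ge_0 (a - c)%C). lra.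
    - replace (d / 2 ^ S n) with (d / 2 ^ n / 2) by (simpl; field; apply pow_nonzero; lra).
      apply (Hnext (t n) (Hin n)), IH. }
  assert (HT : forall n, Cmod (T (a, b, c)) <= 4 ^ n * Cmod (T (t n))).
  { induction n as [|n IH]; [simpl; lra|].
    destruct (Hnext (t n) (Hin n)) as (_ & H & _).
    change (t (S n)) with (next (t n)).
    eapply Rle_trans; [exact IH|]. simpl.
    replace (4 * 4 ^ n * Cmod (T (next (t n)))) with (4 ^ n * (4 * Cmod (T (next (t n))))) by ring.
    apply Rmult_le_compat_l; [apply pow_le; lra | exact H]. }
  destruct (geometric_Cauchy_limit_C (fun n => first (t n)) d) as [z Hz].
  { intros n. apply (Hnext (t n) (Hin n)), Hsides. }
  assert (Hzr : cball rho z).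
  { unfold cball. apply Rnot_lt_le. intros Hlt.
    destruct (half_power_small (4 * d) (Cmod z - rho)) as [n Hn]; [lra|lra|].
    specialize (Hz n). specialize (Hin n).
    assert (Cmod (first (t n)) <= rho).
    { destruct (t n) as [[a' b'] c']. apply Hin. }
    generalize (Cmod_triangle_rev z (first (t n))). rewrite Cmod_minus_sym. lra. }
  destruct (f_der z Hzr) as [l Hl].
  (* At stage n the sides are at most e = d / 2^n and the vertices lie within 4 e + e of the limit
     point, so each of the three sides contributes at most e times eps times 5 e; the factor 4^n
     cancels the two factors 2^(-n). *)
  assert (Hsmall : forall eps, 0 < eps -> Cmod (T (a, b, c)) <= 15 * eps * d ^ 2).
  { intros eps Heps.
    destruct (proj1 (locally_C_Cmod _ _) (proj1 (der_eps _ _ _ _) Hl eps Heps)) as (dl & Hdl & Hloc).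
    destruct (half_power_small (5 * d) dl) as [n Hn]; [lra|exact Hdl|].
    eapply Rle_trans; [apply (HT n)|].
    set (e := d / 2 ^ n). assert (He : 0 <= e).
    { apply Rmult_le_pos; [exact Hd | left; apply Rinv_0_lt_compat, pow_lt; lra]. }
    replace (15 * eps * d ^ 2) with (4 ^ n * (3 * (e * (eps * (5 * e))))).
    2:{ unfold e. replace 4 with (2 * 2) at 1 by ring. rewrite Rpow_mult_distr.
        field. apply pow_nonzero; lra. }
    apply Rmult_le_compat_l; [apply pow_le; lra|].
    specialize (Hz n). specialize (Hin n). specialize (Hsides n).
    replace (4 * d / 2 ^ n) with (4 * e) in Hz by (unfold e; field; apply pow_nonzero; lra).
    replace (5 * d / 2 ^ n) with (5 * e) in Hn by (unfold e; field; apply pow_nonzero; lra).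
    fold e in Hsides.
    destruct (t n) as [[a' b'] c']. simpl in Hin, Hsides, Hz |- *.
    destruct Hin as (Ha' & Hb' & Hc'), Hsides as (S1 & S2 & S3).
    assert (Va : Cmod (a' - z)%C <= 5 * e) by lra.
    assert (Vb : Cmod (b' - z)%C <= 5 * e).
    { replace (b' - z)%C with ((b' - a') + (a' - z))%C by ring.
      eapply Rle_trans; [apply Cmod_triangle|]. lra. }
    assert (Vc : Cmod (c' - z)%C <= 5 * e).
    { replace (c' - z)%C with ((a' - z) - (a' - c'))%C by ring.
      eapply Rle_trans; [apply Cmod_triangle_minus|]. lra. }
    set (q := fun w => (f w - f z - l * (w - z))%C).
    set (A := fun w => (f z + l * (w - z))%C).
    assert (A_cont : forall w, cball rho w -> continuous A w).
    { intros w _. apply continuous_Cplus; [apply continuous_const|].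
      apply continuous_Cmult; [apply continuous_const|].
      apply continuous_Cminus; [apply continuous_id | apply continuous_const]. }
    assert (q_cont : forall w, cball rho w -> continuous q w).
    { intros w Hw. apply continuous_C_ext with (fun w => f w - A w)%C.
      { intros y. unfold A, q. ring. }
      apply continuous_Cminus; [now apply f_cont | now apply A_cont]. }
    assert (Hsum : forall x y, cball rho x -> cball rho y -> seg f x y = (seg q x y + seg A x y)%C).
    { intros x y Hx Hy. unfold seg. rewrite <- Cmult_plus_distr_l. f_equal.
      rewrite <- CInt_plus.
      - apply CInt_ext. intros s _. unfold q, A. ring.
      - apply (ex_CInt_segment rho q q_cont); trivial; lra.
      - apply (ex_CInt_segment rho A A_cont); trivial; lra. }
    (* A primitive of the affine part of [f], whose integral around the triangle therefore
       telescopes to 0. *)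
    set (P := fun w => ((f z - l * z) * w + l / 2 * (w * w))%C).
    assert (HA : forall x y, cball rho x -> cball rho y -> seg A x y = (P y - P x)%C).
    { intros x y Hx Hy. apply (seg_primitive rho A A_cont); trivial.
      intros w _. eapply der_eq.
      - apply der_plus; [apply der_scal, der_var|].
        apply der_scal, der_mult; [apply continuous_C_id | apply der_var | apply der_var].
      - unfold A. field. }
    assert (Hq : forall x y, cball rho x -> cball rho y -> Cmod (x - z)%C <= 5 * e ->
      Cmod (y - z)%C <= 5 * e -> Cmod (y - x)%C <= e -> Cmod (seg q x y) <= e * (eps * (5 * e))).
    { intros x y Hx Hy Vx Vy Sxy.
      eapply Rle_trans; [apply (seg_norm_le rho q q_cont _ _ (eps * (5 * e))); trivial|].
      - intros s Hs.
        assert (Hw : Cmod (x + RtoC s * (y - x) - z)%C <= 5 * e).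
        { replace (x + RtoC s * (y - x) - z)%C with ((x - z) + RtoC s * ((y - z) - (x - z)))%C by ring.
          now apply cball_segment. }
        eapply Rle_trans; [apply Hloc; lra|]. apply Rmult_le_compat_l; lra.
      - apply Rmult_le_compat_r; [|exact Sxy]. apply Rmult_le_pos; lra. }
    unfold tri. rewrite !Hsum, !HA by assumption.
    replace (seg q a' b' + (P b' - P a') + (seg q b' c' + (P c' - P b')) + (seg q c' a' + (P a' - P c')))%C
      with (seg q a' b' + seg q b' c' + seg q c' a')%C by ring.
    eapply Rle_trans; [apply Cmod_triangle|].
    eapply Rle_trans; [apply Rplus_le_compat_r, Cmod_triangle|].
    pose proof (Hq a' b' Ha' Hb' Va Vb S1). pose proof (Hq b' c' Hb' Hc' Vb Vc S2).
    pose proof (Hq c' a' Hc' Ha' Vc Va S3). lra. }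
  apply Cmod_eq_0. apply Rle_antisym; [|apply Cmod_ge_0].
  change (tri f a b c) with (T (a, b, c)).
  apply Rnot_lt_le. intros Hpos.
  pose proof (Hsmall (Cmod (T (a, b, c)) / (30 * (d ^ 2 + 1)))) as Hf.
  assert (Hd2 : 0 <= d ^ 2) by apply pow2_ge_0.
  specialize (Hf ltac:(apply Rdiv_lt_0_compat; lra)).
  replace (15 * (Cmod (T (a, b, c)) / (30 * (d ^ 2 + 1))) * d ^ 2)
    with (Cmod (T (a, b, c)) * (d ^ 2 / (2 * (d ^ 2 + 1)))) in Hf by (field; lra).
  assert (d ^ 2 / (2 * (d ^ 2 + 1)) < 1).
  { apply Rmult_lt_reg_r with (2 * (d ^ 2 + 1)); [lra|].
    unfold Rdiv. rewrite Rmult_assoc, Rinv_l by lra. lra. }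
  nra.
Qed.

End Goursat.

(** * Cauchy's integral formula *)

(** Differentiation under the integral sign from a quadratic remainder that is uniform in the
    integration variable. The general [i] serves both the complex parameter of Cauchy kernels and
    the real parameter of Beta integrals. *)
Lemma der_CInt {T : UniformSpace} (i : T -> C) (K : T -> R -> C) (D : R -> C)
    (a b M : R) (x : T) :
  a <= b -> continuous i x -> ex_CInt D a b ->
  locally x (fun y => ex_CInt (K y) a b /\ forall t, a <= t <= b ->
    Cmod (K y t - K x t - D t * (i y - i x))%C <= M * Cmod (i y - i x)%C ^ 2) ->
  der i (fun y => CInt (K y) a b) x (CInt D a b).
Proof.
  intros Hab Hi HD H. apply der_eps. intros eps Heps.
  assert (Hx : ex_CInt (K x) a b) by apply (locally_singleton _ _ H).
  assert (HM : 0 < eps / ((b - a) * Rabs M + 1)).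
  { apply Rdiv_lt_0_compat; [exact Heps|]. generalize (Rabs_pos M). nra. }
  generalize (filter_and _ _ H (proj1 (continuous_C_eps i x) Hi _ HM)).
  apply filter_imp. intros y [[Hy HK] Hs].
  set (dl := (i y - i x)%C) in *.
  replace (CInt (K y) a b - CInt (K x) a b - CInt D a b * dl)%C
    with (CInt (fun t => K y t - K x t - dl * D t)%C a b).
  2:{ rewrite CInt_minus, CInt_minus, CInt_scal; trivial. ring.
      now apply ex_CInt_minus. now apply ex_CInt_scal. }
  eapply Rle_trans.
  - apply CInt_norm_le with (M := Rabs M * Cmod dl ^ 2); [exact Hab| |].
    + apply ex_CInt_minus; [now apply ex_CInt_minus | now apply ex_CInt_scal].
    + intros t Ht. rewrite (Cmult_comm dl). eapply Rle_trans; [now apply HK|].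
      apply Rmult_le_compat_r; [apply pow2_ge_0 | apply Rle_abs].
  - replace ((b - a) * (Rabs M * Cmod dl ^ 2)) with (((b - a) * Rabs M * Cmod dl) * Cmod dl) by ring.
    apply Rmult_le_compat_r; [apply Cmod_ge_0|].
    assert (HB : 0 <= (b - a) * Rabs M) by (generalize (Rabs_pos M); nra).
    apply Rle_trans with (((b - a) * Rabs M + 1) * (eps / ((b - a) * Rabs M + 1))).
    + apply Rmult_le_compat; [exact HB | apply Cmod_ge_0 | lra | left; exact Hs].
    + right. field. lra.
Qed.

Lemma cis_0 : cis 0 = RtoC 1.
Proof. unfold cis. now rewrite cos_0, sin_0. Qed.

Lemma cis_2PI : cis (2 * PI) = RtoC 1.
Proof. unfold cis. now rewrite cos_2PI, sin_2PI. Qed.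

Lemma cis_PI : cis PI = RtoC (-1).
Proof. unfold cis. now rewrite cos_PI, sin_PI. Qed.

Lemma cis_plus (x y : R) : cis (x + y) = (cis x * cis y)%C.
Proof. unfold cis. rewrite cos_plus, sin_plus. apply C_ext; simpl; ring. Qed.

Lemma Cmod_cis (x : R) : Cmod (cis x) = 1.
Proof.
  unfold Cmod, cis; simpl. rewrite !Rmult_1_r.
  generalize (sin2_cos2 x). unfold Rsqr. intros H.
  replace (cos x * cos x + sin x * sin x) with 1 by lra. apply sqrt_1.
Qed.

Lemma cis_neq_0 (x : R) : cis x <> RtoC 0.
Proof. intros H. generalize (Cmod_cis x). rewrite H, Cmod_0. lra. Qed.

Lemma Cconj_cis (x : R) : Cconj (cis x) = cis (- x).
Proof. unfold cis. rewrite cos_neg, sin_neg. reflexivity. Qed.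

Lemma cis_opp (x : R) : cis (- x) = (/ cis x)%C.
Proof.
  assert (H : (cis x * cis (- x) = 1)%C) by (rewrite <- cis_plus, Rplus_opp_r; apply cis_0).
  rewrite <- (Cmult_1_l (/ cis x)), <- H. field. apply cis_neq_0.
Qed.

Lemma rder_cis (x : R) : rder cis x (Ci * cis x)%C.
Proof.
  eapply der_eq.
  - apply rder_pair; simpl.
    + apply is_derive_cos.
    + apply is_derive_sin.
  - apply C_ext; simpl; ring.
Qed.

Lemma continuous_cis (x : R) : continuous cis x.
Proof. eapply rder_continuous, rder_cis. Qed.

Definition circle (r t : R) : C := (RtoC r * cis t)%C.

Lemma Cmod_circle (r t : R) : 0 <= r -> Cmod (circle r t) = r.
Proof. intros H. unfold circle. rewrite Cmod_mult, Cmod_R, Cmod_cis, Rabs_pos_eq; lra. Qed.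

Lemma rder_circle (r x : R) : rder (circle r) x (Ci * circle r x)%C.
Proof.
  eapply der_eq; [apply der_scal, rder_cis|]. unfold circle. ring.
Qed.

Lemma continuous_circle (r x : R) : continuous (circle r) x.
Proof. eapply rder_continuous, rder_circle. Qed.

Lemma circle_neq (r t : R) (z : C) : Cmod z < r -> (circle r t - z <> 0)%C.
Proof.
  intros Hz H. assert (Hr : 0 <= r) by (generalize (Cmod_ge_0 z); lra).
  generalize (Cmod_triangle_rev (circle r t) z). rewrite H, Cmod_0, Cmod_circle by exact Hr. lra.
Qed.

Definition holo (f : C -> C) : Prop := forall z, Cmod z < 1 -> exists l, cder f z l.

Lemma holo_continuous (f : C -> C) (z : C) : holo f -> Cmod z < 1 -> continuous f z.
Proof. intros H Hz. destruct (H z Hz) as [l Hl]. eapply cder_continuous, Hl. Qed.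

Lemma holo_cder (f : C -> C) (z : C) : holo f -> Cmod z < 1 -> cder f z (C_derive f z).
Proof. intros H Hz. destruct (H z Hz) as [l Hl]. now rewrite (cder_C_derive _ _ _ Hl). Qed.

Lemma locally_disc (z : C) : Cmod z < 1 -> locally z (fun w => Cmod w < 1).
Proof.
  intros Hz. apply locally_C_Cmod. exists (1 - Cmod z). split; [lra|].
  intros w Hw. generalize (Cmod_triangle_rev w z). lra.
Qed.

Lemma seg_remainder (f g : C -> C) (z w : C) (rho e : R) :
  (forall x, cball rho x -> continuous f x) -> (forall x, cball rho x -> continuous g x) ->
  cball rho z -> cball rho w ->
  (forall t, 0 <= t <= 1 -> Cmod (f (z + RtoC t * (w - z)) - g (z + RtoC t * (w - z)))%C <= e) ->
  Cmod (seg f z w - seg g z w)%C <= Cmod (w - z)%C * e.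
Proof.
  intros Hf Hg Hz Hw H.
  replace (seg f z w - seg g z w)%C with (seg (fun x => f x - g x)%C z w).
  - apply (seg_norm_le rho); trivial. intros x Hx. apply continuous_Cminus; auto.
  - unfold seg. rewrite CInt_minus; [ring| |];
      apply (ex_CInt_segment rho); trivial; lra.
Qed.

Lemma seg_affine (z w c l : C) :
  seg (fun x => c + l * (x - z))%C z w = (c * (w - z) + l / 2 * ((w - z) * (w - z)))%C.
Proof.
  set (rho := Rmax (Cmod z) (Cmod w)).
  rewrite (seg_primitive rho _ ltac:(intros; apply continuous_Cplus;
    [apply continuous_const | apply continuous_Cmult; [apply continuous_const|];
     apply continuous_Cminus; [apply continuous_id | apply continuous_const]])
    (fun x => c * (x - z) + l / 2 * ((x - z) * (x - z)))%C).
  - ring.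
  - apply Rmax_l.
  - apply Rmax_r.
  - intros x _. assert (Hd : cder (fun x => x - z)%C x (RtoC 1)).
    { eapply der_eq; [apply der_minus; [apply der_var | apply der_const]|]. ring. }
    eapply der_eq.
    + apply der_plus; [apply der_scal, Hd|].
      apply der_scal, der_mult; [apply continuous_C_id | exact Hd | exact Hd].
    + cbv beta; field.
Qed.

Section Cauchy.
Variable f : C -> C.
Hypothesis f_holo : holo f.

Definition disc_primitive (w : C) : C := seg f (RtoC 0) w.

Lemma primitive_minus (z w : C) :
  Cmod z < 1 -> Cmod w < 1 -> (disc_primitive w - disc_primitive z = seg f z w)%C.
Proof.
  intros Hz Hw. set (rho := Rmax (Cmod z) (Cmod w)).
  assert (Hrho : rho < 1) by (apply Rmax_lub_lt; assumption).
  assert (H0 : cball rho (RtoC 0)).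
  { unfold cball. rewrite Cmod_0. apply Rle_trans with (Cmod z); [apply Cmod_ge_0 | apply Rmax_l]. }
  assert (Hz' : cball rho z) by apply Rmax_l. assert (Hw' : cball rho w) by apply Rmax_r.
  assert (Hd : forall x, cball rho x -> exists l, cder f x l).
  { intros x Hx. apply f_holo. unfold cball in Hx. lra. }
  generalize (tri_zero rho f Hd _ _ _ H0 Hz' Hw'). unfold tri.
  rewrite (seg_rev rho f) with (a := RtoC 0) (b := w); trivial.
  - unfold disc_primitive. intros H.
    replace (seg f z w) with ((seg f (RtoC 0) z + seg f z w + - seg f (RtoC 0) w)
      + (seg f (RtoC 0) w - seg f (RtoC 0) z))%C by ring.
    rewrite H. ring.
  - intros x Hx. apply holo_continuous; [exact f_holo|]. unfold cball in Hx. lra.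
Qed.

(** Integrating the first-order expansion of [f] along the segment gains one order, although only
    one derivative of [f] at [z] is available at this stage. *)
Lemma primitive_taylor (z : C) (l : C) : Cmod z < 1 -> cder f z l ->
  forall eps, 0 < eps -> locally z (fun w =>
    Cmod (disc_primitive w - disc_primitive z - f z * (w - z) - l / 2 * ((w - z) * (w - z)))%C
      <= eps * Cmod (w - z)%C ^ 2).
Proof.
  intros Hz Hl eps Heps.
  destruct (proj1 (locally_C_Cmod _ _) (proj1 (der_eps _ _ _ _) Hl eps Heps)) as (d & Hd & Hloc).
  apply locally_C_Cmod. exists (Rmin d (1 - Cmod z)).
  split; [apply Rmin_pos; lra|]. intros w Hw.
  assert (Hwd : Cmod (w - z)%C < d) by (eapply Rlt_le_trans; [exact Hw | apply Rmin_l]).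
  assert (Hw1 : Cmod w < 1).
  { assert (Cmod (w - z)%C < 1 - Cmod z) by (eapply Rlt_le_trans; [exact Hw | apply Rmin_r]).
    generalize (Cmod_triangle_rev w z). lra. }
  rewrite primitive_minus by assumption.
  replace (seg f z w - f z * (w - z) - l / 2 * ((w - z) * (w - z)))%C
    with (seg f z w - seg (fun x => f z + l * (x - z))%C z w)%C by (rewrite seg_affine; ring).
  set (rho := Rmax (Cmod z) (Cmod w)).
  assert (Hrho : rho < 1) by (apply Rmax_lub_lt; assumption).
  replace (eps * Cmod (w - z)%C ^ 2) with (Cmod (w - z)%C * (eps * Cmod (w - z)%C)) by ring.
  apply (seg_remainder _ _ _ _ rho).
  - intros x Hx. apply holo_continuous; [exact f_holo|]. unfold cball in Hx. lra.
  - intros x _. apply continuous_Cplus; [apply continuous_const|].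
    apply continuous_Cmult; [apply continuous_const|].
    apply continuous_Cminus; [apply continuous_id | apply continuous_const].
  - apply Rmax_l.
  - apply Rmax_r.
  - intros t Ht. set (x := (z + RtoC t * (w - z))%C).
    assert (Hx : Cmod (x - z)%C <= Cmod (w - z)%C).
    { unfold x. replace (z + RtoC t * (w - z) - z)%C with (RtoC t * (w - z))%C by ring.
      rewrite Cmod_mult, Cmod_R, Rabs_pos_eq by lra.
      generalize (Cmod_ge_0 (w - z)%C). nra. }
    replace (f x - (f z + l * (x - z)))%C with (f x - f z - l * (x - z))%C by ring.
    eapply Rle_trans; [apply Hloc; lra|]. apply Rmult_le_compat_l; lra.
Qed.

Lemma primitive_cder (z : C) : Cmod z < 1 -> cder disc_primitive z (f z).
Proof.
  intros Hz. destruct (f_holo z Hz) as [l Hl]. apply der_eps. intros eps Heps.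
  set (B := 1 + Cmod (l / 2)%C).
  assert (HB : 0 < B) by (unfold B; generalize (Cmod_ge_0 (l / 2)%C); lra).
  assert (HeB : 0 < eps / B) by now apply Rdiv_lt_0_compat.
  generalize (filter_and _ _ (primitive_taylor z l Hz Hl 1 Rlt_0_1)
    (proj1 (continuous_C_eps _ _) (continuous_C_id z) _ HeB)).
  apply filter_imp. intros w [H1 H2].
  replace (disc_primitive w - disc_primitive z - f z * (w - z))%C with
    ((disc_primitive w - disc_primitive z - f z * (w - z) - l / 2 * ((w - z) * (w - z)))
      + l / 2 * ((w - z) * (w - z)))%C by ring.
  eapply Rle_trans; [apply Cmod_triangle|].
  rewrite (Cmod_mult (l / 2)), Cmod_mult.
  set (m := Cmod (w - z)%C) in *. assert (Hm : 0 <= m) by apply Cmod_ge_0.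
  apply Rle_trans with (B * m * m); [unfold B; nra|].
  apply Rmult_le_compat_r; [exact Hm|].
  apply Rle_trans with (B * (eps / B)); [nra|]. right. field. lra.
Qed.

Lemma circle_integral_zero (r : R) : 0 <= r < 1 ->
  CInt (fun t => circle r t * f (circle r t))%C 0 (2 * PI) = RtoC 0.
Proof.
  intros Hr.
  assert (Hc : forall x, Cmod (circle r x) < 1) by (intros; rewrite Cmod_circle; lra).
  rewrite (CInt_rder (fun t => - Ci * disc_primitive (circle r t))%C).
  - unfold circle. rewrite cis_0, cis_2PI. ring.
  - intros x _. eapply der_eq.
    + apply der_scal, rder_comp; [apply primitive_cder, Hc | apply rder_circle].
    + assert (E : (Ci * Ci = -1)%C) by (apply C_ext; simpl; ring).
      replace (- Ci * (f (circle r x) * (Ci * circle r x)))%C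
        with (- (Ci * Ci) * (circle r x * f (circle r x)))%C by ring.
      rewrite E. ring.
  - intros x _. apply continuous_Cmult; [apply continuous_circle|].
    apply (continuous_comp (circle r) f); [apply continuous_circle|].
    now apply holo_continuous.
Qed.

End Cauchy.

(** With q = z / w the kernel is 1 / (1 - q). The powers q^n, n >= 1, integrate to 0 because each is
    the derivative of a periodic function, and the tail of the geometric series is of order
    rho^n. *)
Lemma CInt_circle_kernel (r : R) (z : C) : Cmod z < r ->
  CInt (fun t => circle r t / (circle r t - z))%C 0 (2 * PI) = RtoC (2 * PI).
Proof.
  intros Hz. assert (Hr : 0 < r) by (generalize (Cmod_ge_0 z); lra).
  assert (Hr0 : RtoC r <> RtoC 0) by (intros E; apply RtoC_inj in E; lra).
  assert (Hc0 : forall t, circle r t <> RtoC 0).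
  { intros t. apply Cmult_neq_0; [exact Hr0 | apply cis_neq_0]. }
  set (q := fun t => (z / circle r t)%C).
  set (rho := Cmod z / r).
  assert (Hrho : 0 <= rho < 1).
  { unfold rho. split; [apply Rmult_le_pos; [apply Cmod_ge_0 | left; now apply Rinv_0_lt_compat]|].
    apply Rmult_lt_reg_r with r; [exact Hr|]. unfold Rdiv. rewrite Rmult_assoc, Rinv_l; lra. }
  assert (Hq : forall t, Cmod (q t) = rho).
  { intros t. unfold q. rewrite Cmod_div by apply Hc0. rewrite Cmod_circle by lra. reflexivity. }
  assert (Hq1 : forall t, (1 - q t <> 0)%C).
  { intros t E. generalize (Cmod_triangle_rev 1 (q t)). rewrite E, Cmod_0, Cmod_1, Hq. lra. }
  assert (Dq : forall t, rder q t (- Ci * q t)%C).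
  { intros t. unfold q. eapply der_eq.
    - apply der_div; [apply continuous_RtoC_id | apply Hc0 | apply der_const | apply rder_circle].
    - cbv beta; field. apply Hc0. }
  assert (Dqn : forall n t, rder (fun t => q t ^ n)%C t (- RtoC (INR n) * Ci * q t ^ n)%C).
  { induction n as [|n IH]; intros t.
    - simpl. eapply der_eq; [apply der_const|]. ring.
    - simpl Cpow. eapply der_eq.
      + apply der_mult; [apply continuous_RtoC_id | apply Dq | apply IH].
      + rewrite S_INR, RtoC_plus. ring. }
  assert (Cqn : forall n t, continuous (fun t => q t ^ n)%C t)
    by (intros; eapply rder_continuous, Dqn).
  assert (Cq1 : forall t, continuous (fun t => / (1 - q t))%C t).
  { intros t. apply continuous_Cinv; [apply Hq1|].
    apply continuous_Cminus; [apply continuous_const|]. eapply rder_continuous, Dq. }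
  assert (Cs : forall n t, continuous (fun t => q t ^ n / (1 - q t))%C t)
    by (intros; apply continuous_Cmult; [apply Cqn | apply Cq1]).
  assert (In : forall n, CInt (fun t => q t ^ S n)%C 0 (2 * PI) = RtoC 0).
  { intros n.
    assert (Hn : (- RtoC (INR (S n)) * Ci <> 0)%C).
    { apply Cmult_neq_0; [|apply Ci_nz]. intros E.
      apply (f_equal Re) in E. rewrite re_opp, !re_RtoC in E.
      generalize (lt_0_INR (S n) ltac:(lia)). lra. }
    rewrite (CInt_rder (fun t => / (- RtoC (INR (S n)) * Ci) * q t ^ S n)%C).
    - unfold q, circle. rewrite cis_0, cis_2PI. ring.
    - intros x _. eapply der_eq; [apply der_scal, Dqn|].
      set (cn := (- RtoC (INR (S n)) * Ci)%C) in *. field. exact Hn.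
    - intros x _. apply Cqn. }
  assert (Jn : forall n, CInt (fun t => / (1 - q t))%C 0 (2 * PI)
    = (RtoC (2 * PI) + CInt (fun t => q t ^ S n / (1 - q t))%C 0 (2 * PI))%C).
  { induction n as [|n IH].
    - rewrite (CInt_ext (fun t => / (1 - q t))%C (fun t => 1 + q t ^ 1 / (1 - q t))%C).
      + rewrite CInt_plus, CInt_const.
        * f_equal. rewrite Rminus_0_r. ring.
        * apply ex_CInt_const.
        * apply ex_CInt_continuous. intros; apply Cs.
      + intros x _. simpl. field. apply Hq1.
    - rewrite IH. f_equal.
      rewrite (CInt_ext (fun t => q t ^ S n / (1 - q t))%C
        (fun t => q t ^ S n + q t ^ S (S n) / (1 - q t))%C).
      + rewrite CInt_plus, In; [ring| |]; apply ex_CInt_continuous; intros; [apply Cqn | apply Cs].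
      + intros x _. simpl. field. apply Hq1. }
  rewrite (CInt_ext _ (fun t => / (1 - q t))%C).
  2:{ intros x _. unfold q. field. split; [apply Hc0|].
      now apply circle_neq. }
  set (J := CInt (fun t => / (1 - q t))%C 0 (2 * PI)) in *.
  assert (HPI := PI_RGT_0).
  assert (Hb : forall n, Cmod (J - RtoC (2 * PI))%C <= 2 * PI * (rho ^ S n / (1 - rho))).
  { intros n. rewrite (Jn n).
    replace (RtoC (2 * PI) + CInt (fun t => q t ^ S n / (1 - q t)) 0 (2 * PI) - RtoC (2 * PI))%C
      with (CInt (fun t => q t ^ S n / (1 - q t)) 0 (2 * PI))%C by ring.
    replace (2 * PI * (rho ^ S n / (1 - rho))) with ((2 * PI - 0) * (rho ^ S n / (1 - rho))) by ring.
    apply CInt_norm_le; [lra|apply ex_CInt_continuous; intros; apply Cs|].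
    intros x _. rewrite Cmod_div, Cmod_pow, Hq by apply Hq1.
    apply Rmult_le_compat_l; [apply pow_le; lra|].
    apply Rinv_le_contravar; [lra|].
    generalize (Cmod_triangle_rev 1 (q x)). rewrite Cmod_1, Hq. lra. }
  replace J with (J - RtoC (2 * PI) + RtoC (2 * PI))%C by ring.
  replace (J - RtoC (2 * PI))%C with (RtoC 0); [ring|].
  symmetry. apply Cmod_eq_0, Rle_antisym; [|apply Cmod_ge_0].
  apply Rnot_lt_le. intros Hpos. set (e := Cmod (J - RtoC (2 * PI))%C) in *.
  destruct (pow_lt_1_zero rho ltac:(rewrite Rabs_pos_eq; lra) (e * (1 - rho) / (2 * PI))
    ltac:(apply Rdiv_lt_0_compat; nra)) as [N HN].
  specialize (HN (S N) ltac:(lia)). rewrite Rabs_pos_eq in HN by (apply pow_le; lra).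
  specialize (Hb N).
  assert (2 * PI * (rho ^ S N / (1 - rho)) < e); [|lra].
  apply Rmult_lt_reg_r with ((1 - rho) / (2 * PI)); [apply Rdiv_lt_0_compat; lra|].
  replace (2 * PI * (rho ^ S N / (1 - rho)) * ((1 - rho) / (2 * PI))) with (rho ^ S N) by (field; lra).
  lra.
Qed.

(* The quotient is differentiable also at [z], since the primitive has a second
   order expansion there; no theorem on removable singularities is needed. *)
Lemma holo_difference_quotient (f : C -> C) (z : C) : holo f -> Cmod z < 1 ->
  holo (fun w => if Ceq_dec w z then f z else ((disc_primitive f w - disc_primitive f z) / (w - z))%C).
Proof.
  intros Hf Hz1. set (F := disc_primitive f).
  assert (DF : forall w, Cmod w < 1 -> cder F w (f w)) by (intros; now apply primitive_cder).
  set (g := fun w => if Ceq_dec w z then f z else ((F w - F z) / (w - z))%C).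
  intros w Hw. destruct (Ceq_dec w z) as [->|Hwz].
    - destruct (Hf z Hz1) as [l Hl]. exists (l / 2)%C. apply der_eps. intros eps Heps.
      generalize (primitive_taylor f Hf z l Hz1 Hl eps Heps). apply filter_imp.
      intros x Hx. unfold g. destruct (Ceq_dec z z) as [_|n]; [|now elim n].
      destruct (Ceq_dec x z) as [->|Hxz].
      + replace (f z - f z - l / 2 * (z - z))%C with (RtoC 0) by ring.
        rewrite Cmod_0. apply Rmult_le_pos; [lra | apply Cmod_ge_0].
      + assert (Hxz' : (x - z <> 0)%C) by now apply Cminus_eq_contra.
        assert (Hp : 0 < Cmod (x - z)%C) by now apply Cmod_gt_0.
        apply Rmult_le_reg_l with (Cmod (x - z)%C); [exact Hp|].
        rewrite <- Cmod_mult.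
        replace ((x - z) * ((F x - F z) / (x - z) - f z - l / 2 * (x - z)))%C
          with (F x - F z - f z * (x - z) - l / 2 * ((x - z) * (x - z)))%C by (field; exact Hxz').
        replace (Cmod (x - z)%C * (eps * Cmod (x - z)%C)) with (eps * Cmod (x - z)%C ^ 2) by ring.
        exact Hx.
    - eexists. apply der_ext_loc with (fun w => (F w - F z) / (w - z))%C.
      + assert (Hn : @locally C_UniformSpace w (fun x : C => (x - z)%C <> RtoC 0)).
        { apply (continuous_C_neq_0 (fun x => x - z)%C).
          - apply continuous_Cminus; [apply continuous_id | apply continuous_const].
          - now apply Cminus_eq_contra. }
        revert Hn. apply filter_imp. intros x Hx. unfold g.
        destruct (Ceq_dec x z) as [->|_]; [|reflexivity]. elim Hx. ring.
      + apply der_div; [apply continuous_C_id | now apply Cminus_eq_contra | |].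
        * apply der_minus; [now apply DF | apply der_const].
        * apply der_minus; [apply der_var | apply der_const].
Qed.

Lemma Cauchy_formula_primitive (f : C -> C) (r : R) (z : C) :
  holo f -> Cmod z < r -> r < 1 ->
  CInt (fun t => disc_primitive f (circle r t) * (circle r t / (circle r t - z)))%C 0 (2 * PI)
  = (RtoC (2 * PI) * disc_primitive f z)%C.
Proof.
  intros Hf Hz Hr1. assert (Hr : 0 < r) by (generalize (Cmod_ge_0 z); lra).
  assert (Hz1 : Cmod z < 1) by lra.
  set (F := disc_primitive f).
  assert (DF : forall w, Cmod w < 1 -> cder F w (f w)) by (intros; now apply primitive_cder).
  set (g := fun w => if Ceq_dec w z then f z else ((F w - F z) / (w - z))%C).
  assert (Hg : holo g) by now apply holo_difference_quotient.
  assert (CF : forall t, continuous (fun t => F (circle r t)) t).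
  { intros t. apply (continuous_comp (circle r) F); [apply continuous_circle|].
    eapply cder_continuous, DF. rewrite Cmod_circle; lra. }
  assert (CK : forall t, continuous (fun t => circle r t / (circle r t - z))%C t).
  { intros t. apply continuous_Cmult; [apply continuous_circle|].
    apply continuous_Cinv; [now apply circle_neq|].
    apply continuous_Cminus; [apply continuous_circle | apply continuous_const]. }
  (* Cauchy's theorem for the difference quotient separates the integral of [F] from the constant
     [F z] times the kernel, whose integral is known. *)
  assert (E := circle_integral_zero g Hg r ltac:(lra)).
  rewrite (CInt_ext _ (fun t => F (circle r t) * (circle r t / (circle r t - z))
     - F z * (circle r t / (circle r t - z)))%C) in E.
  2:{ intros t _. unfold g. pose proof (circle_neq r t z Hz) as Hn.
      destruct (Ceq_dec (circle r t) z) as [e|_]; [elim Hn; rewrite e; ring|].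
      field. exact Hn. }
  assert (XK : ex_CInt (fun t => circle r t / (circle r t - z))%C 0 (2 * PI))
    by (apply ex_CInt_continuous; intros; apply CK).
  rewrite CInt_minus, CInt_scal, CInt_circle_kernel in E; trivial.
  2:{ apply ex_CInt_continuous. intros t _. apply continuous_Cmult; [apply CF | apply CK]. }
  2:{ now apply ex_CInt_scal. }
  match type of E with (?A - ?B = _)%C => replace A with (A - B + B)%C by ring end.
  fold F. rewrite E. ring.
Qed.

(** Here [a] and [b] stand for 1 / (c - w) and 1 / (c - z), and [d] for w - z, so that
    [a - b = d * a * b]. The constant depends only on [n] and the bound [B], which makes the
    remainder uniform over the circle. *)
Lemma inverse_power_remainder (n : nat) (B : R) : exists M, forall a b d : C,
  (a - b = d * a * b)%C -> Cmod a <= B -> Cmod b <= B ->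
  Cmod (a ^ n - b ^ n - RtoC (INR n) * b ^ S n * d)%C <= M * Cmod d ^ 2.
Proof.
  induction n as [|n [M IH]].
  - exists 0. intros a b d _ _ _. simpl.
    replace (1 - 1 - 0 * (b * 1) * d)%C with (RtoC 0) by ring. rewrite Cmod_0. lra.
  - exists (B * M + INR (S n) * (B * B ^ S (S n))). intros a b d Hab Ha Hb.
    replace (a ^ S n - b ^ S n - RtoC (INR (S n)) * b ^ S (S n) * d)%C
      with (a * (a ^ n - b ^ n - RtoC (INR n) * b ^ S n * d)
        + RtoC (INR (S n)) * (d * d) * (a * b ^ S (S n)))%C.
    2:{ rewrite S_INR, RtoC_plus. simpl Cpow.
        replace (a * (a ^ n - b ^ n - RtoC (INR n) * (b * b ^ n) * d) +
          (RtoC (INR n) + 1) * (d * d) * (a * (b * (b * b ^ n))))%C with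
          (a * a ^ n - a * b ^ n + (d * a * b) * b ^ n
            + (RtoC (INR n) + 1) * d * b * b ^ n * (d * a * b - a))%C by ring.
        rewrite <- Hab. ring. }
    assert (HB : 0 <= B) by (generalize (Cmod_ge_0 a); lra).
    eapply Rle_trans; [apply Cmod_triangle|].
    rewrite (Cmod_mult a), !Cmod_mult, Cmod_R, Cmod_pow, (Rabs_pos_eq (INR (S n))) by apply pos_INR.
    specialize (IH a b d Hab Ha Hb).
    rewrite Rmult_plus_distr_r. apply Rplus_le_compat.
    + rewrite Rmult_assoc. apply Rmult_le_compat; trivial; apply Cmod_ge_0.
    + replace (INR (S n) * (B * B ^ S (S n)) * Cmod d ^ 2)
        with (INR (S n) * (Cmod d * Cmod d) * (B * B ^ S (S n))) by ring.
      apply Rmult_le_compat_l.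
      * apply Rmult_le_pos; [apply pos_INR|]. apply Rmult_le_pos; apply Cmod_ge_0.
      * apply Rmult_le_compat; [apply Cmod_ge_0 | apply pow_le, Cmod_ge_0 | exact Ha |].
        apply pow_incr. split; [apply Cmod_ge_0 | exact Hb].
Qed.

Lemma cder_Cauchy_kernel (u : R -> C) (r : R) (n : nat) (z : C) :
  (forall t, continuous u t) -> Cmod z < r ->
  cder (fun z => CInt (fun t => u t * (/ (circle r t - z)) ^ n)%C 0 (2 * PI)) z
    (RtoC (INR n) * CInt (fun t => u t * (/ (circle r t - z)) ^ S n)%C 0 (2 * PI))%C.
Proof.
  intros Hu Hz. assert (Hr : 0 < r) by (generalize (Cmod_ge_0 z); lra).
  assert (HPI := PI_RGT_0).
  assert (Cont : forall w m t, Cmod w < r -> continuous (fun t => u t * (/ (circle r t - w)) ^ m)%C t).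
  { intros w m t Hw. apply continuous_Cmult; [apply Hu|].
    induction m as [|m IH]; simpl; [apply continuous_const|].
    apply continuous_Cmult; [|exact IH]. apply continuous_Cinv; [now apply circle_neq|].
    apply continuous_Cminus; [apply continuous_circle | apply continuous_const]. }
  assert (Ex : forall w m, Cmod w < r -> ex_CInt (fun t => u t * (/ (circle r t - w)) ^ m)%C 0 (2 * PI)).
  { intros w m Hw. apply ex_CInt_continuous. intros t _. now apply Cont. }
  (* Half the distance from [z] to the circle: for parameters within [e] of [z] all kernels are
     bounded by 1 / e. *)
  set (e := (r - Cmod z) / 2). assert (He : 0 < e) by (unfold e; lra).
  destruct (inverse_power_remainder n (/ e)) as [M HM].
  assert (Hbu : exists U, forall t, 0 <= t <= 2 * PI -> Cmod (u t) <= U).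
  { destruct (continuity_ab_maj (fun t => Cmod (u t)) 0 (2 * PI)) as (x & Hx & _); [lra| |].
    - intros t _. apply continuity_pt_filterlim.
      apply continuous_Cmod_comp, Hu.
    - exists (Cmod (u x)). exact Hx. }
  destruct Hbu as [U HU].
  rewrite <- CInt_scal by now apply Ex.
  apply der_CInt with (M := U * M).
  - lra.
  - apply continuous_C_id.
  - now apply ex_CInt_scal, Ex.
  - apply locally_C_Cmod. exists e. split; [exact He|]. intros w Hw.
    assert (Hwr : Cmod w < r - e).
    { generalize (Cmod_triangle_rev w z). unfold e in *. lra. }
    split; [apply Ex; lra|]. intros t Ht.
    assert (Hinv : forall y, Cmod y <= r - e -> Cmod (/ (circle r t - y))%C <= / e).
    { intros y Hy. rewrite Cmod_inv by (apply circle_neq; lra).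
      apply Rinv_le_contravar; [exact He|].
      generalize (Cmod_triangle_rev (circle r t) y). rewrite Cmod_circle by lra. lra. }
    set (a := (/ (circle r t - w))%C). set (b := (/ (circle r t - z))%C).
    replace (u t * a ^ n - u t * b ^ n - RtoC (INR n) * (u t * b ^ S n) * (w - z))%C
      with (u t * (a ^ n - b ^ n - RtoC (INR n) * b ^ S n * (w - z)))%C by ring.
    rewrite Cmod_mult, Rmult_assoc. apply Rmult_le_compat; try apply Cmod_ge_0.
    + now apply HU.
    + apply HM.
      * unfold a, b. field. split; apply circle_neq; lra.
      * apply Hinv. lra.
      * apply Hinv. unfold e. lra.
Qed.

(** Cauchy's formula is known for the primitive [F] first. Differentiating it under the integral
    gives [f] as [Phi 2] and then f' as twice [Phi 3], and every [Phi n] is differentiable. *)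
Lemma holo_C_derive (f : C -> C) : holo f -> holo (C_derive f).
Proof.
  intros Hf z Hz. set (r := (1 + Cmod z) / 2).
  assert (Hr : Cmod z < r < 1) by (unfold r; lra).
  assert (Hr0 : 0 < r) by (generalize (Cmod_ge_0 z); lra).
  assert (HPI := PI_RGT_0).
  assert (HP : RtoC (2 * PI) <> RtoC 0) by (intros E; apply RtoC_inj in E; lra).
  set (F := disc_primitive f).
  assert (DF : forall w, Cmod w < 1 -> cder F w (f w)) by (intros; now apply primitive_cder).
  set (u := fun t => (/ RtoC (2 * PI) * (F (circle r t) * circle r t))%C).
  assert (Hu : forall t, continuous u t).
  { intros t. apply continuous_Cmult; [apply continuous_const|].
    apply continuous_Cmult; [|apply continuous_circle].
    apply (continuous_comp (circle r) F); [apply continuous_circle|].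
    eapply cder_continuous, DF. rewrite Cmod_circle; lra. }
  set (Phi := fun n z => CInt (fun t => u t * (/ (circle r t - z)) ^ n)%C 0 (2 * PI)).
  assert (DPhi : forall n w, Cmod w < r -> cder (Phi n) w (RtoC (INR n) * Phi (S n) w)%C).
  { intros n w Hw. now apply cder_Cauchy_kernel. }
  assert (Loc : forall w, Cmod w < r -> locally w (fun x => Cmod x < r)).
  { intros w Hw. apply locally_C_Cmod. exists (r - Cmod w). split; [lra|].
    intros x Hx. generalize (Cmod_triangle_rev x w). lra. }
  assert (E1 : forall w, Cmod w < r -> Phi 1%nat w = F w).
  { intros w Hw. unfold Phi. rewrite (CInt_ext _ (fun t => / RtoC (2 * PI) *
      (F (circle r t) * (circle r t / (circle r t - w))))%C).
    - rewrite CInt_scal.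
      + unfold F. rewrite (Cauchy_formula_primitive f r w Hf Hw (proj2 Hr)). field. exact HP.
      + apply ex_CInt_continuous. intros t _. apply continuous_Cmult.
        * apply (continuous_comp (circle r) F); [apply continuous_circle|].
          eapply cder_continuous, DF. rewrite Cmod_circle; lra.
        * apply continuous_Cmult; [apply continuous_circle|].
          apply continuous_Cinv; [now apply circle_neq|].
          apply continuous_Cminus; [apply continuous_circle | apply continuous_const].
    - intros t _. unfold u. simpl. unfold Cdiv. ring. }
  assert (E2 : forall w, Cmod w < r -> f w = Phi 2%nat w).
  { intros w Hw. apply (cder_unique F w); [apply DF; lra|].
    apply der_ext_loc with (Phi 1%nat).
    - generalize (Loc w Hw). apply filter_imp. exact E1.
    - eapply der_eq; [apply DPhi, Hw|]. simpl. ring. }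
  assert (E3 : forall w, Cmod w < r -> C_derive f w = (2 * Phi 3%nat w)%C).
  { intros w Hw. apply cder_C_derive. apply der_ext_loc with (Phi 2%nat).
    - generalize (Loc w Hw). apply filter_imp. intros x Hx. symmetry. now apply E2.
    - eapply der_eq; [apply DPhi, Hw|]. reflexivity. }
  eexists. apply der_ext_loc with (fun w => 2 * Phi 3%nat w)%C.
  - generalize (Loc z (proj1 Hr)). apply filter_imp. intros x Hx. symmetry. now apply E3.
  - apply der_scal, DPhi, Hr.
Qed.

Lemma disc_primitive_eq (F f : C -> C) (z : C) : holo f ->
  (forall w, Cmod w < 1 -> cder F w (f w)) -> Cmod z < 1 ->
  disc_primitive f z = (F z - F (RtoC 0))%C.
Proof.
  intros Hf HF Hz. unfold disc_primitive.
  apply (seg_primitive (Cmod z) _ (fun x Hx => holo_continuous f x Hf (Rle_lt_trans _ _ _ Hx Hz))).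
  - unfold cball. rewrite Cmod_0. apply Cmod_ge_0.
  - apply Rle_refl.
  - intros x Hx. apply HF. unfold cball in Hx. lra.
Qed.

(** Since f' is now known to be holomorphic, [f] is a constant plus a primitive, and the formula for
    primitives extends to it. *)
Lemma Cauchy_formula (f : C -> C) (r : R) (z : C) :
  holo f -> Cmod z < r -> r < 1 ->
  CInt (fun t => f (circle r t) * (circle r t / (circle r t - z)))%C 0 (2 * PI)
  = (RtoC (2 * PI) * f z)%C.
Proof.
  intros Hf Hz Hr. assert (Hf' := holo_C_derive f Hf).
  assert (E : forall w, Cmod w < 1 -> f w = (f (RtoC 0) + disc_primitive (C_derive f) w)%C).
  { intros w Hw. rewrite (disc_primitive_eq f) by (trivial; intros; now apply holo_cder). ring. }
  assert (H0 : 0 < r) by (generalize (Cmod_ge_0 z); lra).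
  assert (CK : forall t, continuous (fun t => circle r t / (circle r t - z))%C t).
  { intros t. apply continuous_Cmult; [apply continuous_circle|].
    apply continuous_Cinv; [now apply circle_neq|].
    apply continuous_Cminus; [apply continuous_circle | apply continuous_const]. }
  rewrite (CInt_ext _ (fun t => f (RtoC 0) * (circle r t / (circle r t - z))
    + disc_primitive (C_derive f) (circle r t) * (circle r t / (circle r t - z)))%C).
  2:{ intros t _. rewrite E at 1 by (rewrite Cmod_circle; lra). ring. }
  rewrite CInt_plus, CInt_scal, CInt_circle_kernel, Cauchy_formula_primitive; trivial.
  - rewrite (E z) at 1 by lra. ring.
  - apply ex_CInt_continuous. intros; apply CK.
  - apply ex_CInt_scal, ex_CInt_continuous. intros; apply CK.
  - apply ex_CInt_continuous. intros t _. apply continuous_Cmult; [|apply CK].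
    apply (continuous_comp (circle r) (disc_primitive (C_derive f))); [apply continuous_circle|].
    eapply cder_continuous, primitive_cder; [exact Hf'|]. rewrite Cmod_circle; lra.
Qed.

(** * Mean value inequalities; the logarithm and powers on the right half-plane *)

(** Projecting on the direction [c = f b - f a] reduces to the real mean value theorem for the real
    part of conj c times f. *)
Lemma rder_mean_value (f df : R -> C) (a b M : R) :
  a <= b -> (forall t, a <= t <= b -> rder f t (df t)) ->
  (forall t, a <= t <= b -> Cmod (df t) <= M) ->
  Cmod (f b - f a)%C <= M * (b - a).
Proof.
  intros Hab Hf HM. set (c := (f b - f a)%C).
  set (g := fun t => Re (Cconj c * f t)%C).
  assert (Dg : forall t, a <= t <= b -> is_derive g t (Re (Cconj c * df t)%C)).
  { intros t Ht. apply (rder_Re (fun t => Cconj c * f t)%C), der_scal, Hf, Ht. }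
  destruct (MVT_gen g a b (fun t => Re (Cconj c * df t)%C)) as (x & Hx & E).
  - intros t Ht. rewrite Rmin_left, Rmax_right in Ht by exact Hab. apply Dg; lra.
  - intros t Ht. rewrite Rmin_left, Rmax_right in Ht by exact Hab.
    apply continuity_pt_filterlim.
    apply (ex_derive_continuous (K := R_AbsRing) (V := R_NormedModule)). eexists; apply Dg; lra.
  - rewrite Rmin_left, Rmax_right in Hx by exact Hab.
    assert (E' : Cmod c ^ 2 = g b - g a).
    { unfold g, c. rewrite Cmod2_alt. destruct (f a), (f b); simpl; ring. }
    rewrite E in E'.
    assert (H1 : Re (Cconj c * df x)%C <= Cmod c * M).
    { eapply Rle_trans; [apply Rle_abs|]. eapply Rle_trans; [apply re_le_Cmod|].
      rewrite Cmod_mult, Cmod_conj. apply Rmult_le_compat_l; [apply Cmod_ge_0 | now apply HM]. }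
    destruct (Req_dec (Cmod c) 0) as [H0|H0].
    + rewrite H0. apply Rmult_le_pos; [|lra].
      eapply Rle_trans; [apply Cmod_ge_0 | apply (HM a); lra].
    + assert (0 < Cmod c) by (generalize (Cmod_ge_0 c); lra).
      apply Rmult_le_reg_l with (Cmod c); [assumption|].
      replace (Cmod c * Cmod c) with (Cmod c ^ 2) by ring. rewrite E'. nra.
Qed.

Lemma cder_mean_value (F dF : C -> C) (z w : C) (M : R) :
  (forall t, 0 <= t <= 1 -> cder F (z + RtoC t * (w - z))%C (dF (z + RtoC t * (w - z))%C)) ->
  (forall t, 0 <= t <= 1 -> Cmod (dF (z + RtoC t * (w - z))%C) <= M) ->
  Cmod (F w - F z)%C <= M * Cmod (w - z)%C.
Proof.
  intros HF HM.
  replace (F w) with (F (z + RtoC 1 * (w - z))%C) by (f_equal; ring).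
  replace (F z) with (F (z + RtoC 0 * (w - z))%C) by (f_equal; ring).
  replace (M * Cmod (w - z)%C) with (M * Cmod (w - z)%C * (1 - 0)) by ring.
  apply (rder_mean_value (fun t => F (z + RtoC t * (w - z))%C)
    (fun t => dF (z + RtoC t * (w - z)) * (w - z))%C); [lra| |].
  - intros t Ht. apply rder_comp; [now apply HF | apply rder_line].
  - intros t Ht. rewrite Cmod_mult. apply Rmult_le_compat_r; [apply Cmod_ge_0 | now apply HM].
Qed.

(** The mean value inequality applied twice, hence the bound [M] instead of M / 2. *)
Lemma cder_taylor (F dF ddF : C -> C) (z w : C) (M : R) :
  (forall t, 0 <= t <= 1 -> cder F (z + RtoC t * (w - z))%C (dF (z + RtoC t * (w - z))%C)) ->
  (forall t, 0 <= t <= 1 -> cder dF (z + RtoC t * (w - z))%C (ddF (z + RtoC t * (w - z))%C)) ->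
  (forall t, 0 <= t <= 1 -> Cmod (ddF (z + RtoC t * (w - z))%C) <= M) ->
  Cmod (F w - F z - dF z * (w - z))%C <= M * Cmod (w - z)%C ^ 2.
Proof.
  intros HF HdF HM.
  replace (F w - F z - dF z * (w - z))%C
    with ((F w - dF z * (w - z)) - (F z - dF z * (z - z)))%C by ring.
  replace (M * Cmod (w - z)%C ^ 2) with (M * Cmod (w - z)%C * Cmod (w - z)%C) by ring.
  apply (cder_mean_value (fun x => F x - dF z * (x - z))%C (fun x => dF x - dF z)%C).
  - intros t Ht. apply der_minus; [now apply HF|].
    eapply der_eq; [apply der_scal, der_minus; [apply der_var | apply der_const]|]. ring.
  - intros t Ht. set (x := (z + RtoC t * (w - z))%C).
    assert (Hx : Cmod (x - z)%C <= Cmod (w - z)%C).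
    { unfold x. replace (z + RtoC t * (w - z) - z)%C with (RtoC t * (w - z))%C by ring.
      rewrite Cmod_mult, Cmod_R, Rabs_pos_eq by lra. generalize (Cmod_ge_0 (w - z)%C). nra. }
    assert (HM0 : 0 <= M) by (eapply Rle_trans; [apply Cmod_ge_0 | apply (HM 0); lra]).
    apply Rle_trans with (M * Cmod (x - z)%C); [|apply Rmult_le_compat_l; assumption].
    assert (Hs : forall s, 0 <= s <= 1 ->
      (z + RtoC s * (x - z) = z + RtoC (s * t) * (w - z))%C /\ 0 <= s * t <= 1).
    { intros s Hs. split; [unfold x; rewrite RtoC_mult; ring | nra]. }
    apply (cder_mean_value dF ddF); intros s Hs'; destruct (Hs s Hs') as [-> Hst]; auto.
Qed.

Lemma exp_le (x y : R) : x <= y -> exp x <= exp y.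
Proof. intros [H | ->]; [left; now apply exp_increasing | apply Rle_refl]. Qed.

Lemma Cexp_plus (z w : C) : Cexp (z + w)%C = (Cexp z * Cexp w)%C.
Proof.
  unfold Cexp. rewrite re_plus, im_plus, exp_plus, cis_plus, RtoC_mult. ring.
Qed.

Lemma Cexp_0 : Cexp (RtoC 0) = RtoC 1.
Proof. unfold Cexp. simpl. rewrite exp_0, cis_0. ring. Qed.

Lemma Cmod_Cexp (z : C) : Cmod (Cexp z) = exp (Re z).
Proof.
  unfold Cexp. rewrite Cmod_mult, Cmod_cis, Cmod_R, Rabs_pos_eq by (left; apply exp_pos). ring.
Qed.

Lemma Cexp_neq_0 (z : C) : Cexp z <> RtoC 0.
Proof. apply Cmod_gt_0. rewrite Cmod_Cexp. apply exp_pos. Qed.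

Lemma Cexp_opp (z : C) : Cexp (- z)%C = (/ Cexp z)%C.
Proof.
  assert (H : (Cexp z * Cexp (- z) = 1)%C).
  { rewrite <- Cexp_plus. replace (z + - z)%C with (RtoC 0) by ring. apply Cexp_0. }
  rewrite <- (Cmult_1_l (/ Cexp z)), <- H. field. apply Cexp_neq_0.
Qed.

Lemma rder_Cexp_line (z d : C) (t : R) :
  rder (fun t => Cexp (z + RtoC t * d)%C) t (d * Cexp (z + RtoC t * d)%C)%C.
Proof.
  set (x := Re z). set (a := Re d). set (y := Im z). set (b := Im d).
  assert (E : forall t, Cexp (z + RtoC t * d)%C
    = (exp (x + t * a) * cos (y + t * b), exp (x + t * a) * sin (y + t * b))).
  { intros s. unfold Cexp. rewrite re_plus, im_plus, re_scal_l, im_scal_l.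
    apply C_ext; simpl; unfold x, y, a, b, Re, Im; ring. }
  apply der_ext with (fun t => (exp (x + t * a) * cos (y + t * b), exp (x + t * a) * sin (y + t * b)) : C).
  { intros s. now rewrite E. }
  rewrite E. eapply der_eq.
  - apply rder_pair; simpl.
    + auto_derive; [exact I|]. reflexivity.
    + auto_derive; [exact I|]. reflexivity.
  - apply C_ext; simpl; unfold a, b, Re, Im; ring.
Qed.

(** The derivative along a real line is computed in coordinates; the mean value inequality then
    makes the remainder uniform in the direction [d], which upgrades it to a complex derivative.
    [cder_Clog] follows the same pattern. *)
Lemma cder_Cexp (z : C) : cder Cexp z (Cexp z).
Proof.
  apply der_eps. intros eps Heps.
  set (E := exp (Re z + 1)). assert (HE : 0 < E) by apply exp_pos.
  apply locally_C_Cmod. exists (Rmin 1 (eps / E)).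
  split; [apply Rmin_pos; [lra | now apply Rdiv_lt_0_compat]|].
  intros w Hw.
  assert (H1 : Cmod (w - z)%C < 1) by (eapply Rlt_le_trans; [exact Hw | apply Rmin_l]).
  assert (H2 : Cmod (w - z)%C < eps / E) by (eapply Rlt_le_trans; [exact Hw | apply Rmin_r]).
  set (d := (w - z)%C) in *.
  assert (Hb : forall t, 0 <= t <= 1 -> Cmod (Cexp (z + RtoC t * d)%C) <= E).
  { intros t Ht. rewrite Cmod_Cexp. unfold E. rewrite re_plus, re_scal_l.
    apply exp_le, Rplus_le_compat_l.
    generalize (re_le_Cmod d) (Rle_abs (Re d)). intros.
    destruct (Rle_dec (Re d) 0); nra. }
  assert (H3 : forall t, 0 <= t <= 1 ->
    Cmod (Cexp (z + RtoC t * d) - Cexp z)%C <= E * Cmod d).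
  { intros t Ht.
    replace (Cexp z) with (Cexp (z + RtoC 0 * d)%C) by (f_equal; ring).
    apply Rle_trans with (Cmod d * E * (t - 0)).
    - apply (rder_mean_value (fun t => Cexp (z + RtoC t * d)%C) _ _ _ _ (proj1 Ht)
        (fun t _ => rder_Cexp_line z d t)).
      intros s Hs. rewrite Cmod_mult. apply Rmult_le_compat_l; [apply Cmod_ge_0|].
      apply Hb. lra.
    - generalize (Cmod_ge_0 d). intros. assert (0 <= Cmod d * E) by (apply Rmult_le_pos; lra). nra. }
  replace (Cexp w - Cexp z - Cexp z * d)%C with
    ((Cexp (z + RtoC 1 * d) - RtoC 1 * (Cexp z * d)) - (Cexp (z + RtoC 0 * d) - RtoC 0 * (Cexp z * d)))%C.
  2:{ replace (z + RtoC 1 * d)%C with w by (unfold d; ring).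
      replace (z + RtoC 0 * d)%C with z by ring. ring. }
  apply Rle_trans with (E * Cmod d * Cmod d * (1 - 0)).
  - apply (rder_mean_value (fun t => Cexp (z + RtoC t * d) - RtoC t * (Cexp z * d))%C
      (fun t => d * (Cexp (z + RtoC t * d) - Cexp z))%C); [lra| |].
    + intros t Ht. eapply der_eq.
      * apply der_minus; [apply rder_Cexp_line|].
        apply (der_mult RtoC RtoC (fun _ => Cexp z * d)%C);
          [apply continuous_RtoC_id | apply der_var | apply der_const].
      * ring.
    + intros t Ht. rewrite Cmod_mult, Rmult_comm. apply Rmult_le_compat_r; [apply Cmod_ge_0|].
      now apply H3.
  - assert (E * Cmod d <= eps).
    { apply Rle_trans with (E * (eps / E)); [apply Rmult_le_compat_l; lra|].
      right. field. lra. }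
    rewrite Rminus_0_r, Rmult_1_r. apply Rmult_le_compat_r; [apply Cmod_ge_0 | assumption].
Qed.

Lemma Cmod_sqr (z : C) : Cmod z = sqrt (Re z ^ 2 + Im z ^ 2).
Proof. reflexivity. Qed.

Lemma Re_le_Cmod_pos (z : C) : 0 < Re z -> 0 < Cmod z.
Proof. intros H. generalize (re_le_Cmod z) (Rle_abs (Re z)). lra. Qed.

(** On the right half-plane the arc cosine with its case distinction on the sign of Im becomes one
    differentiable formula. *)
Lemma Clog_right (w : C) : 0 < Re w ->
  Clog w = (/ 2 * ln (Re w ^ 2 + Im w ^ 2), atan (Im w / Re w)).
Proof.
  intros Hw. assert (Hm := Re_le_Cmod_pos w Hw).
  assert (Hp : 0 < Re w ^ 2 + Im w ^ 2) by (generalize (pow2_ge_0 (Im w)); nra).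
  unfold Clog. f_equal.
  - rewrite Cmod_sqr. rewrite <- (sqrt_sqrt (Re w ^ 2 + Im w ^ 2)) at 2 by lra.
    rewrite ln_mult by (apply sqrt_lt_R0; exact Hp). lra.
  - assert (Hc : Re w / Cmod w = cos (atan (Im w / Re w))).
    { rewrite cos_atan.
      replace (1 + (Im w / Re w)²) with ((Re w ^ 2 + Im w ^ 2) / (Re w ^ 2))
        by (unfold Rsqr; field; lra).
      rewrite sqrt_div_alt by nra. rewrite <- Cmod_sqr.
      replace (sqrt (Re w ^ 2)) with (Re w) by (symmetry; apply sqrt_pow2; lra).
      field. lra. }
    unfold Carg. rewrite Hc.
    assert (Hb := atan_bound (Im w / Re w)).
    destruct (Rle_dec 0 (Im w)) as [Hi|Hi].
    + apply acos_cos. split; [|lra].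
      rewrite <- atan_0. destruct (Req_dec (Im w) 0) as [->|Hn].
      * unfold Rdiv. rewrite Rmult_0_l. apply Rle_refl.
      * left. apply atan_increasing. apply Rdiv_lt_0_compat; lra.
    + rewrite <- cos_neg, acos_cos; [ring|]. split; [|lra].
      assert (atan (Im w / Re w) < 0); [|lra].
      rewrite <- atan_0. apply atan_increasing.
      apply Ropp_lt_cancel. rewrite Ropp_0.
      replace (- (Im w / Re w)) with ((- Im w) / Re w) by (field; lra).
      apply Rdiv_lt_0_compat; lra.
Qed.

Lemma rder_Clog_line (w d : C) (t : R) : 0 < Re (w + RtoC t * d)%C ->
  rder (fun t => Clog (w + RtoC t * d)%C) t (d / (w + RtoC t * d))%C.
Proof.
  intros Hp.
  assert (Hloc : @locally R_UniformSpace t (fun t => 0 < Re (w + RtoC t * d)%C)).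
  { assert (Hc : continuous (fun t => Re (w + RtoC t * d)%C) t)
      by apply continuous_Re, continuous_line.
    apply Hc. exists (mkposreal _ Hp). intros y Hy. change (Rabs (y - Re (w + RtoC t * d)%C) < Re (w + RtoC t * d)%C) in Hy.
    apply Rabs_def2 in Hy. simpl in Hy |- *. lra. }
  apply der_ext_loc with (fun t => (/ 2 * ln ((Re w + t * Re d) ^ 2 + (Im w + t * Im d) ^ 2),
    atan ((Im w + t * Im d) / (Re w + t * Re d))) : C).
  { revert Hloc. apply filter_imp. intros x Hx. rewrite Clog_right by exact Hx.
    now rewrite re_plus, im_plus, re_scal_l, im_scal_l. }
  rewrite re_plus, re_scal_l in Hp.
  set (x := Re w + t * Re d) in *. set (y := Im w + t * Im d) in *.
  assert (Hxy : 0 < x ^ 2 + y ^ 2) by (generalize (pow2_ge_0 y); nra).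
  eapply der_eq.
  - apply rder_pair; simpl.
    + auto_derive; [|reflexivity].
      simpl in Hxy. fold x y. lra.
    + auto_derive; [|reflexivity]. fold x. apply Rgt_not_eq, Hp.
  - fold x y. replace (w + RtoC t * d)%C with ((x, y) : C)
      by (apply C_ext; unfold x, y; simpl; unfold Re, Im; ring).
    apply C_ext; simpl; unfold Re, Im in *; field; repeat split; try lra; nra.
Qed.

Lemma cder_Clog (w : C) : 0 < Re w -> cder Clog w (/ w)%C.
Proof.
  intros Hw. assert (Hm := Re_le_Cmod_pos w Hw).
  assert (Hwn : w <> RtoC 0) by now apply Cmod_gt_0.
  apply der_eps. intros eps Heps.
  set (B := / (Re w / 2) * / Cmod w).
  assert (HB : 0 < B).
  { apply Rmult_lt_0_compat; apply Rinv_0_lt_compat; lra. }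
  apply locally_C_Cmod. exists (Rmin (Re w / 2) (eps / B)).
  split; [apply Rmin_pos; [lra | now apply Rdiv_lt_0_compat]|].
  intros x Hx.
  assert (H1 : Cmod (x - w)%C < Re w / 2) by (eapply Rlt_le_trans; [exact Hx | apply Rmin_l]).
  assert (H2 : Cmod (x - w)%C < eps / B) by (eapply Rlt_le_trans; [exact Hx | apply Rmin_r]).
  set (d := (x - w)%C) in *.
  assert (Hre : forall t, 0 <= t <= 1 -> Re w / 2 <= Re (w + RtoC t * d)%C).
  { intros t Ht. rewrite re_plus, re_scal_l.
    generalize (re_le_Cmod d) (Rle_abs (- Re d)). rewrite Rabs_Ropp. nra. }
  replace (Clog x - Clog w - / w * d)%C with
    ((Clog (w + RtoC 1 * d) - RtoC 1 * (/ w * d)) - (Clog (w + RtoC 0 * d) - RtoC 0 * (/ w * d)))%C.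
  2:{ replace (w + RtoC 1 * d)%C with x by (unfold d; ring).
      replace (w + RtoC 0 * d)%C with w by ring. ring. }
  apply Rle_trans with (B * Cmod d * Cmod d * (1 - 0)).
  - apply (rder_mean_value (fun t => Clog (w + RtoC t * d) - RtoC t * (/ w * d))%C
      (fun t => d / (w + RtoC t * d) - / w * d)%C); [lra| |].
    + intros t Ht. eapply der_eq.
      * apply der_minus; [apply rder_Clog_line; specialize (Hre t Ht); lra|].
        apply (der_mult RtoC RtoC (fun _ => / w * d)%C);
          [apply continuous_RtoC_id | apply der_var | apply der_const].
      * ring.
    + intros t Ht. specialize (Hre t Ht).
      set (y := (w + RtoC t * d)%C) in *.
      assert (Hyr : 0 < Re y) by lra. assert (Hym := Re_le_Cmod_pos y Hyr).
      assert (Hyn : y <> RtoC 0) by now apply Cmod_gt_0.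
      replace (d / y - / w * d)%C with (- (RtoC t * (/ y * / w) * d * d))%C
        by (unfold y; unfold y in Hyn; field; split; assumption).
      rewrite Cmod_opp, !Cmod_mult, !Cmod_inv, Cmod_R, Rabs_pos_eq by (trivial; lra).
      apply Rmult_le_compat_r; [apply Cmod_ge_0|].
      apply Rmult_le_compat_r; [apply Cmod_ge_0|].
      unfold B. rewrite <- (Rmult_1_l (/ (Re w / 2) * / Cmod w)).
      assert (Hy2 : / Cmod y <= / (Re w / 2)).
      { apply Rinv_le_contravar; [lra|]. generalize (re_le_Cmod y) (Rle_abs (Re y)). lra. }
      assert (0 < / Cmod w) by now apply Rinv_0_lt_compat.
      assert (0 < / Cmod y) by now apply Rinv_0_lt_compat.
      apply Rmult_le_compat; [lra | nra | lra | nra].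
  - assert (B * Cmod d <= eps).
    { apply Rle_trans with (B * (eps / B)); [apply Rmult_le_compat_l; lra|].
      right. field. lra. }
    rewrite Rminus_0_r, Rmult_1_r. apply Rmult_le_compat_r; [apply Cmod_ge_0 | assumption].
Qed.

Lemma Clog_1 : Clog (RtoC 1) = RtoC 0.
Proof.
  rewrite Clog_right by (simpl; lra). simpl.
  replace (1 * (1 * 1) + 0 * (0 * 1)) with 1 by ring. rewrite ln_1.
  unfold Rdiv. rewrite Rmult_0_l, atan_0. unfold RtoC. f_equal. ring.
Qed.

Lemma Im_Clog_bound (w : C) : 0 < Re w -> - (PI / 2) < Im (Clog w) < PI / 2.
Proof. intros Hw. rewrite Clog_right by exact Hw. simpl.
  generalize (atan_bound (Im w / Re w)). lra.
Qed.

Lemma Im_Clog_neg (w : C) : 0 < Re w -> Im w < 0 -> Im (Clog w) < 0.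
Proof.
  intros Hw Hi. rewrite Clog_right by exact Hw. simpl. rewrite <- atan_0.
  apply atan_increasing. apply Ropp_lt_cancel. rewrite Ropp_0.
  replace (- (Im w / Re w)) with ((- Im w) / Re w) by (field; lra).
  apply Rdiv_lt_0_compat; lra.
Qed.

Lemma Re_Clog (w : C) : Re (Clog w) = ln (Cmod w).
Proof. reflexivity. Qed.

Lemma Cexp_Clog (w : C) : 0 < Re w -> Cexp (Clog w) = w.
Proof.
  intros Hw. assert (Hm := Re_le_Cmod_pos w Hw).
  unfold Cexp. rewrite Re_Clog, exp_ln by exact Hm.
  rewrite Clog_right by exact Hw. simpl Im.
  assert (Hp : 0 < Re w ^ 2 + Im w ^ 2) by (generalize (pow2_ge_0 (Im w)); nra).
  assert (Hs : sqrt (1 + (Im w / Re w)²) = Cmod w / Re w).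
  { replace (1 + (Im w / Re w)²) with ((Re w ^ 2 + Im w ^ 2) / (Re w ^ 2))
      by (unfold Rsqr; field; lra).
    rewrite sqrt_div_alt by nra. rewrite <- Cmod_sqr. f_equal. apply sqrt_pow2; lra. }
  unfold cis. rewrite cos_atan, sin_atan, Hs.
  apply C_ext; unfold Re, Im in *; simpl.
  - field. unfold Re in *. split; lra.
  - field. unfold Re in *. split; lra.
Qed.

(** The principal power (1 - z)^(-c); the sign makes the orders of the hulls positive. *)
Definition pw (c : R) (z : C) : C := Cexp (RtoC (- c) * Clog (1 - z))%C.

Lemma Re_one_minus (z : C) : Cmod z < 1 -> 0 < Re (1 - z)%C.
Proof.
  intros H. unfold Cminus. rewrite re_plus, re_opp, re_RtoC.
  generalize (re_le_Cmod z) (Rle_abs (Re z)). lra.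
Qed.

Lemma one_minus_neq_0 (z : C) : 0 < Re (1 - z)%C -> (1 - z <> 0)%C.
Proof. intros H E. rewrite E in H. simpl in H. lra. Qed.

Lemma pw_plus (a b : R) (z : C) : pw (a + b) z = (pw a z * pw b z)%C.
Proof.
  unfold pw. rewrite <- Cexp_plus. f_equal.
  rewrite !RtoC_opp, RtoC_plus. ring.
Qed.

Lemma pw_at_0 (c : R) : pw c (RtoC 0) = RtoC 1.
Proof.
  unfold pw. replace (1 - 0)%C with (RtoC 1) by ring. rewrite Clog_1, Cmult_0_r. apply Cexp_0.
Qed.

Lemma pw_neq_0 (c : R) (z : C) : pw c z <> RtoC 0.
Proof. apply Cexp_neq_0. Qed.

Lemma pw_opp (c : R) (z : C) : pw (- c) z = (/ pw c z)%C.
Proof. unfold pw. rewrite <- Cexp_opp. f_equal. rewrite !RtoC_opp. ring. Qed.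

Lemma pw_1 (z : C) : 0 < Re (1 - z)%C -> pw 1 z = (/ (1 - z))%C.
Proof.
  intros H. unfold pw. replace (RtoC (Ropp 1) * Clog (1 - z))%C with (- Clog (1 - z))%C
    by (rewrite RtoC_opp; ring).
  now rewrite Cexp_opp, Cexp_Clog.
Qed.

Lemma pw_S (c : R) (z : C) : 0 < Re (1 - z)%C -> pw (c + 1) z = (pw c z / (1 - z))%C.
Proof. intros H. now rewrite pw_plus, pw_1. Qed.

Lemma cder_Clog_one_minus (z : C) : 0 < Re (1 - z)%C ->
  cder (fun z => Clog (1 - z))%C z (- / (1 - z))%C.
Proof.
  intros H. eapply der_eq.
  - apply (cder_comp Clog (fun z => 1 - z)%C); [apply cder_Clog, H|].
    apply der_minus; [apply der_const | apply der_var].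
  - ring.
Qed.

Lemma cder_pw (c : R) (z : C) : 0 < Re (1 - z)%C ->
  cder (pw c) z (RtoC c * pw (c + 1) z)%C.
Proof.
  intros H. eapply der_eq.
  - apply (cder_comp Cexp (fun z => RtoC (- c) * Clog (1 - z))%C);
      [apply cder_Cexp | apply der_scal, cder_Clog_one_minus, H].
  - rewrite pw_S by exact H. fold (pw c z). rewrite RtoC_opp. field. now apply one_minus_neq_0.
Qed.

Lemma Cmod_pw (c : R) (z : C) : Cmod (pw c z) = exp (- c * ln (Cmod (1 - z)%C)).
Proof. unfold pw. rewrite Cmod_Cexp, re_scal_l, Re_Clog. reflexivity. Qed.

Lemma Cmod_pw_le (c rho : R) (z : C) : 0 <= c -> rho < 1 -> Cmod z <= rho ->
  Cmod (pw c z) <= exp (- c * ln (1 - rho)).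
Proof.
  intros Hc Hr Hz. rewrite Cmod_pw.
  assert (H : ln (1 - rho) <= ln (Cmod (1 - z)%C)).
  { apply Rcomplements.ln_le; [lra|].
    generalize (Cmod_triangle_rev 1 z). rewrite Cmod_1. lra. }
  apply exp_le. nra.
Qed.

(** * The Poisson-Herglotz representation *)

Lemma ex_CInt_circle (f : C -> C) (r : R) : holo f -> 0 <= r < 1 ->
  forall t, continuous (fun t => f (circle r t)) t.
Proof.
  intros Hf Hr t. apply (continuous_comp (circle r) f); [apply continuous_circle|].
  apply holo_continuous; [exact Hf|]. rewrite Cmod_circle; lra.
Qed.

Lemma continuous_Cconj {T : UniformSpace} (f : T -> C) (x : T) :
  continuous f x -> continuous (fun y => Cconj (f y)) x.
Proof.
  intros H. apply continuous_C_pair; simpl.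
  - now apply continuous_Re.
  - apply (continuous_opp (V := R_NormedModule) (fun y => Im (f y))). now apply continuous_Im.
Qed.

Lemma CInt_conj (f : R -> C) (a b : R) : ex_CInt f a b ->
  CInt (fun t => Cconj (f t)) a b = Cconj (CInt f a b).
Proof.
  intros H. apply CInt_unique. apply CInt_correct, is_RInt_Re_Im in H. destruct H as [H1 H2].
  apply is_RInt_Re_Im. simpl. split; [exact H1|].
  apply (is_RInt_opp (V := R_NormedModule) (fun t => Im (f t))). exact H2.
Qed.

Lemma mean_value_property (f : C -> C) (r : R) : holo f -> 0 < r < 1 ->
  CInt (fun t => f (circle r t)) 0 (2 * PI) = (RtoC (2 * PI) * f (RtoC 0))%C.
Proof.
  intros Hf Hr. rewrite <- (Cauchy_formula f r (RtoC 0) Hf) by (rewrite ?Cmod_0; lra).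
  apply CInt_ext. intros t _. field. replace (circle r t) with (circle r t - 0)%C by ring.
  apply circle_neq. rewrite Cmod_0. lra.
Qed.

Lemma Cauchy_conj (U : C -> C) (r : R) (z : C) : holo U -> Cmod z < r -> r < 1 ->
  CInt (fun t => Cconj (U (circle r t)) * (circle r t / (circle r t - z)))%C 0 (2 * PI)
  = (RtoC (2 * PI) * Cconj (U (RtoC 0)))%C.
Proof.
  intros HU Hz Hr. assert (Hr0 : 0 < r) by (generalize (Cmod_ge_0 z); lra).
  (* The enlarged radius r + e stays below 1 and, since |z| (2 r - |z|) <= r^2, satisfies |z| (r +
     e) <= r^2, so the denominator below has no zero. As [holo] speaks of the unit disc, [G] is
     rescaled by [r']. *)
  set (e := Rmin (r - Cmod z) ((1 - r) / 2)).
  assert (He : 0 < e) by (apply Rmin_pos; lra).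
  assert (He1 : e <= r - Cmod z) by apply Rmin_l.
  assert (He2 : e <= (1 - r) / 2) by apply Rmin_r.
  set (r' := r + e).
  assert (Hr' : r < r' < 1) by (unfold r'; lra).
  assert (Hzr : Cmod z * r' <= r * r).
  { unfold r'. generalize (Cmod_ge_0 z). nra. }
  assert (HrC : RtoC r <> RtoC 0) by (intros E; apply RtoC_inj in E; lra).
  assert (Hr'C : RtoC r' <> RtoC 0) by (intros E; apply RtoC_inj in E; lra).
  (* On |w| = r, [conj (w / (w - z)) = r^2 / (r^2 - conj z w)], which is
     holomorphic on a disc slightly larger than |w| <= r. *)
  set (G := fun w => (U (RtoC r' * w) * (RtoC (r * r) / (RtoC (r * r) - Cconj z * (RtoC r' * w))))%C).
  assert (Hden : forall w, Cmod w < 1 -> (RtoC (r * r) - Cconj z * (RtoC r' * w) <> 0)%C).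
  { intros w Hw E.
    generalize (Cmod_triangle_rev (RtoC (r * r)) (Cconj z * (RtoC r' * w))%C).
    rewrite E, Cmod_0, !Cmod_mult, Cmod_conj, !Cmod_R, !Rabs_pos_eq by nra.
    assert (Cmod z * (r' * Cmod w) < r * r); [|lra].
    destruct (Req_dec (Cmod z) 0) as [->|Hzn]; [nra|].
    assert (0 < Cmod z) by (generalize (Cmod_ge_0 z); lra).
    apply Rlt_le_trans with (Cmod z * (r' * 1)); [|lra].
    apply Rmult_lt_compat_l; [assumption|]. apply Rmult_lt_compat_l; lra. }
  assert (HG : holo G).
  { intros w Hw. destruct (HU (RtoC r' * w)%C) as [l Hl].
    { rewrite Cmod_mult, Cmod_R, Rabs_pos_eq by lra. generalize (Cmod_ge_0 w). nra. }
    eexists. apply der_mult; [apply continuous_C_id| |].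
    - apply (cder_comp U (fun w => RtoC r' * w)%C); [exact Hl | apply der_scal, der_var].
    - apply der_div; [apply continuous_C_id | now apply Hden | apply der_const |].
      apply der_minus; [apply der_const|]. apply der_scal, der_scal, der_var. }
  set (s := r / r').
  assert (Hs : 0 < s < 1).
  { unfold s. split; [apply Rdiv_lt_0_compat; lra|].
    apply Rmult_lt_reg_r with r'; [lra|]. unfold Rdiv. rewrite Rmult_assoc, Rinv_l; lra. }
  assert (M := mean_value_property G s HG Hs).
  assert (Hcs : forall t, (RtoC r' * circle s t = circle r t)%C).
  { intros t. unfold circle, s. rewrite RtoC_div by lra. field. exact Hr'C. }
  assert (G0 : G (RtoC 0) = U (RtoC 0)).
  { unfold G. replace (RtoC r' * 0)%C with (RtoC 0) by ring. rewrite RtoC_mult. field. exact HrC. }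
  rewrite G0 in M. apply (f_equal Cconj) in M. rewrite <- CInt_conj in M.
  2:{ apply ex_CInt_continuous. intros; apply ex_CInt_circle; [exact HG | lra]. }
  rewrite Cmult_conj in M. replace (Cconj (RtoC (2 * PI))) with (RtoC (2 * PI)) in M
    by (apply C_ext; simpl; ring).
  rewrite <- M. apply CInt_ext. intros t _. unfold G. rewrite Hcs, Cmult_conj. f_equal.
  assert (Hc : (Cconj (circle r t) * circle r t = RtoC (r * r))%C).
  { rewrite Cmult_comm, <- Cmod2_conj, Cmod_circle by lra. f_equal. ring. }
  assert (Hn := circle_neq r t z Hz).
  assert (Hc0 : Cconj (circle r t) <> RtoC 0).
  { intros E. rewrite E, Cmult_0_l in Hc. apply RtoC_inj in Hc. nra. }
  assert (Hd := Hden (circle s t) ltac:(rewrite Cmod_circle; lra)). rewrite Hcs in Hd.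
  rewrite Cdiv_conj by exact Hd.
  rewrite Cminus_conj, Cmult_conj, Cconj_conj.
  replace (Cconj (RtoC (r * r))) with (RtoC (r * r)) by (apply C_ext; simpl; ring).
  rewrite <- Hc. field. split; [|exact Hn].
  replace (Cconj (circle r t) * circle r t - z * Cconj (circle r t))%C
    with (Cconj (circle r t) * (circle r t - z))%C by ring.
  first [now apply Cmult_neq_0 | exact Hc0].
Qed.

(** The sum of Cauchy's formula and its conjugate version: on the circle U + conj U is 2 Re U. *)
Lemma Herglotz (U : C -> C) (r : R) (z : C) : holo U -> Cmod z < r -> r < 1 ->
  CInt (fun t => RtoC (2 * Re (U (circle r t))) * (circle r t / (circle r t - z)))%C 0 (2 * PI)
  = (RtoC (2 * PI) * (U z + Cconj (U (RtoC 0))))%C.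
Proof.
  intros HU Hz Hr. assert (Hr0 : 0 < r) by (generalize (Cmod_ge_0 z); lra).
  rewrite Cmult_plus_distr_l, <- (Cauchy_formula U r z), <- (Cauchy_conj U r z) by assumption.
  assert (CK : forall t, continuous (fun t => circle r t / (circle r t - z))%C t).
  { intros t. apply continuous_Cmult; [apply continuous_circle|].
    apply continuous_Cinv; [now apply circle_neq|].
    apply continuous_Cminus; [apply continuous_circle | apply continuous_const]. }
  rewrite <- CInt_plus.
  - apply CInt_ext. intros t _. rewrite <- Cmult_plus_distr_r. f_equal.
    apply C_ext; destruct (U (circle r t)); simpl; ring.
  - apply ex_CInt_continuous. intros t _.
    apply continuous_Cmult; [apply ex_CInt_circle; [exact HU | lra] | apply CK].
  - apply ex_CInt_continuous. intros t _.
    apply continuous_Cmult; [apply continuous_Cconj, ex_CInt_circle; [exact HU | lra] | apply CK].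
Qed.

(** The real part of the Herglotz formula minus that of the mean value property; the kernel is the
    Poisson kernel Re ((w + z) / (w - z)). *)
Lemma Poisson (U : C -> C) (r : R) (z : C) : holo U -> Cmod z < r -> r < 1 ->
  RInt (fun t => Re (U (circle r t)) * Re (2 * (circle r t / (circle r t - z)) - 1)%C) 0 (2 * PI)
  = 2 * PI * Re (U z).
Proof.
  intros HU Hz Hr. assert (Hr0 : 0 < r) by (generalize (Cmod_ge_0 z); lra).
  assert (CK : forall t, continuous (fun t => circle r t / (circle r t - z))%C t).
  { intros t. apply continuous_Cmult; [apply continuous_circle|].
    apply continuous_Cinv; [now apply circle_neq|].
    apply continuous_Cminus; [apply continuous_circle | apply continuous_const]. }
  assert (CU : forall t, continuous (fun t => U (circle r t)) t) by (apply ex_CInt_circle; [exact HU | lra]).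
  assert (CR : forall t, continuous (fun t => RtoC (2 * Re (U (circle r t))) * (circle r t / (circle r t - z)))%C t).
  { intros t. apply continuous_Cmult; [|apply CK]. apply continuous_RtoC.
    apply (continuous_mult (K := R_AbsRing) (fun _ => 2) (fun t => Re (U (circle r t))));
      [apply continuous_const | apply continuous_Re, CU]. }
  assert (H := Herglotz U r z HU Hz Hr). assert (M := mean_value_property U r HU ltac:(lra)).
  assert (X1 : ex_CInt (fun t => RtoC (2 * Re (U (circle r t))) * (circle r t / (circle r t - z)))%C 0 (2 * PI))
    by (apply ex_CInt_continuous; intros; apply CR).
  assert (X2 : ex_CInt (fun t => U (circle r t)) 0 (2 * PI))
    by (apply ex_CInt_continuous; intros; apply CU).
  apply (f_equal Re) in H, M. rewrite CInt_Re in H, M by assumption.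
  rewrite re_scal_l in H, M. rewrite re_plus, re_conj in H.
  apply ex_CInt_Re in X1, X2.
  replace (2 * PI * Re (U z)) with (2 * PI * (Re (U z) + Re (U (RtoC 0))) - 2 * PI * Re (U (RtoC 0))) by ring.
  rewrite <- H, <- M.
  rewrite <- (RInt_minus (V := R_CompleteNormedModule)) by assumption.
  apply RInt_ext. intros t _. rewrite re_scal_l.
  change (Re (U (circle r t)) * Re (2 * (circle r t / (circle r t - z)) + - (1))%C
    = 2 * Re (U (circle r t)) * Re (circle r t / (circle r t - z))%C - Re (U (circle r t))).
  rewrite re_plus, re_opp, re_RtoC.
  replace (Re (2 * (circle r t / (circle r t - z)))%C) with (2 * Re (circle r t / (circle r t - z))%C)
    by (symmetry; apply (re_scal_l 2)).
  ring.
Qed.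

Lemma Poisson_kernel_pos (r t : R) (z : C) : Cmod z < r ->
  0 <= Re (2 * (circle r t / (circle r t - z)) - 1)%C.
Proof.
  intros Hz. assert (Hr : 0 <= r) by (generalize (Cmod_ge_0 z); lra).
  assert (Hn := circle_neq r t z Hz). set (w := circle r t) in *.
  replace (2 * (w / (w - z)) - 1)%C with ((w + z) / (w - z))%C by (field; exact Hn).
  assert (Hw : Cmod w = r) by now apply Cmod_circle.
  assert (Hp : 0 < Re (w - z)%C ^ 2 + Im (w - z)%C ^ 2).
  { rewrite <- Cmod2_alt. apply pow_lt. now apply Cmod_gt_0. }
  assert (E : Re ((w + z) / (w - z))%C = (Cmod w ^ 2 - Cmod z ^ 2) / (Re (w - z)%C ^ 2 + Im (w - z)%C ^ 2)).
  { rewrite !Cmod2_alt. destruct w as [a b], z as [c d]; simpl in *. field. lra. }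
  rewrite E, Hw. apply Rmult_le_pos; [|left; now apply Rinv_0_lt_compat].
  generalize (Cmod_ge_0 z). nra.
Qed.

Lemma minimum_principle (U : C -> C) (r m : R) (z : C) : holo U -> Cmod z < r -> r < 1 ->
  (forall t, 0 <= t <= 2 * PI -> m <= Re (U (circle r t))) -> m <= Re (U z).
Proof.
  intros HU Hz Hr H. assert (HPI := PI_RGT_0).
  assert (Hr0 : 0 < r) by (generalize (Cmod_ge_0 z); lra).
  set (V := fun z => (U z - RtoC m)%C).
  assert (HV : holo V).
  { intros w Hw. destruct (HU w Hw) as [l Hl]. eexists.
    apply der_minus; [exact Hl | apply der_const]. }
  assert (E := Poisson V r z HV Hz Hr).
  assert (RV : forall w, Re (V w) = Re (U w) - m).
  { intros w. unfold V, Cminus. rewrite re_plus, re_opp, re_RtoC. ring. }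
  assert (0 <= 2 * PI * Re (V z)).
  { rewrite <- E. apply RInt_ge_0; [lra| |].
    - apply (ex_RInt_continuous (V := R_CompleteNormedModule)). intros t _.
      apply (continuous_mult (K := R_AbsRing)).
      + apply continuous_Re. apply ex_CInt_circle; [exact HV | lra].
      + apply continuous_Re. apply continuous_Cminus; [|apply continuous_const].
        apply continuous_Cmult; [apply continuous_const|].
        apply continuous_Cmult; [apply continuous_circle|].
        apply continuous_Cinv; [now apply circle_neq|].
        apply continuous_Cminus; [apply continuous_circle | apply continuous_const].
    - intros t Ht. apply Rmult_le_pos; [|now apply Poisson_kernel_pos].
      rewrite RV. specialize (H t ltac:(lra)). lra. }
  rewrite RV in H0. nra.
Qed.

(** * Closed convex classes of functions on [0, 1] *)

Definition near (e : R) (F G : R -> C) : Prop :=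
  forall s, 0 <= s <= 1 -> Cmod (F s - G s)%C <= e.

Definition mix (l : R) (F G : R -> C) (s : R) : C :=
  (RtoC l * F s + RtoC (1 - l) * G s)%C.

Record closed_convex (S : (R -> C) -> Prop) : Prop := {
  cc_mix : forall F G l, 0 <= l <= 1 -> S F -> S G -> S (mix l F G);
  cc_lim : forall F, (forall e, 0 < e -> exists G, S G /\ near e F G) -> S F
}.

(** Agreement on [0, 1] is approximation with error 0, so a closed class does not see values outside
    [0, 1]. *)
Lemma cc_ext (S : (R -> C) -> Prop) (F G : R -> C) :
  closed_convex S -> (forall s, 0 <= s <= 1 -> F s = G s) -> S F -> S G.
Proof.
  intros HS H HF. apply (cc_lim S HS). intros e He. exists F. split; [exact HF|].
  intros s Hs. rewrite (H s Hs). replace (G s - G s)%C with (RtoC 0) by ring.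
  rewrite Cmod_0. lra.
Qed.

Lemma near_mix (e l : R) (F G F' G' : R -> C) : 0 <= l <= 1 ->
  near e F F' -> near e G G' -> near e (mix l F G) (mix l F' G').
Proof.
  intros Hl H1 H2 s Hs. unfold mix.
  replace (RtoC l * F s + RtoC (1 - l) * G s - (RtoC l * F' s + RtoC (1 - l) * G' s))%C
    with (RtoC l * (F s - F' s) + RtoC (1 - l) * (G s - G' s))%C by ring.
  eapply Rle_trans; [apply Cmod_triangle|].
  rewrite !Cmod_mult, !Cmod_R, !Rabs_pos_eq by lra.
  specialize (H1 s Hs). specialize (H2 s Hs). nra.
Qed.

Lemma near_trans (e e' : R) (F G H : R -> C) : near e F G -> near e' G H -> near (e + e') F H.
Proof.
  intros H1 H2 s Hs. replace (F s - H s)%C with ((F s - G s) + (G s - H s))%C by ring.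
  eapply Rle_trans; [apply Cmod_triangle|].
  specialize (H1 s Hs). specialize (H2 s Hs). lra.
Qed.

Section Averaging.
Variables (S : (R -> C) -> Prop) (w : R -> R) (Phi : R -> R -> C) (a b L : R).
Hypothesis S_cc : closed_convex S.
Hypothesis Hab : a < b.
Hypothesis w_cont : forall u, a <= u <= b -> continuous w u.
Hypothesis w_pos : forall u, a <= u <= b -> 0 < w u.
Hypothesis Phi_S : forall u, a <= u <= b -> S (Phi u).
Hypothesis Phi_cont : forall s u, 0 <= s <= 1 -> a <= u <= b -> continuous (fun u => Phi u s) u.
Hypothesis Phi_lip : forall u u', a <= u <= b -> a <= u' <= b -> near (L * Rabs (u - u')) (Phi u) (Phi u').

Definition average (x y : R) (s : R) : C :=
  (CInt (fun u => RtoC (w u) * Phi u s)%C x y / RtoC (RInt w x y))%C.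

Let ex_w (x y : R) : a <= x -> x <= y -> y <= b -> ex_RInt w x y.
Proof.
  intros. apply (ex_RInt_continuous (V := R_CompleteNormedModule)). intros u Hu.
  rewrite Rmin_left, Rmax_right in Hu by lra. apply w_cont. lra.
Qed.

Let ex_wPhi (x y s : R) : 0 <= s <= 1 -> a <= x -> x <= y -> y <= b ->
  ex_CInt (fun u => RtoC (w u) * Phi u s)%C x y.
Proof.
  intros. apply ex_CInt_continuous. intros u Hu.
  rewrite Rmin_left, Rmax_right in Hu by lra.
  apply continuous_Cmult; [apply continuous_RtoC, w_cont | apply Phi_cont]; lra.
Qed.

Let W_pos (x y : R) : a <= x -> x < y -> y <= b -> 0 < RInt w x y.
Proof.
  intros. apply RInt_gt_0; [assumption| |]; intros; [apply w_pos | apply w_cont]; lra.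
Qed.

(** On an interval of length at most [h] the average is within [L * h] of the function at the left
    end. A longer interval is cut after length [h], and its average is the mixture of the two
    averages weighted by their masses; the error does not grow because mixing preserves [near]. *)
Lemma average_approx (h : R) (n : nat) : 0 < h -> forall x y,
  a <= x -> x < y -> y <= b -> y - x <= INR (Datatypes.S n) * h ->
  exists G, S G /\ near (L * h) (average x y) G.
Proof.
  intros Hh. assert (HL : 0 <= L).
  { generalize (Phi_lip a b ltac:(lra) ltac:(lra) 0 ltac:(lra)) (Cmod_ge_0 (Phi a 0 - Phi b 0)%C).
    rewrite Rabs_left by lra. nra. }
  assert (Base : forall x y, a <= x -> x < y -> y <= b -> y - x <= h ->
    exists G, S G /\ near (L * h) (average x y) G).
  { intros x y Hx Hxy Hy Hle. exists (Phi x). split; [apply Phi_S; lra|].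
    intros s Hs. unfold average.
    assert (HW := W_pos x y Hx Hxy Hy).
    assert (HWC : RtoC (RInt w x y) <> RtoC 0) by (intros E; apply RtoC_inj in E; lra).
    assert (X1 := ex_wPhi x y s Hs Hx ltac:(lra) Hy). assert (X2 := ex_w x y Hx ltac:(lra) Hy).
    assert (X3 : ex_CInt (fun u => Phi x s * RtoC (w u))%C x y).
    { apply ex_CInt_scal. apply ex_CInt_continuous. intros u Hu.
      rewrite Rmin_left, Rmax_right in Hu by lra. apply continuous_RtoC, w_cont. lra. }
    replace (CInt (fun u => RtoC (w u) * Phi u s)%C x y / RtoC (RInt w x y) - Phi x s)%C
      with (CInt (fun u => RtoC (w u) * Phi u s - Phi x s * RtoC (w u))%C x y / RtoC (RInt w x y))%C.
    2:{ rewrite CInt_minus, CInt_scal, CInt_RtoC by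
          (trivial; apply ex_CInt_continuous; intros u Hu;
           rewrite Rmin_left, Rmax_right in Hu by lra; apply continuous_RtoC, w_cont; lra).
        field. exact HWC. }
    rewrite Cmod_div, Cmod_R, Rabs_pos_eq by (trivial; lra).
    apply Rmult_le_reg_r with (RInt w x y); [exact HW|].
    unfold Rdiv. rewrite Rmult_assoc, Rinv_l, Rmult_1_r by lra.
    replace (L * h * RInt w x y) with (RInt (fun u => L * h * w u) x y)
      by exact (RInt_scal (V := R_CompleteNormedModule) w x y (L * h) X2).
    apply CInt_norm_le_fun; [lra | now apply ex_CInt_minus | |].
    - exact (ex_RInt_scal (V := R_NormedModule) w x y (L * h) X2).
    - intros u Hu. replace (RtoC (w u) * Phi u s - Phi x s * RtoC (w u))%C
        with (RtoC (w u) * (Phi u s - Phi x s))%C by ring.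
      assert (Hw := w_pos u ltac:(lra)).
      rewrite Cmod_mult, Cmod_R, Rabs_pos_eq by lra.
      rewrite Rmult_comm. apply Rmult_le_compat_r; [lra|].
      eapply Rle_trans; [apply (Phi_lip u x); lra|].
      apply Rmult_le_compat_l; [exact HL|]. rewrite Rabs_pos_eq; lra. }
  induction n as [|n IH]; intros x y Hx Hxy Hy Hle.
  - apply Base; trivial. simpl in Hle. lra.
  - destruct (Rle_dec (y - x) h) as [Hs|Hs]; [now apply Base|].
    set (c := x + h).
    destruct (Base x c) as (G1 & S1 & N1); [exact Hx|unfold c; lra|unfold c; lra|unfold c; lra|].
    destruct (IH c y) as (G2 & S2 & N2); [unfold c; lra|unfold c; lra|exact Hy| |].
    { rewrite S_INR in Hle. unfold c. lra. }
    assert (W1 := W_pos x c Hx ltac:(unfold c; lra) ltac:(unfold c; lra)).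
    assert (W2 := W_pos c y ltac:(unfold c; lra) ltac:(unfold c; lra) Hy).
    assert (EW : RInt w x c + RInt w c y = RInt w x y).
    { apply (RInt_Chasles (V := R_CompleteNormedModule)); apply ex_w; unfold c; lra. }
    set (l := RInt w x c / RInt w x y).
    assert (Hl : 0 <= l <= 1).
    { unfold l. split; [apply Rmult_le_pos; [lra | left; apply Rinv_0_lt_compat; lra]|].
      apply Rmult_le_reg_r with (RInt w x y); [lra|]. unfold Rdiv. rewrite Rmult_assoc, Rinv_l; lra. }
    exists (mix l G1 G2). split; [now apply (cc_mix S S_cc)|].
    intros s Hs'.
    replace (average x y s) with (mix l (average x c) (average c y) s).
    { now apply near_mix. }
    unfold mix, average.
    rewrite <- (CInt_Chasles _ x c y) by (apply ex_wPhi; unfold c; lra).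
    replace (1 - l) with (RInt w c y / RInt w x y) by (unfold l; rewrite <- EW; field; lra).
    unfold l. rewrite !RtoC_div by lra. rewrite <- EW, RtoC_plus.
    assert (D1 : RtoC (RInt w x c) <> RtoC 0) by (intros E; apply RtoC_inj in E; lra).
    assert (D2 : RtoC (RInt w c y) <> RtoC 0) by (intros E; apply RtoC_inj in E; lra).
    assert (D3 : (RtoC (RInt w x c) + RtoC (RInt w c y))%C <> RtoC 0).
    { rewrite <- RtoC_plus. intros E; apply RtoC_inj in E; lra. }
    field. repeat split; assumption.
Qed.

Lemma average_closed_convex : S (average a b).
Proof.
  apply (cc_lim S S_cc). intros e He.
  assert (HL : 0 <= L).
  { generalize (Phi_lip a b ltac:(lra) ltac:(lra) 0 ltac:(lra)) (Cmod_ge_0 (Phi a 0 - Phi b 0)%C).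
    rewrite Rabs_left by lra. nra. }
  (* [L + 1] in place of [L], which may be 0. *)
  set (h := e / (L + 1)). assert (Hh : 0 < h) by (apply Rdiv_lt_0_compat; lra).
  destruct (nfloor_ex ((b - a) / h)) as [n [_ Hn]].
  { apply Rmult_le_pos; [lra | left; now apply Rinv_0_lt_compat]. }
  destruct (average_approx h n Hh a b) as (G & HG & N); [lra|exact Hab|lra| |].
  - rewrite S_INR. apply Rlt_le.
    apply Rmult_lt_compat_r with (r := h) in Hn; [|exact Hh].
    unfold Rdiv in Hn. rewrite Rmult_assoc, Rinv_l in Hn by lra. lra.
  - exists G. split; [exact HG|]. intros s Hs. eapply Rle_trans; [apply N, Hs|].
    unfold h. apply Rmult_le_reg_r with (L + 1); [lra|].
    replace (L * (e / (L + 1)) * (L + 1)) with (L * e) by (field; lra). nra.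
Qed.

End Averaging.

(** * The closed convex hull of the functions [(1 - v s) ^ (-c)] *)

Section Hull.
Variable rho : R.
Hypothesis Hrho : 0 <= rho < 1.

(** The closed convex hull of the generators as an intersection of classes, so that membership is an
    induction principle: a property passes to the hull once it defines a closed convex class
    containing the generators. The radius [rho] keeps these away from the singularity at 1. *)
Definition hull (c : R) (F : R -> C) : Prop :=
  forall S, closed_convex S ->
    (forall v, Cmod v <= rho -> S (fun s => pw c (v * RtoC s)%C)) -> S F.

Lemma hull_cc (c : R) : closed_convex (hull c).
Proof.
  split.
  - intros F G l Hl HF HG S HS Hb. apply (cc_mix S HS); auto. now apply HF. now apply HG.
  - intros F H S HS Hb. apply (cc_lim S HS). intros e He.
    destruct (H e He) as (G & HG & N). exists G. split; [now apply HG | exact N].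
Qed.

Lemma hull_base (c : R) (v : C) : Cmod v <= rho -> hull c (fun s => pw c (v * RtoC s)%C).
Proof. intros Hv S HS Hb. now apply Hb. Qed.

Lemma Cmod_scaled (v : C) (s : R) : Cmod v <= rho -> 0 <= s <= 1 -> Cmod (v * RtoC s)%C <= rho.
Proof.
  intros Hv Hs. rewrite Cmod_mult, Cmod_R, Rabs_pos_eq by lra. generalize (Cmod_ge_0 v). nra.
Qed.

Lemma hull_bounded (c : R) (F : R -> C) : 0 <= c -> hull c F ->
  forall s, 0 <= s <= 1 -> Cmod (F s) <= exp (- c * ln (1 - rho)).
Proof.
  intros Hc HF. set (B := exp (- c * ln (1 - rho))).
  apply (HF (fun F => forall s, 0 <= s <= 1 -> Cmod (F s) <= B)).
  - split.
    + intros G H l Hl HG HH s Hs. unfold mix.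
      eapply Rle_trans; [apply Cmod_triangle|]. rewrite !Cmod_mult, !Cmod_R, !Rabs_pos_eq by lra.
      specialize (HG s Hs). specialize (HH s Hs). nra.
    + intros G H s Hs. apply Rnot_lt_le. intros Hlt.
      destruct (H ((Cmod (G s) - B) / 2)) as (G' & HG' & N); [lra|].
      specialize (HG' s Hs). specialize (N s Hs).
      generalize (Cmod_triangle_rev (G s) (G' s)). lra.
  - intros v Hv s Hs. apply Cmod_pw_le; [exact Hc | lra | now apply Cmod_scaled].
Qed.

(** For a fixed bounded [G], multiplication by [G] is linear and uniformly continuous, so the
    functions whose product with [G] is in the hull form a closed convex class. *)
Lemma hull_mult_right (a c : R) (G : R -> C) (B : R) :
  (forall s, 0 <= s <= 1 -> Cmod (G s) <= B) ->
  (forall v, Cmod v <= rho -> hull c (fun s => pw a (v * RtoC s) * G s)%C) ->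
  forall F, hull a F -> hull c (fun s => F s * G s)%C.
Proof.
  intros HB Hbase F HF. apply (HF (fun F => hull c (fun s => F s * G s)%C)); [|exact Hbase].
  split.
  - intros F1 F2 l Hl H1 H2.
    apply (cc_ext _ (mix l (fun s => F1 s * G s)%C (fun s => F2 s * G s)%C) _ (hull_cc c)).
    + intros s _. unfold mix. ring.
    + now apply (cc_mix _ (hull_cc c)).
  - intros F1 H. apply (cc_lim _ (hull_cc c)). intros e He.
    assert (HB0 : 0 <= B) by (eapply Rle_trans; [apply Cmod_ge_0 | apply (HB 0); lra]).
    destruct (H (e / (B + 1))) as (F2 & H2 & N); [apply Rdiv_lt_0_compat; lra|].
    exists (fun s => F2 s * G s)%C. split; [exact H2|].
    intros s Hs. replace (F1 s * G s - F2 s * G s)%C with ((F1 s - F2 s) * G s)%C by ring.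
    rewrite Cmod_mult. apply Rle_trans with (e / (B + 1) * B).
    + apply Rmult_le_compat; try apply Cmod_ge_0; [now apply N | now apply HB].
    + apply Rmult_le_reg_r with (B + 1); [lra|].
      replace (e / (B + 1) * B * (B + 1)) with (e * B) by (field; lra). nra.
Qed.

End Hull.

Lemma is_derive_continuous_R (u : R -> R) (x d : R) : is_derive u x d -> continuous u x.
Proof.
  intros H. apply (ex_derive_continuous (K := R_AbsRing) (V := R_NormedModule)). now exists d.
Qed.

Lemma pw_taylor (c rho : R) (z w : C) : 0 <= c -> rho < 1 -> Cmod z <= rho -> Cmod w <= rho ->
  Cmod (pw c w - pw c z - RtoC c * pw (c + 1) z * (w - z))%C
    <= c * ((c + 1) * exp (- (c + 1 + 1) * ln (1 - rho))) * Cmod (w - z)%C ^ 2.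
Proof.
  intros Hc Hr Hz Hw.
  assert (Hin : forall t, 0 <= t <= 1 -> Cmod (z + RtoC t * (w - z))%C <= rho)
    by (intros t Ht; now apply cball_segment).
  apply (cder_taylor (pw c) (fun x => RtoC c * pw (c + 1) x)%C
    (fun x => RtoC c * (RtoC (c + 1) * pw (c + 1 + 1) x))%C).
  - intros t Ht. apply cder_pw, Re_one_minus. specialize (Hin t Ht). lra.
  - intros t Ht. apply der_scal, cder_pw, Re_one_minus. specialize (Hin t Ht). lra.
  - intros t Ht. rewrite !Cmod_mult, !Cmod_R, !Rabs_pos_eq by lra.
    apply Rmult_le_compat_l; [exact Hc|]. apply Rmult_le_compat_l; [lra|].
    apply Cmod_pw_le; [lra | exact Hr | now apply Hin].
Qed.

Lemma Cmod_pw_opp_le (a : R) (z : C) : 0 <= a -> Cmod z < 1 -> Cmod (pw (- a) z) <= exp (a * ln 2).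
Proof.
  intros Ha Hz. rewrite Cmod_pw, Ropp_involutive.
  assert (H1 : 0 < Cmod (1 - z)%C) by (apply Re_le_Cmod_pos, Re_one_minus, Hz).
  assert (H2 : Cmod (1 - z)%C <= 2).
  { eapply Rle_trans; [apply Cmod_triangle_minus|]. rewrite Cmod_1. lra. }
  assert (H : ln (Cmod (1 - z)%C) <= ln 2) by (apply Rcomplements.ln_le; assumption).
  apply exp_le. nra.
Qed.

(** * Products of two powers through truncated Beta integrals *)

Section BetaIntegral.
Variables (rho a b : R) (v1 v2 : C).
Hypothesis Hrho : 0 <= rho < 1.
Hypothesis Ha : 0 < a.
Hypothesis Hb : 0 < b.
Hypothesis Hv1 : Cmod v1 <= rho.
Hypothesis Hv2 : Cmod v2 <= rho.

Let c := a + b.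
(** Chosen so that 1 - y(u) s is the mean of 1 - v1 s and 1 - v2 s with weights u and 1 - u. *)
Let y (u : R) : C := (v2 + RtoC u * (v1 - v2))%C.
Let w (u : R) : R := exp ((a - 1) * ln u + (b - 1) * ln (1 - u)).
(** This is u^a (1 - u)^b, the Beta weight times u (1 - u); it supplies the boundary terms of the
    partial integration in [u]. *)
Let e (u : R) : R := exp (a * ln u + b * ln (1 - u)).

Let e_w (u : R) : 0 < u < 1 -> e u = w u * (u * (1 - u)).
Proof.
  intros Hu. unfold e, w.
  replace (u * (1 - u)) with (exp (ln u + ln (1 - u))) by (rewrite exp_plus, !exp_ln; lra).
  rewrite <- exp_plus. f_equal. ring.
Qed.

Let e_derive (u : R) : 0 < u < 1 -> is_derive e u (w u * (a * (1 - u) - b * u)).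
Proof.
  intros Hu. replace (w u * (a * (1 - u) - b * u)) with (e u * (a / u - b / (1 - u)))
    by (rewrite e_w by exact Hu; field; lra).
  unfold e. auto_derive; [lra|]. unfold Rminus. field. lra.
Qed.

Let y_bound (u : R) : 0 <= u <= 1 -> Cmod (y u) <= rho.
Proof. intros Hu. apply cball_segment; assumption. Qed.

Let w_cont (u : R) : 0 < u < 1 -> continuous w u.
Proof.
  intros Hu. eapply is_derive_continuous_R. unfold w. auto_derive; [lra | reflexivity].
Qed.

Let boundary (s u : R) : C := (RtoC (e u) * pw c (y u * RtoC s))%C.

Let rder_boundary (s u : R) : 0 <= s <= 1 -> 0 < u < 1 ->
  rder (boundary s) u
    (RtoC (w u) * pw c (y u * RtoC s) / (1 - y u * RtoC s)
      * (RtoC a * RtoC (1 - u) * (1 - v2 * RtoC s) - RtoC b * RtoC u * (1 - v1 * RtoC s)))%C.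
Proof.
  intros Hs Hu.
  assert (Hy : Cmod (y u * RtoC s)%C <= rho) by (apply Cmod_scaled; auto; apply y_bound; lra).
  assert (Hre : 0 < Re (1 - y u * RtoC s)%C) by (apply Re_one_minus; lra).
  eapply der_eq.
  - apply der_mult; [apply continuous_RtoC_id| |].
    + apply rder_RtoC, e_derive, Hu.
    + apply (rder_comp (pw c) (fun u => y u * RtoC s)%C); [apply cder_pw, Hre|].
      apply (der_mult RtoC y (fun _ => RtoC s)); [apply continuous_RtoC_id | apply rder_line | apply der_const].
  - cbv beta. rewrite e_w by exact Hu. rewrite pw_S by exact Hre.
    assert (Hn := one_minus_neq_0 _ Hre).
    set (P := pw c (y u * RtoC s)%C) in *.
    unfold c. rewrite !RtoC_mult, !RtoC_minus, !RtoC_mult, !RtoC_minus, RtoC_plus.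
    unfold y in Hn |- *.
    field. exact Hn.
Qed.

(** With A = (1 - v1 s)^(-a) (1 - v2 s)^(-b), and I(s) the Beta integral of the powers of order [c],
    the left side is the integrand of I' - (A'/A) I. It equals a factor free of [u] times the
    u-derivative of [boundary], so after integration only end terms remain: I / A is constant up to
    them. *)
Let beta_identity (s u : R) : 0 <= s <= 1 -> 0 < u < 1 ->
  (RtoC (w u) * (RtoC c * y u * pw (c + 1) (y u * RtoC s))
   - (RtoC a * v1 / (1 - v1 * RtoC s) + RtoC b * v2 / (1 - v2 * RtoC s))
     * (RtoC (w u) * pw c (y u * RtoC s))
   = (v2 - v1) / ((1 - v1 * RtoC s) * (1 - v2 * RtoC s)) *
     (RtoC (w u) * pw c (y u * RtoC s) / (1 - y u * RtoC s)
      * (RtoC a * RtoC (1 - u) * (1 - v2 * RtoC s) - RtoC b * RtoC u * (1 - v1 * RtoC s))))%C.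
Proof.
  intros Hs Hu.
  assert (Hre : forall v, Cmod v <= rho -> 0 < Re (1 - v * RtoC s)%C).
  { intros v Hv. apply Re_one_minus. generalize (Cmod_scaled rho Hrho v s Hv Hs). lra. }
  assert (Hy := y_bound u ltac:(lra)).
  rewrite pw_S by now apply Hre.
  assert (N1 := one_minus_neq_0 _ (Hre v1 Hv1)). assert (N2 := one_minus_neq_0 _ (Hre v2 Hv2)).
  assert (N3 := one_minus_neq_0 _ (Hre _ Hy)).
  set (P := pw c (y u * RtoC s)%C). unfold c. rewrite RtoC_plus, RtoC_minus.
  unfold y in N3 |- *. field. repeat split; assumption.
Qed.

Section Truncation.
Variable eps : R.
Hypothesis Heps : 0 < eps < / 4.

(** The weight is singular at 0 if a < 1 and at 1 if b < 1. Truncation to [eps, 1 - eps] keeps all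
    integrals proper; the price is boundary terms, which disappear with eps. *)
Let I (s : R) : C := CInt (fun u => RtoC (w u) * pw c (y u * RtoC s))%C eps (1 - eps).
Let N : R := RInt w eps (1 - eps).

Let ex_kernel (d : R) (s : R) : 0 <= s <= 1 ->
  ex_CInt (fun u => RtoC (w u) * pw d (y u * RtoC s))%C eps (1 - eps).
Proof.
  intros Hs. apply ex_CInt_continuous. intros u Hu. rewrite Rmin_left, Rmax_right in Hu by lra.
  apply continuous_Cmult; [apply continuous_RtoC, w_cont; lra|].
  eapply rder_continuous. apply (rder_comp (pw d) (fun u => y u * RtoC s)%C).
  - apply cder_pw, Re_one_minus. generalize (Cmod_scaled rho Hrho (y u) s (y_bound u ltac:(lra)) Hs). lra.
  - apply (der_mult RtoC y (fun _ => RtoC s)); [apply continuous_RtoC_id | apply rder_line | apply der_const].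
Qed.

Let rder_I (s : R) : 0 <= s <= 1 ->
  rder I s (CInt (fun u => RtoC (w u) * (RtoC c * y u * pw (c + 1) (y u * RtoC s)))%C eps (1 - eps)).
Proof.
  (* Near an end of [0, 1] the variation of [s] leaves the interval, so the points [y u * s'] are
     controlled in the larger disc of radius [r']. *)
  intros Hs. set (r' := (1 + rho) / 2).
  assert (Hc : 0 < c) by (unfold c; lra).
  set (M := c * ((c + 1) * exp (- (c + 1 + 1) * ln (1 - r')))).
  assert (HM : 0 <= M).
  { unfold M. apply Rmult_le_pos; [lra|]. apply Rmult_le_pos; [lra | left; apply exp_pos]. }
  destruct (continuity_ab_maj w eps (1 - eps)) as (um & Hm & _); [lra| |].
  { intros u Hu. apply continuity_pt_filterlim, w_cont. lra. }
  apply (der_CInt (T := R_UniformSpace) RtoC (fun s u : R => RtoC (w u) * pw c (y u * RtoC s))%C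
    (fun u => RtoC (w u) * (RtoC c * y u * pw (c + 1) (y u * RtoC s)))%C eps (1 - eps) (w um * M) s).
  - lra.
  - apply continuous_RtoC_id.
  - apply ex_CInt_continuous. intros u Hu. rewrite Rmin_left, Rmax_right in Hu by lra.
    apply continuous_Cmult; [apply continuous_RtoC, w_cont; lra|].
    apply continuous_Cmult.
    + apply continuous_Cmult; [apply continuous_const | apply continuous_line].
    + eapply rder_continuous. apply (rder_comp (pw (c + 1)) (fun u => y u * RtoC s)%C).
      * apply cder_pw, Re_one_minus.
        generalize (Cmod_scaled rho Hrho (y u) s (y_bound u ltac:(lra)) Hs). lra.
      * apply (der_mult RtoC y (fun _ => RtoC s)); [apply continuous_RtoC_id | apply rder_line | apply der_const].
  - apply locally_R_Rabs. exists ((1 - rho) / 2). split; [lra|]. intros s' Hs'.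
    assert (Hy' : forall u, eps <= u <= 1 - eps -> Cmod (y u * RtoC s')%C <= r').
    { intros u Hu. replace (y u * RtoC s')%C with (y u * RtoC s + y u * RtoC (s' - s))%C
        by (rewrite RtoC_minus; ring).
      eapply Rle_trans; [apply Cmod_triangle|].
      assert (Hyu := y_bound u ltac:(lra)).
      generalize (Cmod_scaled rho Hrho (y u) s Hyu Hs). rewrite Cmod_mult, Cmod_R.
      assert (Cmod (y u) * Rabs (s' - s) <= 1 * ((1 - rho) / 2)).
      { apply Rmult_le_compat; [apply Cmod_ge_0 | apply Rabs_pos | lra | lra]. }
      rewrite Cmod_mult, Cmod_R. unfold r'. lra. }
    split.
    + apply ex_CInt_continuous. intros u Hu. rewrite Rmin_left, Rmax_right in Hu by lra.
      apply continuous_Cmult; [apply continuous_RtoC, w_cont; lra|].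
      eapply rder_continuous. apply (rder_comp (pw c) (fun u => y u * RtoC s')%C).
      * apply cder_pw, Re_one_minus. generalize (Hy' u Hu). unfold r'. lra.
      * apply (der_mult RtoC y (fun _ => RtoC s')); [apply continuous_RtoC_id | apply rder_line | apply der_const].
    + intros u Hu.
      replace (RtoC (w u) * pw c (y u * RtoC s') - RtoC (w u) * pw c (y u * RtoC s)
        - RtoC (w u) * (RtoC c * y u * pw (c + 1) (y u * RtoC s)) * (RtoC s' - RtoC s))%C
      with (RtoC (w u) * (pw c (y u * RtoC s') - pw c (y u * RtoC s)
        - RtoC c * pw (c + 1) (y u * RtoC s) * (y u * RtoC s' - y u * RtoC s)))%C by ring.
      rewrite Cmod_mult, Cmod_R, Rabs_pos_eq by (left; apply exp_pos).
      rewrite Rmult_assoc. apply Rmult_le_compat; [left; apply exp_pos | apply Cmod_ge_0 | now apply Hm |].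
      eapply Rle_trans.
      * apply (pw_taylor c r'); [lra | unfold r'; lra | | now apply Hy'].
        generalize (Cmod_scaled rho Hrho (y u) s (y_bound u ltac:(lra)) Hs). unfold r'. lra.
      * fold M. apply Rmult_le_compat_l; [exact HM|].
        replace (y u * RtoC s' - y u * RtoC s)%C with (y u * (RtoC s' - RtoC s))%C by ring.
        rewrite Cmod_mult. apply pow_incr. split; [apply Rmult_le_pos; apply Cmod_ge_0|].
        generalize (y_bound u ltac:(lra)) (Cmod_ge_0 (RtoC s' - RtoC s)%C). nra.
Qed.

(** The quotient of [I] by the product of powers. It equals [N] at 0 and moves by at most [K * X],
    where [X] is eps^a + eps^b. *)
Let T (s : R) : C := (pw (- a) (v1 * RtoC s) * pw (- b) (v2 * RtoC s) * I s)%C.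
Let X : R := exp (a * ln eps) + exp (b * ln eps).
(** The factors bound the two inverse powers (the moduli of 1 - v s are at most 2), the coefficient
    from [beta_identity], and the power in the boundary terms. *)
Let K : R := exp (a * ln 2) * exp (b * ln 2) * (2 / ((1 - rho) * (1 - rho))) * exp (- c * ln (1 - rho)).

Let rder_T (s : R) : 0 <= s <= 1 ->
  rder T s (pw (- a) (v1 * RtoC s) * pw (- b) (v2 * RtoC s)
    * ((v2 - v1) / ((1 - v1 * RtoC s) * (1 - v2 * RtoC s))
       * (boundary s (1 - eps) - boundary s eps)))%C.
Proof.
  intros Hs.
  assert (Hre : forall v, Cmod v <= rho -> 0 < Re (1 - v * RtoC s)%C).
  { intros v Hv. apply Re_one_minus. generalize (Cmod_scaled rho Hrho v s Hv Hs). lra. }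
  assert (N1 := one_minus_neq_0 _ (Hre v1 Hv1)). assert (N2 := one_minus_neq_0 _ (Hre v2 Hv2)).
  assert (Dv : forall v d, Cmod v <= rho ->
    rder (fun s => pw d (v * RtoC s)%C) s (RtoC d * pw (d + 1) (v * RtoC s) * v)%C).
  { intros v d Hv. apply (rder_comp (pw d) (fun s => v * RtoC s)%C); [apply cder_pw, Hre, Hv|].
    eapply der_eq; [apply der_scal, der_var|]. ring. }
  set (D := fun u => (RtoC (w u) * pw c (y u * RtoC s) / (1 - y u * RtoC s)
      * (RtoC a * RtoC (1 - u) * (1 - v2 * RtoC s) - RtoC b * RtoC u * (1 - v1 * RtoC s)))%C).
  assert (CD : forall u, eps <= u <= 1 - eps -> continuous D u).
  { intros u Hu.
    assert (Hyr := Hre _ (y_bound u ltac:(lra))).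
    assert (Cy : continuous (fun u => y u * RtoC s)%C u)
      by (apply continuous_Cmult; [apply continuous_line | apply continuous_const]).
    assert (CR : forall g : R -> R, continuous g u -> continuous (fun u => RtoC (g u)) u)
      by (intros; now apply continuous_RtoC).
    apply continuous_Cmult; [apply continuous_Cmult|].
    - apply continuous_Cmult; [apply CR, w_cont; lra|].
      apply (continuous_comp (fun u => y u * RtoC s)%C (pw c)); [exact Cy|].
      eapply cder_continuous, cder_pw, Hyr.
    - apply continuous_Cinv; [now apply one_minus_neq_0|].
      apply continuous_Cminus; [apply continuous_const | exact Cy].
    - apply continuous_Cminus; (apply continuous_Cmult; [|apply continuous_const]);
        (apply continuous_Cmult; [apply continuous_const|]).
      + apply CR. eapply is_derive_continuous_R. auto_derive; [exact Logic.I | reflexivity].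
      + apply continuous_RtoC_id. }
  assert (ED : CInt D eps (1 - eps) = (boundary s (1 - eps) - boundary s eps)%C).
  { apply CInt_rder; intros u Hu; rewrite Rmin_left, Rmax_right in Hu by lra.
    - apply rder_boundary; lra.
    - now apply CD. }
  eapply der_eq.
  - apply der_mult; [apply continuous_RtoC_id| |apply rder_I, Hs].
    apply der_mult; [apply continuous_RtoC_id | now apply Dv | now apply Dv].
  - cbv beta. rewrite !pw_S by (apply Hre; assumption). rewrite <- ED.
    set (P1 := pw (- a) (v1 * RtoC s)%C). set (P2 := pw (- b) (v2 * RtoC s)%C).
    set (q := ((v2 - v1) / ((1 - v1 * RtoC s) * (1 - v2 * RtoC s)))%C).
    set (m := (RtoC a * v1 / (1 - v1 * RtoC s) + RtoC b * v2 / (1 - v2 * RtoC s))%C).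
    assert (XD : ex_CInt D eps (1 - eps)).
    { apply ex_CInt_continuous. intros u Hu; rewrite Rmin_left, Rmax_right in Hu by lra. now apply CD. }
    assert (E : CInt (fun u => RtoC (w u) * (RtoC c * y u * pw (c + 1) (y u * RtoC s)))%C eps (1 - eps)
      = (q * CInt D eps (1 - eps) + m * I s)%C).
    { unfold I. assert (XI := ex_kernel c s Hs).
      rewrite <- (CInt_scal q D) by exact XD. rewrite <- (CInt_scal m) by exact XI.
      rewrite <- CInt_plus by (now apply ex_CInt_scal).
      apply CInt_ext. intros u Hu. rewrite Rmin_left, Rmax_right in Hu by lra.
      generalize (beta_identity s u Hs ltac:(lra)). fold q m. fold (D u). intros <-. ring. }
    rewrite E. unfold m. rewrite !RtoC_opp. field. split; assumption.
Qed.

Let T_bound (s : R) : 0 <= s <= 1 -> Cmod (T s - RtoC N)%C <= K * X.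
Proof.
  intros Hs.
  assert (T0 : T 0 = RtoC N).
  { unfold T. replace (v1 * RtoC 0)%C with (RtoC 0) by ring. replace (v2 * RtoC 0)%C with (RtoC 0) by ring.
    rewrite !pw_at_0, !Cmult_1_l. unfold I, N.
    rewrite <- CInt_RtoC.
    - apply CInt_ext. intros u _. replace (y u * RtoC 0)%C with (RtoC 0) by ring.
      rewrite pw_at_0. ring.
    - apply (ex_RInt_continuous (V := R_CompleteNormedModule)). intros u Hu.
      rewrite Rmin_left, Rmax_right in Hu by lra. apply w_cont. lra. }
  assert (HX : 0 <= X) by (unfold X; generalize (exp_pos (a * ln eps)) (exp_pos (b * ln eps)); lra).
  assert (Hd : 0 < (1 - rho) * (1 - rho)) by (apply Rmult_lt_0_compat; lra).
  assert (HK : 0 <= K).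
  { unfold K. repeat apply Rmult_le_pos; try (left; apply exp_pos); [lra|].
    left. now apply Rinv_0_lt_compat. }
  rewrite <- T0. apply Rle_trans with (K * X * (s - 0)).
  2:{ assert (0 <= K * X) by (apply Rmult_le_pos; assumption). nra. }
  apply (rder_mean_value T _ 0 s (K * X) (proj1 Hs) (fun t Ht => rder_T t ltac:(lra))).
  intros t Ht. assert (Ht1 : 0 <= t <= 1) by lra.
  assert (Hsc := fun v Hv => Cmod_scaled rho Hrho v t Hv Ht1).
  rewrite !Cmod_mult.
  assert (B1 : Cmod (pw (- a) (v1 * RtoC t)%C) <= exp (a * ln 2)).
  { apply Cmod_pw_opp_le; [lra|]. specialize (Hsc v1 Hv1). lra. }
  assert (B2 : Cmod (pw (- b) (v2 * RtoC t)%C) <= exp (b * ln 2)).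
  { apply Cmod_pw_opp_le; [lra|]. specialize (Hsc v2 Hv2). lra. }
  assert (Hm : forall v, Cmod v <= rho -> 1 - rho <= Cmod (1 - v * RtoC t)%C).
  { intros v Hv. specialize (Hsc v Hv). generalize (Cmod_triangle_rev 1 (v * RtoC t)%C).
    rewrite Cmod_1. lra. }
  assert (B3 : Cmod ((v2 - v1) / ((1 - v1 * RtoC t) * (1 - v2 * RtoC t)))%C
    <= 2 / ((1 - rho) * (1 - rho))).
  { assert (M1 := Hm v1 Hv1). assert (M2 := Hm v2 Hv2).
    rewrite Cmod_div, Cmod_mult.
    - apply Rmult_le_compat; [apply Cmod_ge_0 | | |].
      + left. apply Rinv_0_lt_compat. nra.
      + eapply Rle_trans; [apply Cmod_triangle_minus|]. lra.
      + apply Rinv_le_contravar; [exact Hd|]. nra.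
    - apply Cmult_neq_0; apply Cmod_gt_0; lra. }
  assert (Ebound : forall u, eps <= u <= 1 - eps -> Cmod (boundary t u) <= e u * exp (- c * ln (1 - rho))).
  { intros u Hu. unfold boundary. rewrite Cmod_mult, Cmod_R, Rabs_pos_eq by (left; apply exp_pos).
    apply Rmult_le_compat_l; [left; apply exp_pos|].
    apply Cmod_pw_le; [unfold c; lra | lra |]. apply Hsc, y_bound. lra. }
  assert (Hln : forall x, 0 < x < 1 -> ln x < 0) by (intros; rewrite <- ln_1; apply ln_increasing; lra).
  assert (E1 : e eps <= exp (a * ln eps)).
  { unfold e. assert (H := Hln (1 - eps) ltac:(lra)).
    left. apply exp_increasing. nra. }
  assert (E2 : e (1 - eps) <= exp (b * ln eps)).
  { unfold e. replace (1 - (1 - eps)) with eps by ring. assert (H := Hln (1 - eps) ltac:(lra)).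
    left. apply exp_increasing. nra. }
  assert (B4 : Cmod (boundary t (1 - eps) - boundary t eps)%C <= X * exp (- c * ln (1 - rho))).
  { eapply Rle_trans; [apply Cmod_triangle_minus|].
    generalize (Ebound (1 - eps) ltac:(lra)) (Ebound eps ltac:(lra)) (exp_pos (- c * ln (1 - rho))).
    unfold X. nra. }
  unfold K.
  replace (exp (a * ln 2) * exp (b * ln 2) * (2 / ((1 - rho) * (1 - rho))) * exp (- c * ln (1 - rho)) * X)
    with (exp (a * ln 2) * exp (b * ln 2) * ((2 / ((1 - rho) * (1 - rho))) * (X * exp (- c * ln (1 - rho)))))
    by ring.
  apply Rmult_le_compat; [| |apply Rmult_le_compat; trivial; apply Cmod_ge_0
    |apply Rmult_le_compat; trivial; apply Cmod_ge_0];
    apply Rmult_le_pos; apply Cmod_ge_0.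
Qed.

Lemma hull_two_powers_approx :
  exists G, hull rho c G /\
    near (exp (- a * ln (1 - rho)) * exp (- b * ln (1 - rho)) * (K * X) / N)
      (fun s => pw a (v1 * RtoC s) * pw b (v2 * RtoC s))%C G.
Proof.
  assert (HN : 0 < N).
  { apply RInt_gt_0; [lra | intros; apply exp_pos | intros; apply w_cont; lra]. }
  set (L := c * exp (- (c + 1) * ln (1 - rho)) * 2).
  exists (average w (fun u s => pw c (y u * RtoC s)%C) eps (1 - eps)). split.
  - apply (average_closed_convex (hull rho c) w _ eps (1 - eps) L (hull_cc rho c)).
    + lra.
    + intros; apply w_cont; lra.
    + intros; apply exp_pos.
    + intros u Hu. apply hull_base, y_bound. lra.
    + intros s u Hs Hu.
      eapply rder_continuous. apply (rder_comp (pw c) (fun u => y u * RtoC s)%C).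
      * apply cder_pw, Re_one_minus.
        generalize (Cmod_scaled rho Hrho (y u) s (y_bound u ltac:(lra)) Hs). lra.
      * apply (der_mult RtoC y (fun _ => RtoC s)); [apply continuous_RtoC_id | apply rder_line | apply der_const].
    + intros u u' Hu Hu' s Hs.
      assert (Y1 := Cmod_scaled rho Hrho (y u) s (y_bound u ltac:(lra)) Hs).
      assert (Y2 := Cmod_scaled rho Hrho (y u') s (y_bound u' ltac:(lra)) Hs).
      apply Rle_trans with (c * exp (- (c + 1) * ln (1 - rho)) * Cmod (y u * RtoC s - y u' * RtoC s)%C).
      * apply (cder_mean_value (pw c) (fun x => RtoC c * pw (c + 1) x)%C).
        -- intros t Ht. apply cder_pw, Re_one_minus.
           generalize (cball_segment rho _ _ t Ht Y2 Y1). unfold cball. lra.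
        -- intros t Ht. rewrite Cmod_mult, Cmod_R, Rabs_pos_eq by (unfold c; lra).
           apply Rmult_le_compat_l; [unfold c; lra|].
           apply Cmod_pw_le; [unfold c; lra | lra|]. now apply cball_segment.
      * unfold L. rewrite !Rmult_assoc. apply Rmult_le_compat_l; [unfold c; lra|].
        apply Rmult_le_compat_l; [left; apply exp_pos|].
        replace (y u * RtoC s - y u' * RtoC s)%C with (RtoC s * (RtoC (u - u') * (v1 - v2)))%C
          by (unfold y; rewrite RtoC_minus; ring).
        rewrite !Cmod_mult, !Cmod_R, (Rabs_pos_eq s) by lra.
        assert (H2 : Cmod (v1 - v2)%C <= 2) by (eapply Rle_trans; [apply Cmod_triangle_minus|]; lra).
        generalize (Rabs_pos (u - u')) (Cmod_ge_0 (v1 - v2)%C). intros.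
        assert (Rabs (u - u') * Cmod (v1 - v2)%C <= 2 * Rabs (u - u')) by nra.
        assert (0 <= Rabs (u - u') * Cmod (v1 - v2)%C) by (apply Rmult_le_pos; assumption).
        nra.
  - intros s Hs. unfold average. fold (I s). fold N.
    assert (HNC : RtoC N <> RtoC 0) by (intros E; apply RtoC_inj in E; lra).
    replace (pw a (v1 * RtoC s) * pw b (v2 * RtoC s) - I s / RtoC N)%C
      with (- (pw a (v1 * RtoC s) * pw b (v2 * RtoC s) * (T s - RtoC N) / RtoC N))%C.
    2:{ unfold T. rewrite !pw_opp. field. repeat split; trivial; apply pw_neq_0. }
    rewrite Cmod_opp, Cmod_div, Cmod_R, (Rabs_pos_eq N) by (trivial; lra).
    apply Rmult_le_compat_r; [left; now apply Rinv_0_lt_compat|].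
    rewrite !Cmod_mult.
    apply Rmult_le_compat; [apply Rmult_le_pos; apply Cmod_ge_0 | apply Cmod_ge_0 | |now apply T_bound].
    apply Rmult_le_compat; try apply Cmod_ge_0; apply Cmod_pw_le; try lra; now apply Cmod_scaled.
Qed.

(** A lower bound for the mass that does not depend on eps, so that the error, a constant times
    [X / N], tends to 0. *)
Lemma beta_weight_lower : RInt w (/ 4) (3 / 4) <= N.
Proof.
  assert (Xw : forall x z, eps <= x -> x <= z -> z <= 1 - eps -> ex_RInt w x z).
  { intros x z Hx Hxz Hz. apply (ex_RInt_continuous (V := R_CompleteNormedModule)). intros u Hu.
    rewrite Rmin_left, Rmax_right in Hu by lra. apply w_cont. lra. }
  assert (Hp : forall x z, eps <= x -> x <= z -> z <= 1 - eps -> 0 <= RInt w x z).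
  { intros x z Hx Hxz Hz. apply RInt_ge_0; [lra | apply Xw; lra | intros; left; apply exp_pos]. }
  assert (C1 : RInt w eps (/ 4) + RInt w (/ 4) (3 / 4) = RInt w eps (3 / 4))
    by (apply (RInt_Chasles (V := R_CompleteNormedModule)); apply Xw; lra).
  assert (C2 : RInt w eps (3 / 4) + RInt w (3 / 4) (1 - eps) = N)
    by (apply (RInt_Chasles (V := R_CompleteNormedModule)); apply Xw; lra).
  generalize (Hp eps (/ 4) ltac:(lra) ltac:(lra) ltac:(lra))
    (Hp (3 / 4) (1 - eps) ltac:(lra) ltac:(lra) ltac:(lra)). lra.
Qed.

End Truncation.

(* Euler's Beta integral
   [A^(-a) B^(-b) = C int_0^1 u^(a-1) (1-u)^(b-1) (u A + (1-u) B)^(-a-b) du]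
   exhibits the product as a mean of powers with exponent [a + b]. *)
Lemma hull_two_powers : hull rho (a + b) (fun s => pw a (v1 * RtoC s) * pw b (v2 * RtoC s))%C.
Proof.
  apply (cc_lim _ (hull_cc rho (a + b))). intros d Hd.
  set (N0 := RInt w (/ 4) (3 / 4)).
  assert (HN0 : 0 < N0).
  { apply RInt_gt_0; [lra | intros; apply exp_pos | intros; apply w_cont; lra]. }
  set (K0 := exp (- a * ln (1 - rho)) * exp (- b * ln (1 - rho)) *
    (exp (a * ln 2) * exp (b * ln 2) * (2 / ((1 - rho) * (1 - rho))) * exp (- c * ln (1 - rho)))).
  assert (HK0 : 0 < K0).
  { assert (0 < (1 - rho) * (1 - rho)) by (apply Rmult_lt_0_compat; lra).
    unfold K0. repeat apply Rmult_lt_0_compat; try apply exp_pos; [lra|].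
    now apply Rinv_0_lt_compat. }
  set (dl := d * N0 / (2 * K0)).
  assert (Hdl : 0 < dl) by (apply Rdiv_lt_0_compat; [apply Rmult_lt_0_compat|]; lra).
  (* The last two entries are dl^(1/a) and dl^(1/b), so eps^a and eps^b are at most [dl]; and [dl]
     solves K0 (2 dl) = d N0. The entry 1/8 ensures eps < 1/4. *)
  set (eps := Rmin (/ 8) (Rmin (exp (ln dl / a)) (exp (ln dl / b)))).
  assert (Hexp : forall x, exp x > 0) by (intros; apply exp_pos).
  assert (Heps : 0 < eps < / 4).
  { split; [apply Rmin_pos; [lra | apply Rmin_pos; apply exp_pos]|].
    eapply Rle_lt_trans; [apply Rmin_l | lra]. }
  assert (Hpow : forall q, 0 < q -> eps <= exp (ln dl / q) -> exp (q * ln eps) <= dl).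
  { intros q Hq He. rewrite <- (exp_ln dl Hdl) at 1.
    assert (ln eps <= ln dl / q).
    { rewrite <- (ln_exp (ln dl / q)). apply Rcomplements.ln_le; lra. }
    apply exp_le, Rle_trans with (q * (ln dl / q)); [apply Rmult_le_compat_l; lra|].
    right. field. lra. }
  destruct (hull_two_powers_approx eps Heps) as (G & HG & HN).
  exists G. split; [exact HG|]. intros s Hs. eapply Rle_trans; [apply HN, Hs|].
  assert (P1 : exp (a * ln eps) <= dl).
  { apply Hpow; [exact Ha|]. unfold eps. eapply Rle_trans; [apply Rmin_r | apply Rmin_l]. }
  assert (P2 : exp (b * ln eps) <= dl).
  { apply Hpow; [exact Hb|]. unfold eps. eapply Rle_trans; [apply Rmin_r | apply Rmin_r]. }
  assert (NL := beta_weight_lower eps Heps). fold N0 in NL.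
  rewrite <- (Rmult_assoc (exp (- a * ln (1 - rho)) * exp (- b * ln (1 - rho)))). fold K0.
  set (N := RInt w eps (1 - eps)) in *.
  apply Rmult_le_reg_r with N; [lra|].
  unfold Rdiv. rewrite Rmult_assoc, Rinv_l, Rmult_1_r by lra.
  apply Rle_trans with (K0 * (2 * dl)); [apply Rmult_le_compat_l; lra|].
  replace (K0 * (2 * dl)) with (d * N0) by (unfold dl; field; lra).
  apply Rmult_le_compat_l; lra.
Qed.

End BetaIntegral.

(** * Products and exponentials in the hull *)

Section HullProducts.
Variable rho : R.
Hypothesis Hrho : 0 <= rho < 1.

(** The product is linear in each factor: for a fixed generator of order [b] the factor [F] runs
    over its hull, then for fixed [F] the factor [G] does. Generators are multiplied by the Beta
    integral. *)
Lemma hull_mult (a b : R) (F G : R -> C) : 0 < a -> 0 < b ->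
  hull rho a F -> hull rho b G -> hull rho (a + b) (fun s => F s * G s)%C.
Proof.
  intros Ha Hb HF HG.
  assert (H1 : forall v, Cmod v <= rho -> hull rho (a + b) (fun s => F s * pw b (v * RtoC s))%C).
  { intros v Hv. apply (hull_mult_right rho a (a + b) _ (exp (- b * ln (1 - rho)))); [| |exact HF].
    - intros s Hs. apply Cmod_pw_le; [lra | lra | now apply Cmod_scaled].
    - intros v' Hv'. now apply hull_two_powers. }
  apply (cc_ext _ (fun s => G s * F s)%C _ (hull_cc rho (a + b))); [intros; ring|].
  apply (hull_mult_right rho b (a + b) F (exp (- a * ln (1 - rho)))); [| |exact HG].
  - apply hull_bounded; [exact Hrho | lra | exact HF].
  - intros v Hv. apply (cc_ext _ _ _ (hull_cc rho (a + b))) with (2 := H1 v Hv). intros; ring.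
Qed.

Definition exp_primitive (c : R) (N : R -> C) (s : R) : C := Cexp (RtoC c * CInt N 0 s)%C.

(** All orders [c] at once: mixing two such functions with weights l and 1 - l calls for the orders
    c l and c (1 - l). *)
Definition exponentiable (N : R -> C) : Prop :=
  (forall s, 0 <= s <= 1 -> continuous N s) /\
  forall c, 0 < c -> hull rho c (exp_primitive c N).

(** Continuity at the ends of [0, 1] involves values outside, which uniform approximation on [0, 1]
    does not control; hence the passage to a closure before [closed_convex] applies. *)
Definition approx_exponentiable (N : R -> C) : Prop :=
  forall e, 0 < e -> exists N', near e N N' /\ exponentiable N'.

Lemma ex_CInt_sub (N : R -> C) (s : R) :
  (forall s, 0 <= s <= 1 -> continuous N s) -> 0 <= s <= 1 -> ex_CInt N 0 s.
Proof.
  intros H Hs. apply ex_CInt_continuous. intros u Hu.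
  rewrite Rmin_left, Rmax_right in Hu by lra. apply H. lra.
Qed.

(** The exponential of a sum is a product, so [hull_mult] applies with orders [c * l] and
    [c * (1 - l)]; the weights 0 and 1 are treated apart because these orders must be positive. *)
Lemma exponentiable_mix (l : R) (N1 N2 : R -> C) : 0 <= l <= 1 ->
  exponentiable N1 -> exponentiable N2 -> exponentiable (mix l N1 N2).
Proof.
  intros Hl [C1 H1] [C2 H2]. split.
  - intros s Hs. apply continuous_Cplus; (apply continuous_Cmult; [apply continuous_const|]); auto.
  - intros c Hc.
    assert (E : forall s, 0 <= s <= 1 ->
      CInt (mix l N1 N2) 0 s = (RtoC l * CInt N1 0 s + RtoC (1 - l) * CInt N2 0 s)%C).
    { intros s Hs. assert (X1 := ex_CInt_sub N1 s C1 Hs). assert (X2 := ex_CInt_sub N2 s C2 Hs).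
      unfold mix. rewrite CInt_plus by (now apply ex_CInt_scal).
      rewrite (CInt_scal _ N1), (CInt_scal _ N2) by assumption. reflexivity. }
    destruct (Req_dec l 0) as [->|Hl0].
    { apply (cc_ext _ _ _ (hull_cc rho c)) with (2 := H2 c Hc).
      intros s Hs. unfold exp_primitive. rewrite E by exact Hs. f_equal.
      rewrite Rminus_0_r. ring. }
    destruct (Req_dec l 1) as [->|Hl1].
    { apply (cc_ext _ _ _ (hull_cc rho c)) with (2 := H1 c Hc).
      intros s Hs. unfold exp_primitive. rewrite E by exact Hs. f_equal.
      rewrite Rminus_diag. ring. }
    assert (P1 : 0 < c * l) by (apply Rmult_lt_0_compat; lra).
    assert (P2 : 0 < c * (1 - l)) by (apply Rmult_lt_0_compat; lra).
    replace c with (c * l + c * (1 - l)) at 1 by ring.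
    apply (cc_ext _ _ _ (hull_cc rho (c * l + c * (1 - l))))
      with (2 := hull_mult _ _ _ _ P1 P2 (H1 _ P1) (H2 _ P2)).
    intros s Hs. unfold exp_primitive. rewrite E by exact Hs. rewrite <- Cexp_plus. f_equal.
    rewrite !RtoC_mult. ring.
Qed.

Lemma approx_exponentiable_cc : closed_convex approx_exponentiable.
Proof.
  split.
  - intros F G l Hl HF HG e He.
    destruct (HF e He) as (F' & NF & EF). destruct (HG e He) as (G' & NG & EG).
    exists (mix l F' G'). split; [now apply near_mix | now apply exponentiable_mix].
  - intros F H e He. destruct (H (e / 2)) as (G & HG & NG); [lra|].
    destruct (HG (e / 2)) as (G' & NG' & EG); [lra|].
    exists G'. split; [|exact EG]. replace e with (e / 2 + e / 2) by field.
    now apply near_trans with G.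
Qed.

(** The primitive of v / (1 - v s) is - log (1 - v s), so the exponential of [c] times it is a
    generator. *)
Lemma approx_exponentiable_base (v : C) : Cmod v <= rho ->
  approx_exponentiable (fun s => v / (1 - v * RtoC s))%C.
Proof.
  intros Hv e He. exists (fun s => v / (1 - v * RtoC s))%C. split.
  { intros s _. match goal with |- context [Cmod ?x] => replace x with (RtoC 0) by ring end.
    rewrite Cmod_0. lra. }
  assert (Hre : forall s, 0 <= s <= 1 -> 0 < Re (1 - v * RtoC s)%C).
  { intros s Hs. apply Re_one_minus. generalize (Cmod_scaled rho Hrho v s Hv Hs). lra. }
  assert (Dl : forall s, rder (fun s => v * RtoC s)%C s v).
  { intros s. eapply der_eq; [apply der_scal, der_var|]. ring. }
  assert (HC : forall s, 0 <= s <= 1 -> continuous (fun s => v / (1 - v * RtoC s))%C s).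
  { intros s Hs. apply continuous_Cmult; [apply continuous_const|].
    apply continuous_Cinv; [now apply one_minus_neq_0, Hre|].
    apply continuous_Cminus; [apply continuous_const | eapply rder_continuous, Dl]. }
  split; [exact HC|]. intros c Hc.
  apply (cc_ext _ _ _ (hull_cc rho c)) with (2 := hull_base rho c v Hv).
  intros s Hs. unfold exp_primitive, pw. f_equal.
  rewrite (CInt_rder (fun s => - Clog (1 - v * RtoC s))%C).
  - replace (1 - v * RtoC 0)%C with (RtoC 1) by ring. rewrite Clog_1, RtoC_opp. ring.
  - intros u Hu. rewrite Rmin_left, Rmax_right in Hu by lra.
    eapply der_eq.
    + apply der_opp. apply (rder_comp (fun z => Clog (1 - z))%C (fun s => v * RtoC s)%C);
        [apply cder_Clog_one_minus, Hre; lra | apply Dl].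
    + field. apply one_minus_neq_0, Hre. lra.
  - intros u Hu. rewrite Rmin_left, Rmax_right in Hu by lra. apply HC. lra.
Qed.

Lemma Cexp_diff (z w : C) : Cmod (w - z)%C <= 1 ->
  Cmod (Cexp w - Cexp z)%C <= exp 1 * Cmod (Cexp z) * Cmod (w - z)%C.
Proof.
  intros H. apply (cder_mean_value Cexp Cexp).
  - intros; apply cder_Cexp.
  - intros t Ht. rewrite Cexp_plus, Cmod_mult, Rmult_comm.
    apply Rmult_le_compat_r; [apply Cmod_ge_0|].
    rewrite Cmod_Cexp, re_scal_l.
    apply exp_le. generalize (re_le_Cmod (w - z)%C) (Rle_abs (Re (w - z)%C)). nra.
Qed.

Lemma hull_exp_primitive (N : R -> C) (c : R) : 0 < c ->
  (forall s, 0 <= s <= 1 -> continuous N s) -> approx_exponentiable N ->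
  hull rho c (exp_primitive c N).
Proof.
  intros Hc HN H. apply (cc_lim _ (hull_cc rho c)). intros e He.
  set (B := exp (- c * ln (1 - rho))). assert (HB : 0 < B) by apply exp_pos.
  assert (He1 : 0 < exp 1) by apply exp_pos.
  (* The first bound gives c d <= 1, under which [Cexp_diff] applies; the second makes exp 1 times B
     c d at most [e]. The modulus bound [B] is available for the approximant, which already lies in
     the hull. *)
  set (d := Rmin (/ c) (e / (exp 1 * B * c))).
  assert (Hp : 0 < exp 1 * B * c) by (repeat apply Rmult_lt_0_compat; assumption).
  assert (Hd : 0 < d).
  { apply Rmin_pos; [now apply Rinv_0_lt_compat | now apply Rdiv_lt_0_compat]. }
  destruct (H d Hd) as (N' & Hnear & HC' & HN'). exists (exp_primitive c N').
  split; [now apply HN'|]. intros s Hs. unfold exp_primitive.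
  assert (Hdiff : Cmod (RtoC c * CInt N 0 s - RtoC c * CInt N' 0 s)%C <= c * d).
  { replace (RtoC c * CInt N 0 s - RtoC c * CInt N' 0 s)%C
      with (RtoC c * CInt (fun u => N u - N' u)%C 0 s)%C.
    2:{ rewrite CInt_minus by now apply ex_CInt_sub. ring. }
    rewrite Cmod_mult, Cmod_R, Rabs_pos_eq by lra. apply Rmult_le_compat_l; [lra|].
    apply Rle_trans with ((s - 0) * d); [|nra].
    apply CInt_norm_le; [lra | apply ex_CInt_minus; now apply ex_CInt_sub|].
    intros u Hu. apply Hnear. lra. }
  assert (Hcd : c * d <= 1).
  { apply Rle_trans with (c * / c); [apply Rmult_le_compat_l; [lra | apply Rmin_l]|].
    right. field. lra. }
  eapply Rle_trans; [apply Cexp_diff; lra|].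
  assert (HB' := hull_bounded rho Hrho c _ ltac:(lra) (HN' c Hc) s Hs).
  fold B in HB'. unfold exp_primitive in HB'.
  apply Rle_trans with (exp 1 * B * (c * d)).
  - apply Rmult_le_compat; [apply Rmult_le_pos; [lra | apply Cmod_ge_0] | apply Cmod_ge_0 | | exact Hdiff].
    apply Rmult_le_compat_l; lra.
  - apply Rle_trans with (exp 1 * B * (c * (e / (exp 1 * B * c)))).
    + apply Rmult_le_compat_l; [nra|]. apply Rmult_le_compat_l; [lra | apply Rmin_r].
    + right. field. repeat split; lra.
Qed.

(** The estimate passes from the generators to the hull because it is affine and stable under
    uniform limits. The class used in the induction puts integrability and the estimate on nearby
    functions, so that its closure under limits is immediate. *)
Lemma hull_functional_bound (c m : R) (e : C) (F : R -> C) :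
  (forall v, Cmod v < 1 -> m <= Re (e * CInt (fun s => pw c (v * RtoC s)) 0 1)%C) ->
  (forall s, 0 <= s <= 1 -> continuous F s) -> hull rho c F ->
  m <= Re (e * CInt F 0 1)%C.
Proof.
  intros Hm HFc HF.
  assert (X : forall d, 0 < d -> exists G, near d F G /\ ex_CInt G 0 1 /\ m <= Re (e * CInt G 0 1)%C).
  { apply (HF (fun F => forall d, 0 < d -> exists G, near d F G /\ ex_CInt G 0 1 /\
      m <= Re (e * CInt G 0 1)%C)).
    - split.
      + intros F1 F2 l Hl H1 H2 d Hd.
        destruct (H1 d Hd) as (G1 & N1 & E1 & M1). destruct (H2 d Hd) as (G2 & N2 & E2 & M2).
        exists (mix l G1 G2). split; [now apply near_mix|].
        assert (X1 : ex_CInt (fun s => RtoC l * G1 s)%C 0 1) by now apply ex_CInt_scal.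
        assert (X2 : ex_CInt (fun s => RtoC (1 - l) * G2 s)%C 0 1) by now apply ex_CInt_scal.
        split; [now apply ex_CInt_plus|].
        unfold mix. rewrite CInt_plus, (CInt_scal _ G1), (CInt_scal _ G2) by assumption.
        replace (e * (RtoC l * CInt G1 0 1 + RtoC (1 - l) * CInt G2 0 1))%C
          with (RtoC l * (e * CInt G1 0 1) + RtoC (1 - l) * (e * CInt G2 0 1))%C by ring.
        rewrite re_plus, !re_scal_l. nra.
      + intros F1 H d Hd. destruct (H (d / 2)) as (F2 & H2 & N2); [lra|].
        destruct (H2 (d / 2)) as (G & NG & EG & MG); [lra|].
        exists G. split; [|now split]. replace d with (d / 2 + d / 2) by field.
        now apply near_trans with F2.
    - intros v Hv d Hd. exists (fun s => pw c (v * RtoC s)%C). split; [|split].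
      + intros s _. match goal with |- context [Cmod ?x] => replace x with (RtoC 0) by ring end.
        rewrite Cmod_0. lra.
      + apply ex_CInt_continuous. intros s Hs. rewrite Rmin_left, Rmax_right in Hs by lra.
        eapply rder_continuous. apply (rder_comp (pw c) (fun s => v * RtoC s)%C).
        * apply cder_pw, Re_one_minus. generalize (Cmod_scaled rho Hrho v s Hv Hs). lra.
        * apply der_scal, der_var.
      + apply Hm. lra. }
  apply Rnot_lt_le. intros Hlt.
  set (g := m - Re (e * CInt F 0 1)%C) in *.
  assert (He := Cmod_ge_0 e).
  destruct (X (g / (2 * (Cmod e + 1)))) as (G & NG & EG & MG).
  { apply Rdiv_lt_0_compat; unfold g; lra. }
  assert (EF := ex_CInt_sub F 1 HFc ltac:(lra)).
  assert (Hd : Cmod (e * (CInt G 0 1 - CInt F 0 1))%C <= Cmod e * (g / (2 * (Cmod e + 1)))).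
  { rewrite Cmod_mult. apply Rmult_le_compat_l; [exact He|].
    rewrite <- CInt_minus by assumption.
    replace (g / (2 * (Cmod e + 1))) with ((1 - 0) * (g / (2 * (Cmod e + 1)))) by ring.
    apply CInt_norm_le; [lra | now apply ex_CInt_minus|].
    intros s Hs. rewrite Cmod_minus_sym. now apply NG. }
  assert (Cmod e * (g / (2 * (Cmod e + 1))) < g).
  { apply Rmult_lt_reg_r with (2 * (Cmod e + 1)); [lra|].
    replace (Cmod e * (g / (2 * (Cmod e + 1))) * (2 * (Cmod e + 1))) with (Cmod e * g) by (field; lra).
    unfold g. nra. }
  assert (Re (e * CInt G 0 1)%C - Re (e * CInt F 0 1)%C <= Cmod (e * (CInt G 0 1 - CInt F 0 1))%C).
  { eapply Rle_trans; [|apply re_le_Cmod]. eapply Rle_trans; [|apply Rle_abs]. right.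
    replace (e * (CInt G 0 1 - CInt F 0 1))%C with (e * CInt G 0 1 + - (e * CInt F 0 1))%C by ring.
    rewrite re_plus, re_opp. ring. }
  unfold g in *. lra.
Qed.

End HullProducts.

(** * Convex functions of order alpha *)

Lemma cder_k (alpha : R) (z : C) : 0 < Re (1 - z)%C ->
  cder (k alpha) z (pw (2 - 2 * alpha) z).
Proof.
  intros Hz. unfold k. destruct (Req_EM_T alpha (1 / 2)) as [->|Hn].
  - eapply der_eq; [apply der_opp, cder_Clog_one_minus, Hz|].
    replace (2 - 2 * (1 / 2)) with 1 by field. rewrite pw_1 by exact Hz. ring.
  - apply der_ext with (fun z => RtoC (/ (1 - 2 * alpha)) * (pw (1 - 2 * alpha) z - 1))%C.
    { intros w. unfold Cpowr, pw. do 4 f_equal. f_equal. ring. }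
    eapply der_eq.
    + apply der_scal, der_minus; [apply cder_pw, Hz | apply der_const].
    + replace (1 - 2 * alpha + 1) with (2 - 2 * alpha) by ring.
      rewrite RtoC_inv by lra. field. intros E. apply RtoC_inj in E. lra.
Qed.

Lemma k_0 (alpha : R) : k alpha (RtoC 0) = RtoC 0.
Proof.
  unfold k. destruct (Req_EM_T alpha (1 / 2)) as [_|Hn].
  - replace (1 - 0)%C with (RtoC 1) by ring. rewrite Clog_1. ring.
  - unfold Cpowr. replace (1 - 0)%C with (RtoC 1) by ring.
    rewrite Clog_1, Cmult_0_r, Cexp_0. ring.
Qed.

Lemma Re_one_minus_scaled (z : C) (s : R) : 0 <= s <= 1 -> 0 < Re (1 - z)%C ->
  0 < Re (1 - z * RtoC s)%C.
Proof.
  unfold Cminus. rewrite !re_plus, !re_opp, re_scal_r, re_RtoC. intros Hs H.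
  destruct (Rle_dec (Re z) 0); nra.
Qed.

Lemma rder_scaled (z : C) (s : R) : rder (fun s => z * RtoC s)%C s z.
Proof. eapply der_eq; [apply der_scal, der_var|]. ring. Qed.

Lemma continuous_pw_scaled (c : R) (z : C) (s : R) : 0 <= s <= 1 -> 0 < Re (1 - z)%C ->
  continuous (fun s => pw c (z * RtoC s)%C) s.
Proof.
  intros Hs Hz. eapply rder_continuous. apply (rder_comp (pw c) (fun s => z * RtoC s)%C).
  - apply cder_pw, Re_one_minus_scaled; assumption.
  - apply rder_scaled.
Qed.

(** One formula for the three cases of the definition: z = 0, alpha = 1/2 and the general power. It
    holds for Re z < 1, thus also on the circle without 1. *)
Lemma h_integral (alpha : R) (z : C) : 0 < Re (1 - z)%C ->
  h alpha z = CInt (fun s => pw (2 - 2 * alpha) (z * RtoC s)%C) 0 1.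
Proof.
  intros Hz. unfold h, div_id. destruct (Ceq_dec z (RtoC 0)) as [->|Hn].
  - rewrite (CInt_ext _ (fun _ => RtoC 1)).
    + rewrite CInt_const, Rminus_0_r. ring.
    + intros s _. replace (RtoC 0 * RtoC s)%C with (RtoC 0) by ring. apply pw_at_0.
  - assert (E : CInt (fun s => z * pw (2 - 2 * alpha) (z * RtoC s))%C 0 1 = k alpha z).
    { rewrite (CInt_rder (fun s => k alpha (z * RtoC s)%C)).
      - replace (z * RtoC 0)%C with (RtoC 0) by ring. rewrite k_0.
        replace (z * RtoC 1)%C with z by ring. ring.
      - intros s Hs. rewrite Rmin_left, Rmax_right in Hs by lra.
        eapply der_eq; [apply (rder_comp (k alpha) (fun s => z * RtoC s)%C);
          [apply cder_k, Re_one_minus_scaled; assumption | apply rder_scaled]|]. ring.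
      - intros s Hs. rewrite Rmin_left, Rmax_right in Hs by lra.
        apply continuous_Cmult; [apply continuous_const | now apply continuous_pw_scaled]. }
    rewrite <- E, CInt_scal.
    + field. exact Hn.
    + apply ex_CInt_continuous. intros s Hs. rewrite Rmin_left, Rmax_right in Hs by lra.
      now apply continuous_pw_scaled.
Qed.

Lemma rder_CInt_upper (N : R -> C) (d s : R) : 0 < d -> 0 <= s <= 1 ->
  (forall u, - d < u < 1 + d -> continuous N u) -> rder (fun s => CInt N 0 s) s (N s).
Proof.
  intros Hd Hs HN. apply rder_is_derive.
  apply (is_derive_RInt (V := C_R_NormedModule) N (fun s => CInt N 0 s) 0 s).
  - apply locally_R_Rabs. exists d. split; [exact Hd|]. intros x Hx. apply Rabs_def2 in Hx.
    apply CInt_correct, ex_CInt_continuous. intros u Hu. apply HN.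
    unfold Rmin, Rmax in Hu. destruct (Rle_dec 0 x); lra.
  - apply HN. lra.
Qed.

Lemma continuous_eq_off_0 (F G : C -> C) (r : R) : 0 < r ->
  continuous F (RtoC 0) -> continuous G (RtoC 0) ->
  (forall z, Cmod z < r -> z <> RtoC 0 -> F z = G z) -> F (RtoC 0) = G (RtoC 0).
Proof.
  intros Hr HF HG H. apply Ceq_minus, Cmod_eq_0, Rle_antisym; [|apply Cmod_ge_0].
  apply Rnot_lt_le. intros Hlt. set (e := Cmod (F (RtoC 0) - G (RtoC 0))%C) in *.
  assert (He : 0 < e / 2) by lra.
  destruct (proj1 (locally_C_Cmod _ _) (filter_and _ _
    (proj1 (continuous_C_eps _ _) HF _ He) (proj1 (continuous_C_eps _ _) HG _ He))) as (d & Hd & Hloc).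
  set (x := Rmin d r / 2). assert (Hm : 0 < Rmin d r) by (apply Rmin_pos; assumption).
  assert (Hx : 0 < x < Rmin d r) by (unfold x; lra).
  assert (Hxd := Rmin_l d r). assert (Hxr := Rmin_r d r).
  destruct (Hloc (RtoC x)) as [H1 H2].
  { replace (RtoC x - 0)%C with (RtoC x) by ring. rewrite Cmod_R, Rabs_pos_eq; lra. }
  rewrite (H (RtoC x)) in H1.
  2:{ rewrite Cmod_R, Rabs_pos_eq; lra. }
  2:{ intros E. apply RtoC_inj in E. lra. }
  assert (e <= Cmod (G (RtoC x) - G (RtoC 0))%C + Cmod (G (RtoC x) - F (RtoC 0))%C).
  { unfold e. replace (F (RtoC 0) - G (RtoC 0))%C
      with ((G (RtoC x) - G (RtoC 0)) - (G (RtoC x) - F (RtoC 0)))%C by ring.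
    apply Cmod_triangle_minus. }
  lra.
Qed.

Section ConvexOfOrder.
Variables (alpha : R) (f : C -> C).
Hypothesis Halpha : 0 <= alpha < 1.
Hypothesis Hf : convex_of_order alpha f.

Let p := 2 - 2 * alpha.
Let f1 := C_derive f.
Let f2 := C_derive f1.

Let holo_f : holo f.
Proof.
  intros z Hz. destruct Hf as [H _]. destruct (H z Hz) as [l Hl].
  exists l. now apply cder_is_derive.
Qed.

Let holo_f1 : holo f1.
Proof. now apply holo_C_derive. Qed.

Let holo_f2 : holo f2.
Proof. now apply holo_C_derive. Qed.

Let f1_neq_0 (z : C) : Cmod z < 1 -> f1 z <> RtoC 0.
Proof. intros Hz. destruct Hf as (_ & _ & _ & H). apply (H z Hz). Qed.

Let g (z : C) : C := (f2 z / f1 z)%C.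

Let holo_g : holo g.
Proof.
  intros z Hz. destruct (holo_f1 z Hz) as [l1 H1]. destruct (holo_f2 z Hz) as [l2 H2].
  eexists. apply der_div; [apply continuous_C_id | now apply f1_neq_0 | exact H2 | exact H1].
Qed.

(** The quantity in the definition of order alpha, normalised to (1 + z f''/f' - alpha) / (1 -
    alpha): it has positive real part, and the value 1 at the origin. *)
Let q (z : C) : C := (1 + z * g z / RtoC (1 - alpha))%C.

Let alpha_neq : RtoC (1 - alpha) <> RtoC 0.
Proof. intros E. apply RtoC_inj in E. lra. Qed.

Let holo_q : holo q.
Proof.
  intros z Hz. destruct (holo_g z Hz) as [l Hl]. eexists.
  apply der_plus; [apply der_const|].
  apply der_div; [apply continuous_C_id | exact alpha_neq | | apply der_const].
  apply der_mult; [apply continuous_C_id | apply der_var | exact Hl].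
Qed.

Let q_pos (z : C) : Cmod z < 1 -> 0 < Re (q z).
Proof.
  intros Hz. destruct Hf as (_ & _ & _ & H). destruct (H z Hz) as [_ Hre].
  fold f1 in Hre. fold f2 in Hre. unfold q, g.
  replace (1 + z * (f2 z / f1 z) / RtoC (1 - alpha))%C
    with (RtoC (/ (1 - alpha)) * (1 + z * f2 z / f1 z - RtoC alpha))%C.
  2:{ rewrite RtoC_inv by lra. rewrite RtoC_minus in alpha_neq |- *.
      field. split; [now apply f1_neq_0 | exact alpha_neq]. }
  rewrite re_scal_l. unfold Cminus. rewrite re_plus, re_opp, re_RtoC.
  apply Rmult_lt_0_compat; [apply Rinv_0_lt_compat; lra | lra].
Qed.

Variable z : C.
Hypothesis Hz : Cmod z < 1.

Let r := (1 + Cmod z) / 2.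
Let rho := Cmod z / r.

Let Hr : Cmod z < r /\ 0 < r /\ r < 1.
Proof. generalize (Cmod_ge_0 z). unfold r. lra. Qed.

Let Hrho : 0 <= rho < 1.
Proof.
  generalize (Cmod_ge_0 z). intros. unfold rho.
  split; [apply Rmult_le_pos; [lra | left; apply Rinv_0_lt_compat; lra]|].
  apply Rmult_lt_reg_r with r; [lra|]. unfold Rdiv. rewrite Rmult_assoc, Rinv_l; lra.
Qed.

Let mu (t : R) : R := Re (q (circle r t)).
Let v (t : R) : C := (z / circle r t)%C.

Let mu_cont (t : R) : continuous mu t.
Proof. apply continuous_Re, ex_CInt_circle; [exact holo_q | lra]. Qed.

Let mu_pos (t : R) : 0 < mu t.
Proof. apply q_pos. rewrite Cmod_circle; lra. Qed.

Let mu_total : RInt mu 0 (2 * PI) = 2 * PI.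
Proof.
  assert (M := mean_value_property q r holo_q ltac:(lra)).
  apply (f_equal Re) in M. rewrite CInt_Re in M.
  - unfold mu. rewrite M, re_scal_l. unfold q.
    replace (1 + 0 * g (RtoC 0) / RtoC (1 - alpha))%C with (RtoC 1) by (field; exact alpha_neq).
    simpl. ring.
  - apply ex_CInt_continuous. intros t _. apply ex_CInt_circle; [exact holo_q | lra].
Qed.

Let circle_neq_0 (t : R) : circle r t <> RtoC 0.
Proof.
  replace (circle r t) with (circle r t - 0)%C by ring. apply circle_neq. rewrite Cmod_0. lra.
Qed.

Let ex_mu_kernel (zeta : C) : Cmod zeta < r ->
  ex_CInt (fun t => RtoC (mu t) * / (circle r t - zeta))%C 0 (2 * PI).
Proof.
  intros Hzeta. apply ex_CInt_continuous. intros t _.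
  apply continuous_Cmult; [apply continuous_RtoC, mu_cont|].
  apply continuous_Cinv; [now apply circle_neq|].
  apply continuous_Cminus; [apply continuous_circle | apply continuous_const].
Qed.

(** Herglotz's formula for [q], after removing the constant terms and dividing by zeta. The division
    excludes zeta = 0, which is recovered by continuity. *)
Let g_representation (zeta : C) : Cmod zeta < r ->
  (RtoC (2 * PI) * g zeta = RtoC p * CInt (fun t => RtoC (mu t) * / (circle r t - zeta)) 0 (2 * PI))%C.
Proof.
  assert (Off : forall zeta, Cmod zeta < r -> zeta <> RtoC 0 ->
    (RtoC (2 * PI) * g zeta = RtoC p * CInt (fun t => RtoC (mu t) * / (circle r t - zeta)) 0 (2 * PI))%C).
  { intros x Hx Hx0. assert (H := Herglotz q r x holo_q Hx ltac:(lra)).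
    rewrite (CInt_ext _ (fun t => 2 * RtoC (mu t) + 2 * x * (RtoC (mu t) * / (circle r t - x)))%C) in H.
    2:{ intros t _. fold (mu t). rewrite RtoC_mult. field. now apply circle_neq. }
    assert (Xm : ex_CInt (fun t => RtoC (mu t)) 0 (2 * PI)).
    { apply ex_CInt_continuous. intros t _. apply continuous_RtoC, mu_cont. }
    assert (Xk := ex_mu_kernel x Hx).
    assert (Xr : ex_RInt mu 0 (2 * PI)).
    { apply (ex_RInt_continuous (V := R_CompleteNormedModule)). intros; apply mu_cont. }
    assert (X1 : ex_CInt (fun t => 2 * RtoC (mu t))%C 0 (2 * PI)) by now apply ex_CInt_scal.
    assert (X2 : ex_CInt (fun t => 2 * x * (RtoC (mu t) * / (circle r t - x)))%C 0 (2 * PI))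
      by now apply ex_CInt_scal.
    rewrite CInt_plus, !CInt_scal, CInt_RtoC, mu_total in H by assumption.
    set (J := CInt (fun t => RtoC (mu t) * / (circle r t - x))%C 0 (2 * PI)) in *.
      assert (q0 : q (RtoC 0) = RtoC 1).
      { unfold q. field. exact alpha_neq. }
      rewrite q0 in H. replace (Cconj (RtoC 1)) with (RtoC 1) in H by (apply C_ext; simpl; ring).
      unfold q in H.
      assert (H' : (2 * x * J = RtoC (2 * PI) * (x * g x / RtoC (1 - alpha)))%C).
      { replace (2 * x * J)%C with (2 * RtoC (2 * PI) + 2 * x * J - 2 * RtoC (2 * PI))%C by ring.
        rewrite H. ring. }
      replace (RtoC p) with (2 * RtoC (1 - alpha))%C by (rewrite <- RtoC_mult; f_equal; unfold p; ring).
      replace (2 * RtoC (1 - alpha) * J)%C with (RtoC (1 - alpha) * (2 * x * J) / x)%C by (field; exact Hx0).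
      rewrite H'. field. split; [exact alpha_neq | exact Hx0]. }
  intros Hzeta. destruct (Ceq_dec zeta (RtoC 0)) as [->|Hn]; [|now apply Off].
  apply (continuous_eq_off_0 (fun zeta => RtoC (2 * PI) * g zeta)%C
    (fun zeta => RtoC p * CInt (fun t => RtoC (mu t) * / (circle r t - zeta)) 0 (2 * PI))%C r); [lra| | |exact Off].
  - apply continuous_Cmult; [apply continuous_const|].
    apply holo_continuous; [exact holo_g | rewrite Cmod_0; lra].
  - apply continuous_Cmult; [apply continuous_const|].
    apply (continuous_C_ext (fun zeta => CInt (fun t => RtoC (mu t) * (/ (circle r t - zeta)) ^ 1)%C 0 (2 * PI))).
    + intros y. apply CInt_ext. intros t _. simpl. ring.
    + eapply cder_continuous, cder_Cauchy_kernel; [|exact Hzeta].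
      intros t. apply continuous_RtoC, mu_cont.
Qed.

(** The logarithmic derivative of s -> f'(z s), divided by [p]; by [g_representation] it is a mean
    of the functions v / (1 - v s) with v = z / w, w on the circle. *)
Let N (s : R) : C := (z * g (z * RtoC s) / RtoC p)%C.

Let p_neq : RtoC p <> RtoC 0.
Proof. intros E. apply RtoC_inj in E. unfold p in E. lra. Qed.

(** Two-sided derivatives are taken at s = 0 and s = 1 as well, which calls for room on both
    sides. *)
Let margin : exists d, 0 < d /\ forall s, - d < s < 1 + d -> Cmod (z * RtoC s)%C < 1.
Proof.
  exists ((1 - Cmod z) / 2). split; [lra|]. intros s Hs.
  rewrite Cmod_mult, Cmod_R. assert (Hzp := Cmod_ge_0 z).
  assert (Rabs s <= 1 + (1 - Cmod z) / 2) by (apply Rabs_le; lra).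
  assert (Cmod z * Rabs s <= Cmod z * (1 + (1 - Cmod z) / 2)) by (apply Rmult_le_compat_l; assumption).
  nra.
Qed.

Let N_cont (s : R) : Cmod (z * RtoC s)%C < 1 -> continuous N s.
Proof.
  intros Hs. apply continuous_Cmult; [|apply continuous_const].
  apply continuous_Cmult; [apply continuous_const|].
  apply (continuous_comp (fun s => z * RtoC s)%C g).
  - eapply rder_continuous, rder_scaled.
  - now apply holo_continuous.
Qed.

Let in_disc (s : R) : 0 <= s <= 1 -> Cmod (z * RtoC s)%C < 1.
Proof.
  intros Hs. rewrite Cmod_mult, Cmod_R, Rabs_pos_eq by lra. generalize (Cmod_ge_0 z). nra.
Qed.

Let v_bound (t : R) : Cmod (v t) <= rho.
Proof.
  unfold v. rewrite Cmod_div by apply circle_neq_0. rewrite Cmod_circle by lra. apply Rle_refl.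
Qed.

Let v_lip (t t' : R) : Cmod (v t - v t')%C <= Rabs (t - t').
Proof.
  assert (H : forall a b, a <= b -> Cmod (v b - v a)%C <= 1 * (b - a)).
  { intros a b Hab. apply (rder_mean_value v (fun t => - Ci * v t)%C); [exact Hab| |].
    - intros x _. eapply der_eq.
      + apply der_div; [apply continuous_RtoC_id | apply circle_neq_0 | apply der_const | apply rder_circle].
      + unfold v. cbv beta. field. apply circle_neq_0.
    - intros x _. rewrite Cmod_mult, Cmod_opp, Cmod_Ci. generalize (v_bound x). lra. }
  destruct (Rle_dec t t') as [Hle|Hle].
  - rewrite Cmod_minus_sym, Rabs_minus_sym, Rabs_pos_eq by lra. specialize (H t t' Hle). lra.
  - rewrite Rabs_pos_eq by lra. specialize (H t' t ltac:(lra)). lra.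
Qed.

Let N_approx : approx_exponentiable rho N.
Proof.
  assert (HPI := PI_RGT_0).
  assert (Hden : forall t s, 0 <= s <= 1 -> 1 - rho <= Cmod (1 - v t * RtoC s)%C).
  { intros t s Hs. generalize (Cmod_triangle_rev 1 (v t * RtoC s)%C)
      (Cmod_scaled rho Hrho (v t) s (v_bound t) Hs). rewrite Cmod_1. lra. }
  assert (Hden0 : forall t s, 0 <= s <= 1 -> (1 - v t * RtoC s)%C <> RtoC 0).
  { intros t s Hs. apply Cmod_gt_0. specialize (Hden t s Hs). lra. }
  assert (Vc : forall t, continuous v t).
  { intros t. apply continuous_Cmult; [apply continuous_const|].
    apply continuous_Cinv; [apply circle_neq_0 | apply continuous_circle]. }
  apply (cc_ext _ (average mu (fun t s => v t / (1 - v t * RtoC s))%C 0 (2 * PI)) _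
    (approx_exponentiable_cc rho Hrho)).
  - intros s Hs. unfold average. rewrite mu_total.
    assert (Hzs : Cmod (z * RtoC s)%C < r).
    { rewrite Cmod_mult, Cmod_R, Rabs_pos_eq by lra. generalize (Cmod_ge_0 z). nra. }
    assert (E := g_representation _ Hzs).
    assert (HPC : RtoC (2 * PI) <> RtoC 0) by (intros E'; apply RtoC_inj in E'; lra).
    rewrite (CInt_ext _ (fun t => z * (RtoC (mu t) * / (circle r t - z * RtoC s)))%C).
    + rewrite CInt_scal by now apply ex_mu_kernel.
      set (J := CInt (fun t => RtoC (mu t) * / (circle r t - z * RtoC s))%C 0 (2 * PI)) in *.
      unfold N. replace J with (RtoC p * J / RtoC p)%C by (field; exact p_neq).
      rewrite <- E. field. split; [exact p_neq | exact HPC].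
    + intros t _. unfold v. field. split; [now apply circle_neq|]. apply circle_neq_0.
  - apply (average_closed_convex _ mu _ 0 (2 * PI) (/ ((1 - rho) * (1 - rho)))
      (approx_exponentiable_cc rho Hrho)).
    + lra.
    + intros; apply mu_cont.
    + intros; apply mu_pos.
    + intros t _. apply (approx_exponentiable_base rho Hrho), v_bound.
    + intros s t Hs _. apply continuous_Cmult; [apply Vc|].
      apply continuous_Cinv; [now apply Hden0|].
      apply continuous_Cminus; [apply continuous_const|].
      apply continuous_Cmult; [apply Vc | apply continuous_const].
    + intros t t' _ _ s Hs.
      assert (D1 := Hden t s Hs). assert (D2 := Hden t' s Hs).
      assert (Z1 := Hden0 t s Hs). assert (Z2 := Hden0 t' s Hs).
      replace (v t / (1 - v t * RtoC s) - v t' / (1 - v t' * RtoC s))%C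
        with ((v t - v t') * / ((1 - v t * RtoC s) * (1 - v t' * RtoC s)))%C
        by (field; split; assumption).
      rewrite Cmod_mult, Rmult_comm.
      rewrite Cmod_inv, Cmod_mult by (apply Cmult_neq_0; assumption).
      assert (0 < (1 - rho) * (1 - rho)) by (apply Rmult_lt_0_compat; lra).
      apply Rmult_le_compat; [left; apply Rinv_0_lt_compat; nra | apply Cmod_ge_0 | | apply v_lip].
      apply Rinv_le_contravar; [assumption|]. nra.
Qed.

Let f1_exp (s : R) : 0 <= s <= 1 -> f1 (z * RtoC s)%C = exp_primitive p N s.
Proof.
  intros Hs. destruct margin as (d & Hd & Hm).
  (* The quotient of f'(z s) by the exponential has derivative 0 and the value 1 at s = 0. *)
  set (E := fun s => (f1 (z * RtoC s) * Cexp (- (RtoC p * CInt N 0 s)))%C).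
  assert (DE : forall t, 0 <= t <= 1 -> rder E t (RtoC 0)).
  { intros t Ht. assert (Hin := in_disc t Ht). eapply der_eq.
    - apply der_mult; [apply continuous_RtoC_id| |].
      + apply (rder_comp f1 (fun s => z * RtoC s)%C); [now apply holo_cder | apply rder_scaled].
      + apply (rder_comp Cexp (fun s => - (RtoC p * CInt N 0 s))%C); [apply cder_Cexp|].
        apply der_opp, der_scal, (rder_CInt_upper N d t Hd Ht).
        intros u Hu. now apply N_cont, Hm.
    - cbv beta. fold f2. unfold N at 3, g. assert (Hn := f1_neq_0 _ Hin).
      field. split; assumption. }
  assert (HE : E s = RtoC 1).
  { replace (E s) with (E 0 + (E s - E 0))%C by ring.
    assert (E0 : E 0 = RtoC 1).
    { unfold E. rewrite CInt_point. replace (z * RtoC 0)%C with (RtoC 0) by ring.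
      replace (- (RtoC p * 0))%C with (RtoC 0) by ring. rewrite Cexp_0.
      destruct Hf as (_ & _ & H1 & _). fold f1 in H1. rewrite H1. ring. }
    rewrite E0. replace (E s - 1)%C with (RtoC 0); [ring|].
    symmetry. apply Cmod_eq_0, Rle_antisym; [|apply Cmod_ge_0].
    rewrite <- E0. replace 0 with (0 * (s - 0)) at 2 by ring.
    apply (rder_mean_value E (fun _ => RtoC 0)); [lra | intros; apply DE; lra|].
    intros; rewrite Cmod_0; lra. }
  unfold E in HE. rewrite Cexp_opp in HE. fold (exp_primitive p N s) in HE.
  assert (Hn : exp_primitive p N s <> RtoC 0) by apply Cexp_neq_0.
  replace (f1 (z * RtoC s)%C) with (f1 (z * RtoC s) * / exp_primitive p N s * exp_primitive p N s)%C
    by (field; exact Hn).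
  rewrite HE. ring.
Qed.

Lemma convex_of_order_lower_bound (e : C) (m : R) :
  (forall w, Cmod w < 1 -> m <= Re (e * h alpha w)%C) -> m <= Re (e * div_id f z)%C.
Proof.
  intros Hm. unfold div_id. destruct (Ceq_dec z (RtoC 0)) as [E0|Hn].
  { specialize (Hm (RtoC 0) ltac:(rewrite Cmod_0; lra)). unfold h, div_id in Hm.
    destruct (Ceq_dec (RtoC 0) (RtoC 0)) as [_|n]; [exact Hm | now elim n]. }
  assert (Cf1 : forall s, 0 <= s <= 1 -> continuous (fun s => f1 (z * RtoC s)%C) s).
  { intros s Hs. apply (continuous_comp (fun s => z * RtoC s)%C f1).
    - eapply rder_continuous, rder_scaled.
    - apply holo_continuous; [exact holo_f1 | now apply in_disc]. }
  replace (f z / z)%C with (CInt (fun s => f1 (z * RtoC s)%C) 0 1).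
  - apply (hull_functional_bound rho Hrho p m e).
    + intros w Hw. unfold p. rewrite <- h_integral by now apply Re_one_minus. now apply Hm.
    + exact Cf1.
    + apply (cc_ext _ _ _ (hull_cc rho p)) with (2 := hull_exp_primitive rho Hrho N p
        ltac:(unfold p; lra) (fun s Hs => N_cont s (in_disc s Hs)) N_approx).
      intros s Hs. symmetry. now apply f1_exp.
  - assert (E : CInt (fun s => z * f1 (z * RtoC s))%C 0 1 = f z).
    { rewrite (CInt_rder (fun s => f (z * RtoC s)%C)).
      - replace (z * RtoC 0)%C with (RtoC 0) by ring. replace (z * RtoC 1)%C with z by ring.
        destruct Hf as (_ & -> & _). ring.
      - intros s Hs. rewrite Rmin_left, Rmax_right in Hs by lra.
        eapply der_eq; [apply (rder_comp f (fun s => z * RtoC s)%C);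
          [apply holo_cder; [exact holo_f | now apply in_disc] | apply rder_scaled]|].
        fold f1. ring.
      - intros s Hs. rewrite Rmin_left, Rmax_right in Hs by lra.
        apply continuous_Cmult; [apply continuous_const | now apply Cf1]. }
    rewrite <- E, CInt_scal by (apply (ex_CInt_sub _ 1 Cf1); lra).
    field. exact Hn.
Qed.

End ConvexOfOrder.

(** * The boundary curve of h_alpha *)

(** Half-angle form of the argument: a single formula, continuous off the closed negative real axis,
    where the denominator vanishes. *)
Definition arg (w : C) : R := 2 * atan (Im w / (Cmod w + Re w)).

Lemma Cmod_plus_Re_pos (w : C) : 0 < Im w \/ 0 < Re w -> 0 < Cmod w + Re w.
Proof.
  intros [H|H].
  - assert (Hs : Cmod w ^ 2 = Re w ^ 2 + Im w ^ 2) by apply Cmod2_alt.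
    assert (H0 := Cmod_ge_0 w). nra.
  - generalize (Cmod_ge_0 w). lra.
Qed.

Lemma cis_arg (w : C) : 0 < Cmod w + Re w -> w = (RtoC (Cmod w) * cis (arg w))%C.
Proof.
  intros H. assert (H0 := Cmod_ge_0 w).
  assert (Hs : Cmod w ^ 2 = Re w ^ 2 + Im w ^ 2) by apply Cmod2_alt.
  set (r := Cmod w) in *. set (x := Re w) in *. set (v := Im w) in *.
  set (t := v / (r + x)).
  assert (Hr : 0 < r). { destruct (Req_dec r 0) as [E|]; [|lra]. rewrite E in *. nra. }
  assert (Ht : v = t * (r + x)) by (unfold t; field; lra).
  assert (Hq : 0 < 1 + t²) by (generalize (Rle_0_sqr t); lra).
  assert (Hsq : sqrt (1 + t²) * sqrt (1 + t²) = 1 + t²) by (apply sqrt_sqrt; lra).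
  assert (Hsp : 0 < sqrt (1 + t²)) by now apply sqrt_lt_R0.
  assert (Hx : r - x = t ^ 2 * (r + x)).
  { assert ((r - x) * (r + x) = t ^ 2 * (r + x) * (r + x)) by nra.
    apply Rmult_eq_reg_r with (r + x); lra. }
  unfold arg. fold r x v t. replace (2 * atan t) with (atan t + atan t) by ring.
  rewrite cis_plus. unfold cis. rewrite cos_atan, sin_atan.
  assert (Hi : / sqrt (1 + t²) * / sqrt (1 + t²) = / (1 + t²)).
  { rewrite <- Rinv_mult, Hsq. reflexivity. }
  assert (Ex : x = r * ((1 - t ^ 2) * / (1 + t²))).
  { unfold Rsqr in *. apply Rmult_eq_reg_r with (1 + t * t); [|lra].
    replace (r * ((1 - t ^ 2) * / (1 + t * t)) * (1 + t * t)) with (r * (1 - t ^ 2)) by (field; lra). nra. }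
  assert (Ev : v = r * (2 * t * / (1 + t²))).
  { unfold Rsqr in *. apply Rmult_eq_reg_r with (1 + t * t); [|lra].
    replace (r * (2 * t * / (1 + t * t)) * (1 + t * t)) with (2 * t * r) by (field; lra). rewrite Ht at 1.
    replace (2 * t * r) with (t * (2 * r)) by ring. rewrite Rmult_assoc. f_equal. nra. }
  rewrite <- Hi in Ex, Ev. unfold Rdiv.
  apply C_ext; simpl; [fold x; rewrite Ex at 1 | fold v; rewrite Ev at 1]; ring.
Qed.

Lemma arg_pos (w : C) : 0 < Im w -> 0 < arg w.
Proof.
  intros H. assert (Hp := Cmod_plus_Re_pos w (or_introl H)).
  unfold arg. assert (0 < atan (Im w / (Cmod w + Re w))); [|lra].
  rewrite <- atan_0. apply atan_increasing. now apply Rdiv_lt_0_compat.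
Qed.

Lemma arg_positive_real (w : C) : Im w = 0 -> arg w = 0.
Proof. intros H. unfold arg. rewrite H. unfold Rdiv. rewrite Rmult_0_l, atan_0. ring. Qed.

Lemma continuous_arg {T : UniformSpace} (f : T -> C) (x : T) :
  continuous f x -> 0 < Cmod (f x) + Re (f x) -> continuous (fun y => arg (f y)) x.
Proof.
  intros Hf Hp. unfold arg.
  apply (continuous_mult (K := R_AbsRing) (fun _ => 2)); [apply continuous_const|].
  apply (continuous_comp (fun y => Im (f y) / (Cmod (f y) + Re (f y))) atan).
  - apply (continuous_mult (K := R_AbsRing) (fun y => Im (f y)) (fun y => / (Cmod (f y) + Re (f y)))).
    + now apply continuous_Im.
    + apply (continuous_comp (fun y => Cmod (f y) + Re (f y)) Rinv); [|apply continuous_Rinv; lra].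
      apply (continuous_plus (V := R_NormedModule));
        [now apply continuous_Cmod_comp | now apply continuous_Re].
  - apply (ex_derive_continuous (K := R_AbsRing) (V := R_NormedModule)).
    eexists. apply is_derive_atan.
Qed.

Lemma Im_Clog_polar (r psi : R) : 0 < r -> - (PI / 2) < psi < PI / 2 ->
  Im (Clog (RtoC r * cis psi)%C) = psi.
Proof.
  intros Hr Hpsi.
  assert (Hc : 0 < cos psi) by (apply cos_gt_0; lra).
  assert (Er : Re (RtoC r * cis psi)%C = r * cos psi) by (rewrite re_scal_l; reflexivity).
  assert (Ei : Im (RtoC r * cis psi)%C = r * sin psi) by (rewrite im_scal_l; reflexivity).
  rewrite Clog_right by (rewrite Er; apply Rmult_lt_0_compat; assumption).
  change (atan (Im (RtoC r * cis psi)%C / Re (RtoC r * cis psi)%C) = psi). rewrite Er, Ei.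
  replace (r * sin psi / (r * cos psi)) with (tan psi) by (unfold tan; field; lra).
  apply atan_tan. lra.
Qed.

Lemma one_minus_cis (theta : R) :
  (1 - cis theta = RtoC (2 * sin (theta / 2)) * cis ((theta - PI) / 2))%C.
Proof.
  set (u := theta / 2). replace theta with (2 * u) by (unfold u; field).
  replace ((2 * u - PI) / 2) with (u - PI / 2) by field.
  unfold cis. rewrite cos_minus, sin_minus, cos_PI2, sin_PI2, cos_2a_sin, sin_2a.
  apply C_ext; simpl; ring.
Qed.

Lemma Re_one_minus_cis (theta : R) : 0 < theta < 2 * PI -> 0 < Re (1 - cis theta)%C.
Proof.
  intros H. rewrite one_minus_cis, re_scal_l. simpl.
  assert (0 < sin (theta / 2)) by (apply sin_gt_0; lra).
  assert (0 < cos ((theta - PI) / 2)) by (apply cos_gt_0; lra).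
  apply Rmult_lt_0_compat; lra.
Qed.

Lemma Im_Clog_one_minus_cis (theta : R) : 0 < theta < 2 * PI ->
  Im (Clog (1 - cis theta)%C) = (theta - PI) / 2.
Proof.
  intros H. rewrite one_minus_cis. apply Im_Clog_polar; [|lra].
  assert (0 < sin (theta / 2)) by (apply sin_gt_0; lra). lra.
Qed.

Lemma pw_cis (c theta : R) : 0 < theta < 2 * PI ->
  pw c (cis theta) = (RtoC (Cmod (pw c (cis theta))) * cis (c * ((PI - theta) / 2)))%C.
Proof.
  intros H. rewrite Cmod_pw. unfold pw, Cexp.
  rewrite re_scal_l, im_scal_l, Re_Clog, Im_Clog_one_minus_cis by exact H.
  f_equal. f_equal. field.
Qed.

(** The argument of 1 - w lies in (-PI/2, 0), so multiplied by -c with c <= 2 it stays in (0,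
    PI). *)
Lemma Im_pw_pos (c : R) (w : C) : 0 < c <= 2 -> 0 < Re (1 - w)%C -> 0 < Im w -> 0 < Im (pw c w).
Proof.
  intros Hc Hre Hi. unfold pw, Cexp. rewrite im_scal_l, im_scal_l.
  set (psi := Im (Clog (1 - w)%C)). change (Im (cis (- c * psi))) with (sin (- c * psi)).
  apply Rmult_lt_0_compat; [apply exp_pos|].
  assert (B := Im_Clog_bound _ Hre).
  assert (Ng : Im (Clog (1 - w)%C) < 0).
  { apply Im_Clog_neg; [exact Hre|]. unfold Cminus. rewrite im_plus, im_opp, im_RtoC. lra. }
  fold psi in B, Ng. replace (- c * psi) with (c * - psi) by ring.
  apply sin_gt_0; [apply Rmult_lt_0_compat; lra|].
  apply Rle_lt_trans with (2 * - psi); [apply Rmult_le_compat_r; lra | lra].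
Qed.

Lemma CInt_Im_pos (F : R -> C) :
  (forall s, 0 <= s <= 1 -> continuous F s) -> (forall s, 0 < s < 1 -> 0 < Im (F s)) ->
  0 < Im (CInt F 0 1).
Proof.
  intros HF Hp. rewrite CInt_Im by (apply (ex_CInt_sub F 1 HF); lra).
  apply RInt_gt_0; [lra | exact Hp |]. intros s Hs. now apply continuous_Im, HF.
Qed.

Lemma Im_h_pos (alpha : R) (z : C) : 0 <= alpha < 1 -> 0 < Re (1 - z)%C -> 0 < Im z ->
  0 < Im (h alpha z).
Proof.
  intros Ha Hre Hi. rewrite h_integral by exact Hre. apply CInt_Im_pos.
  - intros s Hs. now apply continuous_pw_scaled.
  - intros s Hs. apply Im_pw_pos; [lra | apply Re_one_minus_scaled; [lra | exact Hre] |].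
    rewrite im_scal_r. nra.
Qed.

Lemma cder_h (alpha : R) (z : C) : z <> RtoC 0 -> 0 < Re (1 - z)%C ->
  cder (h alpha) z ((pw (2 - 2 * alpha) z - h alpha z) / z)%C.
Proof.
  intros Hz Hre. apply der_ext_loc with (fun z => k alpha z / z)%C.
  - generalize (continuous_C_neq_0 (fun z => z) z (continuous_C_id z) Hz). apply filter_imp.
    intros y Hy. unfold h, div_id. destruct (Ceq_dec y (RtoC 0)); [contradiction | reflexivity].
  - eapply der_eq.
    + apply der_div; [apply continuous_C_id | exact Hz | apply cder_k, Hre | apply der_var].
    + unfold h, div_id. destruct (Ceq_dec z (RtoC 0)); [contradiction|]. field. exact Hz.
Qed.

Definition Yint (alpha : R) (z : C) : C :=
  CInt (fun u => RtoC (1 - u) * pw (2 * alpha) (z * RtoC u))%C 0 1.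

Lemma continuous_Yint_integrand (alpha : R) (z : C) (u : R) : 0 <= u <= 1 -> 0 < Re (1 - z)%C ->
  continuous (fun u => RtoC (1 - u) * pw (2 * alpha) (z * RtoC u))%C u.
Proof.
  intros Hu Hre. apply continuous_Cmult; [|now apply continuous_pw_scaled].
  apply (continuous_C_ext (fun u => 1 - RtoC u)%C); [intros; now rewrite RtoC_minus|].
  apply continuous_Cminus; [apply continuous_const | apply continuous_RtoC_id].
Qed.

(* This is Euler's transformation of the hypergeometric function
   [z h' = (p/2) z F(p+1, 2; 3; z)] with [p = 2 - 2 alpha]. *)
Lemma h_derivative_factor (alpha : R) (z : C) : 0 < alpha < 1 -> z <> RtoC 0 -> 0 < Re (1 - z)%C ->
  (pw (2 - 2 * alpha) z - h alpha z = RtoC (2 - 2 * alpha) * z * pw (2 - 2 * alpha) z * Yint alpha z)%C.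
Proof.
  intros Ha Hz Hre.
  assert (H1z := one_minus_neq_0 z Hre).
  assert (Hsc : forall u, 0 <= u <= 1 -> 0 < Re (1 - z * RtoC u)%C)
    by (intros; now apply Re_one_minus_scaled).
  assert (Dpw : forall c u, 0 <= u <= 1 ->
    rder (fun u => pw c (z * RtoC u)%C) u (RtoC c * pw (c + 1) (z * RtoC u) * z)%C).
  { intros c u Hu. apply (rder_comp (pw c) (fun u => z * RtoC u)%C); [apply cder_pw; auto | apply rder_scaled]. }
  assert (Hh : h alpha z = (k alpha z / z)%C).
  { unfold h, div_id. destruct (Ceq_dec z (RtoC 0)); [contradiction | reflexivity]. }
  rewrite Hh. unfold k, Yint. destruct (Req_EM_T alpha (1 / 2)) as [->|Hn].
  - replace (2 - 2 * (1 / 2)) with 1 by field. replace (2 * (1 / 2)) with 1 by field.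
    (* The antiderivatives here and below come from z (1 - u) = (1 - z u) - (1 - z), which splits
       the integrand into two powers; at alpha = 1/2 one of them integrates to a logarithm. *)
    rewrite (CInt_rder (fun u => (RtoC u + (1 - z) / z * Clog (1 - z * RtoC u)) / z)%C).
    + rewrite pw_1 by exact Hre.
      replace (1 - z * RtoC 0)%C with (RtoC 1) by ring. rewrite Clog_1.
      replace (1 - z * RtoC 1)%C with (1 - z)%C by ring. field. split; assumption.
    + intros u Hu. rewrite Rmin_left, Rmax_right in Hu by lra.
      assert (Hu1 := one_minus_neq_0 _ (Hsc u Hu)).
      eapply der_eq.
      * apply der_div; [apply continuous_RtoC_id | exact Hz | | apply der_const].
        apply der_plus; [apply der_var|]. apply der_scal.
        apply (rder_comp (fun z => Clog (1 - z))%C (fun u => z * RtoC u)%C);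
          [apply cder_Clog_one_minus, Hsc, Hu | apply rder_scaled].
      * rewrite pw_1 by (apply Hsc, Hu). rewrite RtoC_minus. field. split; assumption.
    + intros u Hu. rewrite Rmin_left, Rmax_right in Hu by lra.
      generalize (continuous_Yint_integrand (1 / 2) z u Hu Hre).
      replace (2 * (1 / 2)) with 1 by field. trivial.
  - set (p := 2 - 2 * alpha). set (beta := 1 - 2 * alpha).
    assert (Hp : RtoC p <> RtoC 0) by (intros E; apply RtoC_inj in E; unfold p in E; lra).
    assert (Hb : RtoC beta <> RtoC 0) by (intros E; apply RtoC_inj in E; unfold beta in E; lra).
    assert (Ep : RtoC p = (RtoC beta + 1)%C) by (rewrite <- RtoC_plus; f_equal; unfold p, beta; ring).
    assert (EP : pw beta z = (pw p z * (1 - z))%C).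
    { replace p with (beta + 1) by (unfold p, beta; ring). rewrite pw_S by exact Hre. field. exact H1z. }
    rewrite (CInt_rder (fun u => (- (pw (- p) (z * RtoC u) / RtoC p)
      + (1 - z) * pw (- beta) (z * RtoC u) / RtoC beta) / (z * z))%C).
    + replace (z * RtoC 0)%C with (RtoC 0) by ring. replace (z * RtoC 1)%C with z by ring.
      rewrite !pw_at_0, !pw_opp, EP.
      replace (Cpowr (1 - z) (2 * alpha - 1)) with (pw beta z).
      2:{ unfold Cpowr, pw. do 3 f_equal. unfold beta. ring. }
      rewrite EP. assert (HP := pw_neq_0 p z). fold beta. rewrite RtoC_inv by (unfold beta; lra).
      rewrite Ep in Hp |- *. field. repeat split; assumption.
    + intros u Hu. rewrite Rmin_left, Rmax_right in Hu by lra.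
      assert (Hu1 := one_minus_neq_0 _ (Hsc u Hu)).
      eapply der_eq.
      * apply der_div; [apply continuous_RtoC_id | apply Cmult_neq_0; exact Hz | | apply der_const].
        apply der_plus.
        -- apply der_opp, der_div; [apply continuous_RtoC_id | exact Hp | apply Dpw, Hu | apply der_const].
        -- apply der_div; [apply continuous_RtoC_id | exact Hb | apply der_scal, Dpw, Hu | apply der_const].
      * replace (- p + 1) with (- beta) by (unfold p, beta; ring).
        replace (2 * alpha) with (- beta + 1) by (unfold beta; ring).
        rewrite pw_S by (apply Hsc, Hu). rewrite !RtoC_opp, RtoC_minus.
        field. repeat split; assumption.
    + intros u Hu. rewrite Rmin_left, Rmax_right in Hu by lra. now apply continuous_Yint_integrand.
Qed.

(** * The turning of the boundary curve *)

Section Boundary.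
Variable alpha : R.
Hypothesis Halpha : 0 < alpha < 1.
Let p := 2 - 2 * alpha.

(** By [cder_h] this is z h'(z) at z = e^(i theta); its argument is the function phi. *)
Definition Mcurve (theta : R) : C := (pw (2 - 2 * alpha) (cis theta) - h alpha (cis theta))%C.
Definition Ycurve (theta : R) : C := Yint alpha (cis theta).
Let X (theta : R) : C := ((1 - cis theta) * Ycurve theta)%C.

Let p_neq : RtoC p <> RtoC 0.
Proof. intros E. apply RtoC_inj in E. unfold p in E. lra. Qed.

Lemma Mcurve_factor (theta : R) : 0 < theta < 2 * PI ->
  Mcurve theta = (RtoC (2 - 2 * alpha) * cis theta * pw (2 - 2 * alpha) (cis theta) * Ycurve theta)%C.
Proof.
  intros H. unfold Mcurve, Ycurve.
  exact (h_derivative_factor alpha (cis theta) Halpha (cis_neq_0 theta) (Re_one_minus_cis theta H)).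
Qed.

Lemma rder_h_cis (theta : R) : 0 < theta < 2 * PI ->
  rder (fun t => h alpha (cis t)) theta (Ci * Mcurve theta)%C.
Proof.
  intros H. eapply der_eq.
  - apply (rder_comp (h alpha) cis); [apply cder_h; [apply cis_neq_0 | now apply Re_one_minus_cis]|].
    apply rder_cis.
  - unfold Mcurve. field. apply cis_neq_0.
Qed.

Lemma rder_Mcurve (theta : R) : 0 < theta < 2 * PI ->
  rder Mcurve theta
    (Ci * (RtoC (2 - 2 * alpha) * cis theta * pw (2 - 2 * alpha + 1) (cis theta) - Mcurve theta))%C.
Proof.
  intros H. eapply der_eq.
  - apply der_minus; [|now apply rder_h_cis].
    apply (rder_comp (pw (2 - 2 * alpha)) cis); [apply cder_pw; now apply Re_one_minus_cis | apply rder_cis].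
  - ring.
Qed.

Lemma Im_Ycurve_pos (theta : R) : 0 < theta < PI -> 0 < Im (Ycurve theta).
Proof.
  intros H. assert (Hre := Re_one_minus_cis theta ltac:(lra)).
  assert (Hs : 0 < sin theta) by (apply sin_gt_0; lra).
  apply CInt_Im_pos.
  - intros u Hu. now apply continuous_Yint_integrand.
  - intros u Hu. rewrite im_scal_l. apply Rmult_lt_0_compat; [lra|].
    apply Im_pw_pos; [lra | apply Re_one_minus_scaled; [lra | exact Hre] |].
    rewrite im_scal_r. simpl. nra.
Qed.

Lemma pw_negative_real (c u : R) : 0 <= u -> pw c (RtoC (- u)) = RtoC (exp (- c * ln (1 + u))).
Proof.
  intros Hu. unfold pw. replace (1 - RtoC (- u))%C with (RtoC (1 + u))
    by (apply C_ext; simpl; ring).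
  rewrite Clog_right by (simpl; lra). simpl.
  replace (0 / (1 + u)) with 0 by (field; lra). rewrite atan_0.
  replace ((1 + u) * ((1 + u) * 1) + 0 * (0 * 1)) with ((1 + u) * (1 + u)) by ring.
  rewrite ln_mult by lra.
  unfold Cexp. simpl. replace (- c * 0 + 0 * (/ 2 * (ln (1 + u) + ln (1 + u)))) with 0 by ring.
  rewrite cis_0. rewrite Cmult_1_r. f_equal. f_equal. field.
Qed.

(** The bound 1/2 is the integral of 1 - u. As X(PI) = 2 y, it gives W(PI) = 2 y (1 - 2 y) > 0, the
    starting value for the propagation along the circle. *)
Lemma Ycurve_PI : exists y, Ycurve PI = RtoC y /\ 0 < y < / 2.
Proof.
  set (F := fun u => (1 - u) * exp (- (2 * alpha) * ln (1 + u))).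
  assert (CF : forall u, 0 <= u <= 1 -> continuous F u).
  { intros u Hu. eapply is_derive_continuous_R. unfold F. auto_derive; [lra | reflexivity]. }
  exists (RInt F 0 1). split.
  - unfold Ycurve, Yint. rewrite <- CInt_RtoC.
    + apply CInt_ext. intros u Hu. rewrite Rmin_left, Rmax_right in Hu by lra.
      rewrite cis_PI. replace (RtoC (-1) * RtoC u)%C with (RtoC (- u)) by (apply C_ext; simpl; ring).
      rewrite pw_negative_real by lra. now rewrite <- RtoC_mult.
    + apply (ex_RInt_continuous (V := R_CompleteNormedModule)). intros u Hu.
      rewrite Rmin_left, Rmax_right in Hu by lra. now apply CF.
  - split.
    + apply RInt_gt_0; [lra | | exact CF]. intros u Hu. apply Rmult_lt_0_compat; [lra | apply exp_pos].
    + assert (E : RInt (fun u => 1 - u) 0 1 = / 2).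
      { apply is_RInt_unique.
        replace (/ 2) with (minus ((fun u => u - u ^ 2 / 2) 1) ((fun u => u - u ^ 2 / 2) 0))
          by (unfold minus, plus, opp; simpl; field).
        apply (is_RInt_derive (V := R_CompleteNormedModule) (fun u => u - u ^ 2 / 2) (fun u => 1 - u)).
        - intros x _. auto_derive; [exact I | field].
        - intros x _. eapply is_derive_continuous_R. auto_derive; [exact I | reflexivity]. }
      rewrite <- E. apply RInt_lt; [lra | | exact CF |].
      * intros u _. eapply is_derive_continuous_R. auto_derive; [exact I | reflexivity].
      * intros u Hu. unfold F.
        assert (exp (- (2 * alpha) * ln (1 + u)) < 1).
        { apply Rlt_le_trans with (exp 0); [apply exp_increasing | rewrite exp_0; lra].
          assert (Hl : 0 < ln (1 + u)) by (rewrite <- ln_1; apply ln_increasing; lra).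
          assert (0 < 2 * alpha * ln (1 + u)) by (apply Rmult_lt_0_compat; [lra | exact Hl]). lra. }
        nra.
Qed.

Lemma Ycurve_slit (theta : R) : 0 < theta <= PI ->
  0 < Cmod (Ycurve theta) + Re (Ycurve theta) /\ Ycurve theta <> RtoC 0.
Proof.
  intros H. assert (S : 0 < Im (Ycurve theta) \/ 0 < Re (Ycurve theta)).
  { destruct (Req_dec theta PI) as [->|Hn].
    - right. destruct Ycurve_PI as (y & -> & Hy). simpl. lra.
    - left. apply Im_Ycurve_pos. lra. }
  split; [now apply Cmod_plus_Re_pos|].
  intros E. rewrite E in S. simpl in S. lra.
Qed.

Lemma Mcurve_neq_0 (theta : R) : 0 < theta <= PI -> Mcurve theta <> RtoC 0.
Proof.
  intros H. assert (HPI := PI_RGT_0). rewrite Mcurve_factor by lra.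
  apply Cmult_neq_0; [|now apply Ycurve_slit]. apply Cmult_neq_0; [|apply pw_neq_0].
  apply Cmult_neq_0; [exact p_neq | apply cis_neq_0].
Qed.

(** This is z k''(z) on the circle. The curve satisfies M' = i (B - M), so writing M = B X gives
    M'/M = i (1/X - 1). *)
Let B (theta : R) : C := (RtoC p * cis theta * pw (p + 1) (cis theta))%C.

Let B_neq_0 (theta : R) : B theta <> RtoC 0.
Proof.
  apply Cmult_neq_0; [|apply pw_neq_0]. apply Cmult_neq_0; [exact p_neq | apply cis_neq_0].
Qed.

Let M_BX (theta : R) : 0 < theta < 2 * PI -> Mcurve theta = (B theta * X theta)%C.
Proof.
  intros H. rewrite Mcurve_factor by exact H. unfold B, X. fold p.
  assert (Hre := Re_one_minus_cis theta H).
  rewrite pw_S by exact Hre. field. now apply one_minus_neq_0.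
Qed.

Let rder_X (theta : R) : 0 < theta < 2 * PI ->
  rder X theta (Ci - Ci * X theta * (2 + RtoC (p + 1) * (cis theta / (1 - cis theta))))%C.
Proof.
  intros H. assert (Hre := Re_one_minus_cis theta H). assert (Hn := one_minus_neq_0 _ Hre).
  apply der_ext_loc with (fun t => Mcurve t / B t)%C.
  - apply locally_R_Rabs. exists (Rmin theta (2 * PI - theta)).
    split; [apply Rmin_pos; lra|]. intros t Ht. apply Rabs_def2 in Ht.
    assert (A1 := Rmin_l theta (2 * PI - theta)). assert (A2 := Rmin_r theta (2 * PI - theta)).
    rewrite M_BX by lra. field. apply B_neq_0.
  - assert (DB : rder B theta (Ci * B theta * (1 + RtoC (p + 1) * (cis theta / (1 - cis theta))))%C).
    { eapply der_eq.
      - apply der_mult; [apply continuous_RtoC_id | apply der_scal, rder_cis |].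
        apply (rder_comp (pw (p + 1)) cis); [apply cder_pw, Hre | apply rder_cis].
      - unfold B. rewrite (pw_S (p + 1)) by exact Hre. field. exact Hn. }
    eapply der_eq.
    + apply der_div; [apply continuous_RtoC_id | apply B_neq_0 | now apply rder_Mcurve | exact DB].
    + fold p. fold (B theta). rewrite M_BX by exact H. assert (HB := B_neq_0 theta).
      field. split; assumption.
Qed.

Let W (theta : R) : R := Re (X theta) - (Re (X theta) ^ 2 + Im (X theta) ^ 2).
(** Equal to cot (theta/2) / 2, the imaginary part of 1 / (1 - e^(i theta)), whose real part is 1/2
    throughout. *)
Let kappa (theta : R) : R := sin theta / (2 * (1 - cos theta)).

Let inv_one_minus_cis (theta : R) : 0 < theta < 2 * PI ->
  (/ (1 - cis theta))%C = (/ 2, kappa theta).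
Proof.
  intros H. assert (Hre := Re_one_minus_cis theta H). assert (Hn := one_minus_neq_0 _ Hre).
  simpl in Hre. set (c0 := (/ 2, kappa theta)).
  assert (E : Cmult c0 (1 - cis theta)%C = RtoC 1).
  2:{ transitivity (Cmult (Cmult c0 (1 - cis theta)%C) (/ (1 - cis theta))%C).
      - rewrite E. ring.
      - field. exact Hn. }
  unfold c0.
  assert (Hs := sin2_cos2 theta). unfold Rsqr in Hs. unfold kappa.
    apply C_ext; simpl.
    + replace (/ 2 * (1 + - cos theta) - sin theta / (2 * (1 - cos theta)) * (0 + - sin theta))
        with ((/ 2 * ((1 - cos theta) * (1 - cos theta)) + / 2 * (sin theta * sin theta)) / (1 - cos theta))
        by (field; lra).
      replace (sin theta * sin theta) with (1 - cos theta * cos theta) by lra. field. lra.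
    + field. lra.
Qed.

(* [d/dtheta (W (1 - cos theta)^(-p-1)) = - (p+1) Im Y (1 - cos theta)^(-p-1)] *)
Let is_derive_W (theta : R) : 0 < theta < 2 * PI ->
  is_derive (fun t => W t * exp (- (p + 1) * ln (1 - cos t))) theta
    (- (p + 1) * Im (Ycurve theta) * exp (- (p + 1) * ln (1 - cos theta))).
Proof.
  intros H. assert (Hre := Re_one_minus_cis theta H). assert (Hn := one_minus_neq_0 _ Hre).
  simpl in Hre.
  assert (DX := rder_X theta H).
  assert (EV : (cis theta / (1 - cis theta))%C = (- / 2, kappa theta)).
  { replace (cis theta / (1 - cis theta))%C with (/ (1 - cis theta) - 1)%C by (field; exact Hn).
    rewrite inv_one_minus_cis by exact H. apply C_ext; simpl; field. }
  rewrite EV in DX.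
  assert (D1 := rder_Re _ _ _ DX). assert (D2 := rder_Im _ _ _ DX).
  assert (EY : Im (Ycurve theta) = Im (X theta) / 2 + kappa theta * Re (X theta)).
  { replace (Ycurve theta) with (X theta * / (1 - cis theta))%C by (unfold X; field; exact Hn).
    rewrite inv_one_minus_cis by exact H. rewrite im_mult. simpl. field. }
  set (x' := Re (Ci - Ci * X theta * (2 + RtoC (p + 1) * ((- / 2)%R, kappa theta)))%C) in *.
  set (y' := Im (Ci - Ci * X theta * (2 + RtoC (p + 1) * ((- / 2)%R, kappa theta)))%C) in *.
  set (xx := fun t => Re (X t)) in *. set (yy := fun t => Im (X t)) in *.
  apply (is_derive_ext (fun t => (xx t - (xx t ^ 2 + yy t ^ 2)) * exp (- (p + 1) * ln (1 - cos t)))).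
  { reflexivity. }
  change (Re (X theta)) with (xx theta) in EY. change (Im (X theta)) with (yy theta) in EY.
  assert (Ex : x' = (2 - (p + 1) / 2) * yy theta + (p + 1) * kappa theta * xx theta).
  { unfold x', xx, yy. destruct (X theta). simpl. field. }
  assert (Ey : y' = 1 - (2 - (p + 1) / 2) * xx theta + (p + 1) * kappa theta * yy theta).
  { unfold y', xx, yy. destruct (X theta). simpl. field. }
  change (is_derive xx theta x') in D1. change (is_derive yy theta y') in D2.
  clearbody xx yy x' y'. rewrite EY.
  assert (D1' : Derive (fun t => xx t) theta = x') by exact (is_derive_unique _ _ _ D1).
  assert (D2' : Derive (fun t => yy t) theta = y') by exact (is_derive_unique _ _ _ D2).
  auto_derive.
  - repeat split; try (eexists; eassumption). lra.
  - rewrite D1', D2', Ex, Ey. unfold Rminus.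
    replace (1 + - cos theta) with (1 - cos theta) by ring.
    unfold kappa. field. lra.
Qed.

(** Dividing [W] by (1 - cos theta)^(p+1) leaves a function that does not increase on the upper half
    circle, so its positive value at PI bounds it from below. *)
Let W_pos (theta : R) : 0 < theta <= PI -> 0 < W theta.
Proof.
  intros H. assert (HPI := PI_RGT_0).
  set (G := fun t => W t * exp (- (p + 1) * ln (1 - cos t))).
  assert (GPI : 0 < G PI).
  { apply Rmult_lt_0_compat; [|apply exp_pos]. unfold W, X.
    destruct Ycurve_PI as (y & -> & Hy). rewrite cis_PI.
    replace ((1 - RtoC (-1)) * RtoC y)%C with (RtoC (2 * y)) by (apply C_ext; simpl; ring).
    simpl. nra. }
  assert (HG : G PI <= G theta).
  { destruct (Req_dec theta PI) as [->|Hne]; [lra|].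
    destruct (MVT_gen G theta PI (fun t => - (p + 1) * Im (Ycurve t) * exp (- (p + 1) * ln (1 - cos t))))
      as (c & Hc & E).
    - intros t Ht. rewrite Rmin_left, Rmax_right in Ht by lra. apply is_derive_W. lra.
    - intros t Ht. rewrite Rmin_left, Rmax_right in Ht by lra.
      apply continuity_pt_filterlim. eapply is_derive_continuous_R, is_derive_W. lra.
    - rewrite Rmin_left, Rmax_right in Hc by lra.
      assert (HY : 0 <= Im (Ycurve c)).
      { destruct (Req_dec c PI) as [->|Hcp].
        - destruct Ycurve_PI as (y & -> & _). simpl. lra.
        - left. apply Im_Ycurve_pos. lra. }
      assert (HE := exp_pos (- (p + 1) * ln (1 - cos c))).
      assert (0 <= (p + 1) * Im (Ycurve c) * exp (- (p + 1) * ln (1 - cos c)) * (PI - theta)).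
      { repeat apply Rmult_le_pos; first [lra | unfold p; lra]. }
      lra. }
  assert (HW : 0 < G theta) by lra. unfold G in HW.
  assert (HE := exp_pos (- (p + 1) * ln (1 - cos theta))).
  apply Rnot_le_lt. intros Hle. nra.
Qed.

(** This imaginary part is that of M'/M, the derivative of the argument, and equals W / |X|^2. *)
Lemma Mcurve_turning (theta : R) : 0 < theta <= PI ->
  0 < Im (Ci * (RtoC (2 - 2 * alpha) * cis theta * pw (2 - 2 * alpha + 1) (cis theta) - Mcurve theta)
    / Mcurve theta)%C.
Proof.
  intros H. assert (HPI := PI_RGT_0). assert (HM := Mcurve_neq_0 theta H).
  fold p. fold (B theta). rewrite M_BX in HM |- * by lra.
  assert (HB := B_neq_0 theta).
  assert (HX : X theta <> RtoC 0) by (intros E; apply HM; rewrite E; ring).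
  replace (Ci * (B theta - B theta * X theta) / (B theta * X theta))%C
    with (Ci * (/ X theta - 1))%C by (field; split; assumption).
  assert (HW := W_pos theta H). unfold W in HW.
  assert (Hp : 0 < Re (X theta) ^ 2 + Im (X theta) ^ 2).
  { rewrite <- Cmod2_alt. apply pow_lt. now apply Cmod_gt_0. }
  assert (E : Im (Ci * (/ X theta - 1))%C
    = (Re (X theta) - (Re (X theta) ^ 2 + Im (X theta) ^ 2)) / (Re (X theta) ^ 2 + Im (X theta) ^ 2)).
  { destruct (X theta) as [x y]. simpl in Hp |- *. field. lra. }
  rewrite E. now apply Rdiv_lt_0_compat.
Qed.

End Boundary.

(** * Growth near 1, continuous arguments and monotone homeomorphisms *)

Lemma rpower_small (q eps : R) : 0 < q -> 0 < eps ->
  exists d, 0 < d /\ forall D, 0 < D < d -> exp (q * ln D) < eps.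
Proof.
  intros Hq He. exists (exp (ln eps / q)). split; [apply exp_pos|]. intros D HD.
  apply Rlt_le_trans with (exp (ln eps)); [apply exp_increasing | rewrite exp_ln; lra].
  assert (H : ln D < ln eps / q).
  { rewrite <- (ln_exp (ln eps / q)). apply ln_increasing; lra. }
  apply Rmult_lt_compat_l with (r := q) in H; [|exact Hq].
  replace (q * (ln eps / q)) with (ln eps) in H by (field; lra). exact H.
Qed.

Lemma rpower_large (q B : R) : 0 < q ->
  exists d, 0 < d /\ forall D, 0 < D < d -> B < exp (- q * ln D).
Proof.
  intros Hq. destruct (rpower_small q (/ (Rabs B + 1)) Hq) as (d & Hd & H).
  { apply Rinv_0_lt_compat. generalize (Rabs_pos B). lra. }
  exists d. split; [exact Hd|]. intros D HD. specialize (H D HD).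
  replace (- q * ln D) with (- (q * ln D)) by ring. rewrite exp_Ropp.
  apply Rle_lt_trans with (Rabs B); [apply Rle_abs|].
  apply Rlt_le_trans with (Rabs B + 1); [lra|].
  rewrite <- (Rinv_inv (Rabs B + 1)). apply Rinv_le_contravar; [apply exp_pos | lra].
Qed.

(** The exponent [g] is max (1 - 2 alpha, 0), and 1/2 in the logarithmic case. Two gaps are used: g
    < 2 - 2 alpha makes k negligible against k' near 1, and g < 1 makes h - k tend to 0. *)
Lemma k_growth (alpha : R) : 0 < alpha < 1 -> exists K g, 0 < K /\ 0 <= g < 1 /\ g < 2 - 2 * alpha /\
  forall z, 0 < Re (1 - z)%C -> Cmod (1 - z)%C <= 1 ->
    Cmod (k alpha z) <= K * exp (- g * ln (Cmod (1 - z)%C)).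
Proof.
  intros Ha. unfold k. destruct (Req_EM_T alpha (1 / 2)) as [->|Hn].
  - exists 4, (/ 2). repeat split; try lra. intros z Hz HD.
    set (D := Cmod (1 - z)%C) in *. assert (HD0 : 0 < D) by now apply Re_le_Cmod_pos.
    rewrite Cmod_opp. eapply Rle_trans; [apply Cmod_le_Re_Im|].
    rewrite Re_Clog. fold D.
    assert (HI : Rabs (Im (Clog (1 - z)%C)) <= 2).
    { apply Rabs_le. generalize (Im_Clog_bound _ Hz) PI_4. lra. }
    assert (Hl : ln D <= 0) by (rewrite <- ln_1; apply Rcomplements.ln_le; lra).
    rewrite (Rabs_left1 (ln D)) by exact Hl.
    assert (E := exp_ineq1_le (- / 2 * ln D)). lra.
  - set (b := 1 - 2 * alpha). assert (Hb : b <> 0) by (unfold b; lra).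
    exists (2 * / Rabs b), (Rmax b 0).
    assert (Hab : 0 < / Rabs b) by (apply Rinv_0_lt_compat, Rabs_pos_lt, Hb).
    split; [lra|]. split; [split; [apply Rmax_r | apply Rmax_lub_lt; unfold b; lra]|].
    split; [apply Rmax_lub_lt; unfold b; lra|].
    intros z Hz HD. set (D := Cmod (1 - z)%C) in *.
    assert (HD0 : 0 < D) by now apply Re_le_Cmod_pos.
    assert (Hl : ln D <= 0) by (rewrite <- ln_1; apply Rcomplements.ln_le; lra).
    replace (Cpowr (1 - z) (2 * alpha - 1)) with (pw b z).
    2:{ unfold Cpowr, pw. do 3 f_equal. unfold b. ring. }
    rewrite Cmod_mult, Cmod_R, Rabs_inv.
    assert (E : exp (- b * ln D) <= exp (- Rmax b 0 * ln D)).
    { apply exp_le. generalize (Rmax_l b 0). nra. }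
    assert (E1 : 1 <= exp (- Rmax b 0 * ln D)).
    { rewrite <- exp_0 at 1. apply exp_le. generalize (Rmax_r b 0). nra. }
    assert (E2 : Cmod (pw b z - 1)%C <= 2 * exp (- Rmax b 0 * ln D)).
    { eapply Rle_trans; [apply Cmod_triangle_minus|]. rewrite Cmod_1, Cmod_pw. fold D. lra. }
    replace (2 * / Rabs b * exp (- Rmax b 0 * ln D)) with (/ Rabs b * (2 * exp (- Rmax b 0 * ln D))) by ring.
    apply Rmult_le_compat_l; [lra | exact E2].
Qed.

Lemma exp_mult_ln (x q : R) : 0 < x -> x * exp (q * ln x) = exp ((1 + q) * ln x).
Proof. intros Hx. rewrite <- (exp_ln x Hx) at 1. rewrite <- exp_plus. f_equal. ring. Qed.

(** Rotating back by the angle [u x] brings the curve to the positive real axis at [x], where the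
    principal logarithm is differentiable and, by continuity of [u], its imaginary part is u t - u x
    nearby. *)
Lemma is_derive_argument (M : R -> C) (u : R -> R) (x : R) (d : C) :
  rder M x d -> M x <> RtoC 0 -> continuous u x ->
  locally x (fun t => M t = (RtoC (Cmod (M t)) * cis (u t))%C) ->
  is_derive u x (Im (d / M x)%C).
Proof.
  intros HM Hn Hu Hloc.
  assert (Hm : 0 < Cmod (M x)) by now apply Cmod_gt_0.
  assert (Hx := locally_singleton _ _ Hloc). simpl in Hx.
  assert (Hcc : (cis (u x) * cis (- u x) = 1)%C) by (rewrite <- cis_plus, Rplus_opp_r; apply cis_0).
  assert (E0 : (M x * cis (- u x))%C = RtoC (Cmod (M x))).
  { rewrite Hx at 1. rewrite <- Cmult_assoc, Hcc. ring. }
  set (L := fun t => (M t * cis (- u x))%C).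
  assert (DL : rder (fun t => Clog (L t)) x (d / M x)%C).
  { eapply der_eq.
    - apply (rder_comp Clog L); [apply cder_Clog; unfold L; rewrite E0; exact Hm|].
      apply der_mult; [apply continuous_RtoC_id | exact HM | apply der_const].
    - unfold L. field. split; [exact Hn | apply cis_neq_0]. }
  apply rder_Im in DL.
  apply (is_derive_ext_loc (fun t => Im (Clog (L t)) + u x)).
  - assert (HPI := PI_RGT_0).
    assert (Hpi : 0 < PI / 2) by lra.
    assert (Hc : locally x (fun t => Rabs (u t - u x) < PI / 2)).
    { unfold continuous in Hu. rewrite filterlim_locally in Hu. exact (Hu (mkposreal _ Hpi)). }
    assert (Hnz : locally x (fun t => M t <> RtoC 0)).
    { apply (continuous_C_neq_0 M); [eapply rder_continuous, HM | exact Hn]. }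
    generalize (filter_and _ _ Hloc (filter_and _ _ Hc Hnz)). apply filter_imp.
    intros t (Ht & Hd & Hz). apply Rabs_def2 in Hd. unfold L. rewrite Ht.
    rewrite <- Cmult_assoc, <- cis_plus.
    rewrite Im_Clog_polar; [|now apply Cmod_gt_0 | lra].
    change (u t + - u x + u x = u t). ring.
  - replace (Im (d / M x)%C) with (Im (d / M x)%C + 0) by ring.
    apply (is_derive_plus (K := R_AbsRing) (V := R_NormedModule)); [exact DL|].
    apply (is_derive_const (K := R_AbsRing) (V := R_NormedModule)).
Qed.

Lemma cis_eq_1_bound (x : R) : cis x = RtoC 1 -> x = 0 \/ 1 < Rabs x.
Proof.
  intros H. destruct (Req_dec x 0) as [|Hn]; [now left|]. right.
  apply Rnot_le_lt. intros Hle.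
  assert (Hc : cos (Rabs x) = 1).
  { apply (f_equal Re) in H. simpl in H. unfold Rabs. destruct (Rcase_abs x); [now rewrite cos_neg | exact H]. }
  assert (H0 : 0 < Rabs x) by now apply Rabs_pos_lt.
  assert (HPI := PI2_1).
  assert (cos (Rabs x) < cos 0) by (apply cos_decreasing_1; lra).
  rewrite cos_0 in H1. lra.
Qed.

(** The retraction onto [c, d]; composing with it turns continuity on an interval into the global
    continuity that the intermediate value theorem asks for. *)
Definition clamp (c d x : R) : R := Rmax c (Rmin x d).

Lemma clamp_in (c d x : R) : c <= d -> c <= clamp c d x <= d.
Proof. intros H. unfold clamp, Rmax, Rmin. repeat destruct Rle_dec; lra. Qed.

Lemma clamp_id (c d x : R) : c <= x <= d -> clamp c d x = x.
Proof. intros H. unfold clamp, Rmax, Rmin. repeat destruct Rle_dec; lra. Qed.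

Lemma clamp_lip (c d x y : R) : c <= d -> Rabs (clamp c d x - clamp c d y) <= Rabs (x - y).
Proof.
  intros H. unfold clamp, Rmax, Rmin, Rabs. repeat destruct Rle_dec; repeat destruct Rcase_abs; lra.
Qed.

Lemma continuous_on_eps (D : R -> Prop) (f : R -> R) :
  continuous_on (T := R_UniformSpace) (U := R_UniformSpace) D f <->
  forall x, D x -> forall e, 0 < e -> exists d, 0 < d /\
    forall y, D y -> Rabs (y - x) < d -> Rabs (f y - f x) < e.
Proof.
  split.
  - intros H x Hx e He. specialize (H x Hx). rewrite filterlim_locally in H.
    destruct (H (mkposreal e He)) as [d Hd]. exists d. split; [apply cond_pos|].
    intros y Hy Hyx. now apply Hd.
  - intros H x Hx. apply filterlim_locally. intros e.
    destruct (H x Hx e (cond_pos e)) as (d & Hd & Hdd).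
    exists (mkposreal d Hd). intros y Hy HDy. now apply Hdd.
Qed.

Lemma continuous_on_clamp (D : R -> Prop) (f : R -> R) (c d : R) : c <= d ->
  (forall x, c <= x <= d -> D x) ->
  continuous_on (T := R_UniformSpace) (U := R_UniformSpace) D f ->
  continuity (fun x => f (clamp c d x)).
Proof.
  intros Hcd HD Hf x. apply continuity_pt_filterlim, filterlim_locally. intros e.
  assert (Hx := clamp_in c d x Hcd).
  destruct (proj1 (continuous_on_eps D f) Hf _ (HD _ Hx) e (cond_pos e)) as (dl & Hdl & Hd).
  exists (mkposreal dl Hdl). intros y Hy. apply Hd; [now apply HD, clamp_in|].
  eapply Rle_lt_trans; [now apply clamp_lip | exact Hy].
Qed.

(** The values lie in 2 PI Z, where every nonzero element exceeds 1 in modulus; a continuous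
    function leaving 0 would take the value 1/2 or -1/2. *)
Lemma continuous_angle_unique (D : R -> Prop) (f : R -> R) (c d : R) : c <= d ->
  (forall x, c <= x <= d -> D x) ->
  continuous_on (T := R_UniformSpace) (U := R_UniformSpace) D f ->
  (forall x, D x -> cis (f x) = RtoC 1) -> f d = 0 -> f c = 0.
Proof.
  intros Hcd HD Hf Hcis Hd0.
  assert (Hcont := continuous_on_clamp D f c d Hcd HD Hf).
  destruct (cis_eq_1_bound _ (Hcis c (HD c ltac:(lra)))) as [|Hbig]; [assumption|]. exfalso.
  set (y := if Rle_dec 0 (f c) then / 2 else - / 2).
  destruct (IVT_gen _ c d y Hcont) as (x & Hx & E).
  - rewrite !clamp_id by lra. rewrite Hd0. unfold y, Rmin, Rmax, Rabs in *.
    destruct (Rcase_abs (f c)); repeat destruct Rle_dec; lra.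
  - rewrite Rmin_left, Rmax_right in Hx by exact Hcd.
    destruct (cis_eq_1_bound _ (Hcis _ (HD _ (clamp_in c d x Hcd)))) as [H0|H1].
    + rewrite E in H0. unfold y in H0. destruct (Rle_dec 0 (f c)); lra.
    + rewrite E in H1. unfold y, Rabs in H1. destruct (Rle_dec 0 (f c)); destruct Rcase_abs; lra.
Qed.

Lemma increasing_homeomorphism (A b : R) (f : R -> R) : 0 < b ->
  continuous_on (T := R_UniformSpace) (U := R_UniformSpace) (Ioc 0 b) f ->
  (forall x y, 0 < x -> x < y -> y <= b -> f x < f y) ->
  (forall x, 0 < x <= b -> A < f x) ->
  (forall e, 0 < e -> exists x, 0 < x <= b /\ f x < A + e) ->
  maps_homeomorphically (Ioc 0 b) (Ioc A (f b)) f.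
Proof.
  intros Hb Hc Hinc HA Hinf. split; [exact Hc|].
  assert (Hle : forall x y, 0 < x -> x <= y -> y <= b -> f x <= f y).
  { intros x y Hx [Hxy | ->] Hy; [left; now apply Hinc | lra]. }
  assert (Hinv : forall x y, Ioc 0 b x -> Ioc 0 b y -> f x < f y -> x < y).
  { intros x y [Hx1 Hx2] [Hy1 Hy2] H. apply Rnot_le_lt. intros Hyx.
    generalize (Hle y x Hy1 Hyx Hx2). lra. }
  assert (Hinj : forall x y, Ioc 0 b x -> Ioc 0 b y -> f x = f y -> x = y).
  { intros x y Hx Hy E. destruct Hx, Hy.
    destruct (Rtotal_order x y) as [Hlt|[Heq|Hlt]]; [|exact Heq|]; exfalso.
    - generalize (Hinc x y). lra.
    - generalize (Hinc y x). lra. }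
  assert (Hex : forall y, exists x, Ioc A (f b) y -> Ioc 0 b x /\ f x = y).
  { intros y. destruct (classic (Ioc A (f b) y)) as [[Hy1 Hy2]|Hn]; [|exists 0; intros; contradiction].
    destruct (Hinf (y - A)) as (c & Hcb & Hfc); [lra|].
    assert (Hcont := continuous_on_clamp (Ioc 0 b) f c b ltac:(lra) (fun x Hx => conj (Rlt_le_trans _ _ _ (proj1 Hcb) (proj1 Hx)) (proj2 Hx)) Hc).
    destruct (IVT_gen _ c b y Hcont) as (x & Hx & E).
    - rewrite !clamp_id by lra. rewrite Rmin_left, Rmax_right by lra. lra.
    - exists (clamp c b x). intros _. split; [|exact E].
      generalize (clamp_in c b x). unfold Ioc. lra. }
  set (g := fun y => proj1_sig (constructive_indefinite_description _ (Hex y))).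
  assert (Hg : forall y, Ioc A (f b) y -> Ioc 0 b (g y) /\ f (g y) = y).
  { intros y. exact (proj2_sig (constructive_indefinite_description _ (Hex y))). }
  assert (Hf : forall x, Ioc 0 b x -> Ioc A (f b) (f x)).
  { intros x [Hx1 Hx2]. split; [apply HA; lra | apply Hle; lra]. }
  exists g. split; [|split; [|exact Hg]].
  - apply continuous_on_eps. intros y0 Hy0 e He.
    destruct (Hg y0 Hy0) as [Hx0 E0]. set (x0 := g y0) in *. destruct Hx0 as [Hx1 Hx2].
    set (e' := Rmin (e / 2) (x0 / 2)).
    assert (He' : 0 < e') by (apply Rmin_pos; lra).
    assert (He1 : e' <= e / 2) by apply Rmin_l. assert (He2 : e' <= x0 / 2) by apply Rmin_r.
    assert (L1 : f (x0 - e') < y0) by (rewrite <- E0; apply Hinc; lra).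
    (* To the right of [b] the function [f] gives no control, but there the inverse is bounded
       anyway, by [b < x0 + e']. *)
    assert (Hup : exists d, 0 < d /\ forall y, Ioc A (f b) y -> y < y0 + d -> g y < x0 + e).
    { destruct (Rle_dec (x0 + e') b) as [Hle'|Hnle].
      - exists (f (x0 + e') - y0). split.
        + assert (f x0 < f (x0 + e')) by (apply Hinc; lra). lra.
        + intros y Hy Hlt. destruct (Hg y Hy) as [Hgy Ey].
          assert (g y < x0 + e'); [|lra]. apply Hinv; [exact Hgy | split; lra | lra].
      - exists 1. split; [lra|]. intros y Hy _. destruct (Hg y Hy) as [[_ Hgy] _]. lra. }
    destruct Hup as (d & Hd & Hup).
    exists (Rmin d (y0 - f (x0 - e'))). split; [apply Rmin_pos; lra|].
    intros y Hy Hyd. apply Rabs_def2 in Hyd.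
    assert (M1 := Rmin_l d (y0 - f (x0 - e'))). assert (M2 := Rmin_r d (y0 - f (x0 - e'))).
    assert (U := Hup y Hy ltac:(lra)).
    destruct (Hg y Hy) as [Hgy Ey].
    assert (x0 - e' < g y) by (apply Hinv; [split; lra | exact Hgy | lra]).
    apply Rabs_def1; lra.
  - intros x Hx. split; [now apply Hf|]. apply Hinj; [apply Hg, Hf, Hx | exact Hx | apply Hg, Hf, Hx].
Qed.

(** * The homeomorphism phi *)

Section Angle.
Variable alpha : R.
Hypothesis Halpha : 0 < alpha < 1.

Definition phi0 (theta : R) : R := PI * (1 - alpha) + alpha * theta + arg (Ycurve alpha theta).

Lemma Mcurve_phi0 (theta : R) : 0 < theta <= PI ->
  Mcurve alpha theta = (RtoC (Cmod (Mcurve alpha theta)) * cis (phi0 theta))%C.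
Proof.
  intros H. assert (HPI := PI_RGT_0). destruct (Ycurve_slit alpha Halpha theta H) as [Hs _].
  rewrite Mcurve_factor by (trivial; lra).
  rewrite !Cmod_mult, Cmod_R, Cmod_cis, Rabs_pos_eq by lra.
  rewrite (pw_cis (2 - 2 * alpha) theta) at 1 by lra. rewrite (cis_arg _ Hs) at 1.
  unfold phi0. replace (PI * (1 - alpha) + alpha * theta + arg (Ycurve alpha theta))
    with (theta + ((2 - 2 * alpha) * ((PI - theta) / 2) + arg (Ycurve alpha theta))) by field.
  rewrite !cis_plus, !RtoC_mult. ring.
Qed.

Lemma phi0_PI : phi0 PI = PI.
Proof.
  unfold phi0. destruct (Ycurve_PI alpha Halpha) as (y & -> & _).
  rewrite arg_positive_real by reflexivity. ring.
Qed.

(** Continuity is read off from [Mcurve], which is differentiable, divided by its nonvanishing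
    elementary factors, rather than from the integral and its parameter. *)
Lemma continuous_Ycurve (theta : R) : 0 < theta < 2 * PI -> continuous (Ycurve alpha) theta.
Proof.
  intros H.
  assert (Hp : RtoC (2 - 2 * alpha) <> RtoC 0) by (intros E; apply RtoC_inj in E; lra).
  assert (Hne : forall t, (RtoC (2 - 2 * alpha) * cis t * pw (2 - 2 * alpha) (cis t) <> 0)%C).
  { intros t. apply Cmult_neq_0; [|apply pw_neq_0]. apply Cmult_neq_0; [exact Hp | apply cis_neq_0]. }
  apply continuous_ext_loc with (fun t => Mcurve alpha t / (RtoC (2 - 2 * alpha) * cis t * pw (2 - 2 * alpha) (cis t)))%C.
  - apply locally_R_Rabs. exists (Rmin theta (2 * PI - theta)).
    split; [apply Rmin_pos; lra|]. intros t Ht. apply Rabs_def2 in Ht.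
    assert (A1 := Rmin_l theta (2 * PI - theta)). assert (A2 := Rmin_r theta (2 * PI - theta)).
    rewrite Mcurve_factor by (trivial; lra).
    match goal with |- ?x = ?y => change (@eq C x y) end. field.
    repeat split; [apply pw_neq_0 | apply cis_neq_0 | exact Hp].
  - apply continuous_Cmult; [eapply rder_continuous, rder_Mcurve; trivial|].
    apply continuous_Cinv; [apply Hne|].
    apply continuous_Cmult.
    + apply continuous_Cmult; [apply continuous_const | apply continuous_cis].
    + apply (continuous_comp cis (pw (2 - 2 * alpha))); [apply continuous_cis|].
      eapply cder_continuous, cder_pw. now apply Re_one_minus_cis.
Qed.

Lemma continuous_phi0 (theta : R) : 0 < theta <= PI -> continuous phi0 theta.
Proof.
  intros H. assert (HPI := PI_RGT_0). unfold phi0.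
  apply (continuous_plus (V := R_NormedModule) (fun t => PI * (1 - alpha) + alpha * t)
    (fun t => arg (Ycurve alpha t))).
  - eapply is_derive_continuous_R. auto_derive; [exact I | reflexivity].
  - apply continuous_arg; [apply continuous_Ycurve; lra | now apply Ycurve_slit].
Qed.

Lemma phi0_increasing (x y : R) : 0 < x -> x < y -> y <= PI -> phi0 x < phi0 y.
Proof.
  intros Hx Hxy Hy. assert (HPI := PI_RGT_0).
  set (d := fun t => Im (Ci * (RtoC (2 - 2 * alpha) * cis t * pw (2 - 2 * alpha + 1) (cis t)
    - Mcurve alpha t) / Mcurve alpha t)%C).
  destruct (MVT_gen phi0 x y d) as (c & Hc & E).
  - intros t Ht. rewrite Rmin_left, Rmax_right in Ht by lra.
    apply is_derive_argument.
    + apply rder_Mcurve; trivial. lra.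
    + apply Mcurve_neq_0; trivial; lra.
    + apply continuous_phi0. lra.
    + apply locally_R_Rabs. exists (Rmin t (PI - t)).
      split; [apply Rmin_pos; lra|]. intros s Hs. apply Rabs_def2 in Hs.
      assert (A1 := Rmin_l t (PI - t)). assert (A2 := Rmin_r t (PI - t)).
      apply Mcurve_phi0. lra.
  - intros t Ht. rewrite Rmin_left, Rmax_right in Ht by lra.
    apply continuity_pt_filterlim, continuous_phi0. lra.
  - rewrite Rmin_left, Rmax_right in Hc by lra.
    assert (Hd : 0 < d c) by (apply Mcurve_turning; trivial; lra).
    assert (0 < d c * (y - x)) by (apply Rmult_lt_0_compat; lra). lra.
Qed.

Lemma phi0_lower (theta : R) : 0 < theta <= PI -> PI * (1 - alpha) < phi0 theta.
Proof.
  intros H. assert (HPI := PI_RGT_0). unfold phi0.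
  assert (0 < alpha * theta) by (apply Rmult_lt_0_compat; lra).
  assert (0 <= arg (Ycurve alpha theta)); [|lra].
  destruct (Req_dec theta PI) as [->|Hn].
  - destruct (Ycurve_PI alpha Halpha) as (y & -> & _). rewrite arg_positive_real by reflexivity. lra.
  - left. apply arg_pos, Im_Ycurve_pos; trivial; lra.
Qed.

Lemma Cmod_one_minus_cis (theta : R) : 0 <= theta <= 2 * PI ->
  Cmod (1 - cis theta)%C = 2 * sin (theta / 2).
Proof.
  intros H. rewrite one_minus_cis, Cmod_mult, Cmod_cis, Cmod_R.
  assert (0 <= sin (theta / 2)) by (apply sin_ge_0; lra).
  rewrite Rabs_pos_eq; lra.
Qed.

Lemma Cmod_one_minus_cis_le (theta : R) : 0 < theta < 2 * PI -> 0 < Cmod (1 - cis theta)%C <= theta.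
Proof.
  intros H. rewrite Cmod_one_minus_cis by lra.
  assert (0 < sin (theta / 2)) by (apply sin_gt_0; lra).
  assert (sin (theta / 2) < theta / 2) by (apply sin_lt_x; lra). lra.
Qed.

(** By the factorization, p z Y = 1 - h/k', and h is of smaller order than k' at 1. The limit is
    real and positive, so arg Y tends to 0 and phi to PI (1 - alpha), an infimum that is not
    attained. *)
Lemma Ycurve_limit (e : R) : 0 < e -> exists d, 0 < d /\ forall theta, 0 < theta < d ->
  Cmod (Ycurve alpha theta - / RtoC (2 - 2 * alpha))%C < e.
Proof.
  intros He. destruct (k_growth alpha Halpha) as (K & g & HK & Hg & Hgp & Hk).
  set (p := 2 - 2 * alpha) in *. assert (Hp : 0 < p) by (unfold p; lra).
  assert (HpC : RtoC p <> RtoC 0) by (intros E; apply RtoC_inj in E; lra).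
  assert (HPI := PI_RGT_0).
  destruct (rpower_small (p - g) (p * e / (2 * K))) as (d1 & Hd1 & S1); [lra| |].
  { apply Rdiv_lt_0_compat; [apply Rmult_lt_0_compat; lra | lra]. }
  set (d := Rmin (Rmin d1 1) (p * e / 2)).
  assert (Hpe : 0 < p * e) by (apply Rmult_lt_0_compat; lra).
  exists d. split; [repeat apply Rmin_pos; lra|]. intros theta Ht.
  assert (T1 : theta < d1).
  { apply Rlt_le_trans with d; [lra|]. unfold d. eapply Rle_trans; [apply Rmin_l | apply Rmin_l]. }
  assert (T2 : theta < 1).
  { apply Rlt_le_trans with d; [lra|]. unfold d. eapply Rle_trans; [apply Rmin_l | apply Rmin_r]. }
  assert (T3 : theta < p * e / 2) by (apply Rlt_le_trans with d; [lra | apply Rmin_r]).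
  assert (HPI2 := PI2_1).
  assert (Hre := Re_one_minus_cis theta ltac:(lra)).
  destruct (Cmod_one_minus_cis_le theta ltac:(lra)) as [HD0 HD1].
  specialize (Hk (cis theta) Hre ltac:(lra)). set (D := Cmod (1 - cis theta)%C) in *.
  assert (HY : (RtoC p * cis theta * pw p (cis theta) * Ycurve alpha theta
      = pw p (cis theta) - h alpha (cis theta))%C).
  { symmetry. apply (Mcurve_factor alpha Halpha theta). lra. }
  assert (Hh : h alpha (cis theta) = (k alpha (cis theta) / cis theta)%C).
  { unfold h, div_id. destruct (Ceq_dec (cis theta) (RtoC 0)) as [E|]; [elim (cis_neq_0 _ E) | reflexivity]. }
  assert (HP := pw_neq_0 p (cis theta)). assert (Hc := cis_neq_0 theta).
  assert (E : (Ycurve alpha theta - / RtoC p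
    = ((1 - cis theta) - k alpha (cis theta) * / cis theta * / pw p (cis theta)) * / cis theta * / RtoC p)%C).
  { replace (Ycurve alpha theta) with ((RtoC p * cis theta * pw p (cis theta) * Ycurve alpha theta)
      / (RtoC p * cis theta * pw p (cis theta)))%C by (field; repeat split; assumption).
    rewrite HY, Hh. field. repeat split; assumption. }
  rewrite E, !Cmod_mult, !Cmod_inv, Cmod_cis, Cmod_R, Rabs_pos_eq by (trivial; lra).
  rewrite Rinv_1, Rmult_1_r.
  apply Rmult_lt_reg_r with p; [exact Hp|]. rewrite Rmult_assoc, Rinv_l, Rmult_1_r by lra.
  eapply Rle_lt_trans; [apply Cmod_triangle_minus|]. fold D.
  rewrite !Cmod_mult, !Cmod_inv, Cmod_cis, Rinv_1, Rmult_1_r by trivial.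
  assert (HkP : Cmod (k alpha (cis theta)) * / Cmod (pw p (cis theta)) <= K * exp ((p - g) * ln D)).
  { rewrite Cmod_pw. fold D. rewrite <- exp_Ropp.
    apply Rle_trans with (K * exp (- g * ln D) * exp (- (- p * ln D))).
    - apply Rmult_le_compat_r; [left; apply exp_pos | exact Hk].
    - right. rewrite Rmult_assoc, <- exp_plus. do 2 f_equal. ring. }
  assert (HS := S1 D ltac:(lra)).
  assert (K * exp ((p - g) * ln D) < p * e / 2).
  { apply Rmult_lt_compat_l with (r := K) in HS; [|exact HK].
    replace (K * (p * e / (2 * K))) with (p * e / 2) in HS by (field; lra). exact HS. }
  lra.
Qed.

Lemma phi0_limit (e : R) : 0 < e -> exists x, 0 < x <= PI /\ phi0 x < PI * (1 - alpha) + e.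
Proof.
  intros He. assert (HPI := PI_RGT_0).
  assert (Hq : 0 < / (2 - 2 * alpha)) by (apply Rinv_0_lt_compat; lra).
  assert (Hc : continuous arg (/ RtoC (2 - 2 * alpha))%C).
  { apply (continuous_arg (fun w => w)); [apply continuous_C_id|].
    rewrite <- RtoC_inv by lra. rewrite Cmod_R, Rabs_pos_eq by lra. simpl. lra. }
  unfold continuous in Hc. rewrite filterlim_locally in Hc.
  assert (He2 : 0 < e / 2) by lra.
  destruct (proj1 (locally_C_Cmod _ _) (Hc (mkposreal _ He2))) as (r & Hr & Harg).
  destruct (Ycurve_limit r Hr) as (d & Hd & HY).
  set (x := Rmin (Rmin (d / 2) (e / 4)) PI).
  assert (X1 : x <= d / 2) by (unfold x; eapply Rle_trans; [apply Rmin_l | apply Rmin_l]).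
  assert (X2 : x <= e / 4) by (unfold x; eapply Rle_trans; [apply Rmin_l | apply Rmin_r]).
  assert (X3 : x <= PI) by apply Rmin_r.
  assert (X0 : 0 < x) by (unfold x; repeat apply Rmin_pos; lra).
  exists x. split; [lra|].
  specialize (Harg _ (HY x ltac:(lra))).
  change (Rabs (arg (Ycurve alpha x) - arg (/ RtoC (2 - 2 * alpha))%C) < e / 2) in Harg.
  rewrite (arg_positive_real (/ RtoC (2 - 2 * alpha))%C) in Harg.
  2:{ rewrite <- RtoC_inv by lra. reflexivity. }
  apply Rabs_def2 in Harg. unfold phi0.
  assert (alpha * x <= 1 * x) by (apply Rmult_le_compat_r; lra). lra.
Qed.

Lemma C_derive_h_cis (theta : R) : 0 < theta < 2 * PI ->
  C_derive (h alpha) (cis theta) = (Mcurve alpha theta / cis theta)%C.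
Proof.
  intros H. apply cder_C_derive, cder_h; [apply cis_neq_0 | now apply Re_one_minus_cis].
Qed.

Lemma arg_branch_exists : is_arg_branch alpha (fun theta => phi0 theta - theta).
Proof.
  assert (HPI := PI_RGT_0). split; [|split].
  - intros x Hx. apply (filterlim_filter_le_1 (F := locally x)); [apply filter_le_within|].
    apply (continuous_minus (V := R_NormedModule) phi0 (fun t => t) x);
      [now apply continuous_phi0 | apply continuous_id].
  - rewrite phi0_PI. ring.
  - intros theta Ht. unfold Ioc in Ht. rewrite C_derive_h_cis by lra.
    assert (HM := Mcurve_neq_0 alpha Halpha theta Ht). split.
    + intros E. apply HM. replace (Mcurve alpha theta) with (Mcurve alpha theta / cis theta * cis theta)%C
        by (field; apply cis_neq_0). rewrite E. ring.
    + rewrite Cmod_div, Cmod_cis by apply cis_neq_0. rewrite (Mcurve_phi0 theta Ht) at 1.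
      unfold Rminus. rewrite cis_plus, cis_opp. unfold Rdiv. rewrite Rinv_1, Rmult_1_r. unfold Cdiv. ring.
Qed.

(** Two branches differ by a continuous function with values in 2 PI Z that vanishes at PI. Hence
    the explicit [phi0] stands for every branch. *)
Lemma arg_branch_unique (a : R -> R) (theta : R) : is_arg_branch alpha a -> 0 < theta <= PI ->
  phi a theta = phi0 theta.
Proof.
  intros (Hc & Ha & Hb) Ht. assert (HPI := PI_RGT_0).
  assert (E : a theta - (phi0 theta - theta) = 0); [|unfold phi; lra].
  destruct arg_branch_exists as (Hc0 & Ha0 & Hb0).
  apply (continuous_angle_unique (Ioc 0 PI) (fun t => a t - (phi0 t - t)) theta PI).
  - lra.
  - intros x Hx. unfold Ioc. lra.
  - apply continuous_on_eps. intros x Hx e He.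
    assert (He2 : 0 < e / 2) by lra.
    destruct (proj1 (continuous_on_eps _ _) Hc x Hx _ He2) as (d1 & Hd1 & H1).
    destruct (proj1 (continuous_on_eps _ _) Hc0 x Hx _ He2) as (d2 & Hd2 & H2).
    exists (Rmin d1 d2). split; [apply Rmin_pos; assumption|]. intros y Hy Hyx.
    specialize (H1 y Hy (Rlt_le_trans _ _ _ Hyx (Rmin_l _ _))).
    specialize (H2 y Hy (Rlt_le_trans _ _ _ Hyx (Rmin_r _ _))). cbv beta in H2.
    apply Rabs_def2 in H1, H2. apply Rabs_def1; lra.
  - intros x Hx. destruct (Hb x Hx) as [Hn E1]. destruct (Hb0 x Hx) as [_ E2].
    set (m := RtoC (Cmod (C_derive (h alpha) (cis x)))) in *.
    assert (Hm : m <> RtoC 0).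
    { intros E. apply Hn. rewrite E1, E. ring. }
    unfold Rminus at 1. rewrite cis_plus, cis_opp.
    assert (E3 : cis (a x) = cis (phi0 x - x)).
    { rewrite <- (Cmult_1_l (cis (a x))), <- (Cmult_1_l (cis (phi0 x - x))).
      rewrite <- (Cinv_l m Hm), <- !Cmult_assoc. f_equal. now rewrite <- E1. }
    rewrite E3. field. apply cis_neq_0.
  - rewrite Ha, Ha0. ring.
Qed.

Lemma phi_homeomorphism (a : R -> R) : is_arg_branch alpha a ->
  maps_homeomorphically (Ioc 0 PI) (Ioc (PI * (1 - alpha)) PI) (phi a).
Proof.
  intros Ha. assert (HPI := PI_RGT_0).
  assert (E := fun t Ht => arg_branch_unique a t Ha Ht).
  assert (EPI : phi a PI = PI) by (rewrite E by lra; apply phi0_PI).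
  replace (Ioc (PI * (1 - alpha)) PI) with (Ioc (PI * (1 - alpha)) (phi a PI)) by now rewrite EPI.
  apply increasing_homeomorphism; [exact HPI| | | |].
  - apply continuous_on_eps. intros x Hx e He.
    destruct (proj1 (continuous_on_eps _ _) (proj1 Ha) x Hx (e / 2) ltac:(lra)) as (d & Hd & H).
    exists (Rmin d (e / 2)). split; [apply Rmin_pos; lra|]. intros y Hy Hyx.
    specialize (H y Hy (Rlt_le_trans _ _ _ Hyx (Rmin_l _ _))).
    assert (Hyx' := Rlt_le_trans _ _ _ Hyx (Rmin_r d (e / 2))).
    unfold phi. apply Rabs_def2 in H, Hyx'. apply Rabs_def1; lra.
  - intros x y Hx Hxy Hy. rewrite !E by lra. now apply phi0_increasing.
  - intros x Hx. rewrite E by lra. now apply phi0_lower.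
  - intros e He. destruct (phi0_limit e He) as (x & Hx & Hlt). exists x. split; [exact Hx|].
    now rewrite E.
Qed.

End Angle.

(** * The infimum over the disc *)

Lemma Re_cis_mult (t : R) (w : C) : Re (cis t * w)%C = cos t * Re w - sin t * Im w.
Proof. rewrite re_mult. reflexivity. Qed.

Lemma Re_cis_mult_diff (t : R) (v w : C) : Rabs (Re (cis t * v)%C - Re (cis t * w)%C) <= Cmod (v - w)%C.
Proof.
  replace (Re (cis t * v)%C - Re (cis t * w)%C) with (Re (cis t * (v - w))%C).
  - eapply Rle_trans; [apply re_le_Cmod|]. rewrite Cmod_mult, Cmod_cis. lra.
  - rewrite !Re_cis_mult. unfold Cminus. rewrite re_plus, im_plus, re_opp, im_opp. ring.
Qed.

(** The map 1 / (1 - z) sends the disc into the half-plane Re > 1/2 and the circle to its border;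
    both the order of convexity of [k] and the case alpha = 0 rest on this. *)
Lemma Re_inv_one_minus (z : C) : 0 < Re (1 - z)%C ->
  Re (/ (1 - z))%C = / 2 + (1 - Cmod z ^ 2) / (2 * Cmod (1 - z)%C ^ 2).
Proof.
  intros H. assert (Hp : 0 < Cmod (1 - z)%C) by now apply Re_le_Cmod_pos.
  assert (Hp2 : 0 < Cmod (1 - z)%C ^ 2) by now apply pow_lt.
  rewrite !Cmod2_alt in *. destruct z as [x y]. simpl in *. field.
  lra.
Qed.

Lemma k_convex_of_order (alpha : R) : 0 <= alpha < 1 -> convex_of_order alpha (k alpha).
Proof.
  intros Ha.
  assert (D1 : forall z, Cmod z < 1 -> C_derive (k alpha) z = pw (2 - 2 * alpha) z).
  { intros z Hz. apply cder_C_derive, cder_k, Re_one_minus, Hz. }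
  split; [|split; [|split]].
  - intros z Hz. eexists. apply cder_is_derive, cder_k, Re_one_minus, Hz.
  - apply k_0.
  - rewrite D1 by (rewrite Cmod_0; lra). apply pw_at_0.
  - intros z Hz. unfold unit_disc in Hz. assert (Hre := Re_one_minus z Hz).
    rewrite (D1 z Hz). split; [apply pw_neq_0|].
    replace (C_derive (C_derive (k alpha)) z)
      with (RtoC (2 - 2 * alpha) * pw (2 - 2 * alpha + 1) z)%C.
    2:{ symmetry. apply cder_C_derive. apply der_ext_loc with (pw (2 - 2 * alpha)).
        - generalize (locally_disc z Hz). apply filter_imp. intros w Hw. symmetry. now apply D1.
        - apply cder_pw, Hre. }
    rewrite pw_S by exact Hre. assert (Hn := one_minus_neq_0 z Hre).
    replace (1 + z * (RtoC (2 - 2 * alpha) * (pw (2 - 2 * alpha) z / (1 - z))) / pw (2 - 2 * alpha) z)%C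
      with (RtoC 1 + RtoC (2 - 2 * alpha) * (/ (1 - z) + - (1)))%C
      by (field; split; [exact Hn | apply pw_neq_0]).
    rewrite re_plus, re_scal_l, re_plus, re_opp, !re_RtoC, Re_inv_one_minus by exact Hre.
    assert (Hp : 0 < Cmod (1 - z)%C) by now apply Re_le_Cmod_pos.
    assert (0 < (1 - Cmod z ^ 2) / (2 * Cmod (1 - z)%C ^ 2)).
    { apply Rdiv_lt_0_compat; [generalize (Cmod_ge_0 z); nra|].
      apply Rmult_lt_0_compat; [lra | now apply pow_lt]. }
    set (u := (1 - Cmod z ^ 2) / (2 * Cmod (1 - z)%C ^ 2)) in *. nra.
Qed.

Lemma h_at_0 (alpha : R) : h alpha (RtoC 0) = RtoC 1.
Proof.
  unfold h, div_id. destruct (Ceq_dec (RtoC 0) (RtoC 0)) as [_|n]; [reflexivity | now elim n].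
Qed.

Lemma h_div (alpha : R) (z : C) : z <> RtoC 0 -> h alpha z = (k alpha z / z)%C.
Proof. intros H. unfold h, div_id. destruct (Ceq_dec z (RtoC 0)); [contradiction | reflexivity]. Qed.

Section Infimum.
Variables (alpha t : R).
Hypothesis Halpha : 0 <= alpha < 1.

(** The closed disc without 1. As h is continuous up to this part of the boundary, an infimum over
    the disc may be tested at boundary points as well. *)
Definition rim (z : C) : Prop := Cmod z <= 1 /\ 0 < Re (1 - z)%C.

(** [k alpha] itself belongs to the class, so the values of h in the disc are among those over which
    the infimum runs; boundary points are reached along radii. *)
Lemma lower_bound_on_rim (b : R) :
  (forall f z, convex_of_order alpha f -> Cmod z < 1 -> b <= Re (cis t * div_id f z)%C) ->
  forall z, rim z -> b <= Re (cis t * h alpha z)%C.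
Proof.
  intros Hb z [Hz Hre].
  assert (Hin : forall w, Cmod w < 1 -> b <= Re (cis t * h alpha w)%C).
  { intros w Hw. apply Hb; [now apply k_convex_of_order | exact Hw]. }
  destruct Hz as [Hz|Hz]; [now apply Hin|].
  assert (Hz0 : z <> RtoC 0) by (apply Cmod_gt_0; lra).
  apply Rnot_lt_le. intros Hlt.
  assert (He : 0 < b - Re (cis t * h alpha z)%C) by lra.
  assert (Hc : continuous (h alpha) z) by (eapply cder_continuous, cder_h; assumption).
  destruct (proj1 (locally_C_Cmod _ _) (proj1 (continuous_C_eps _ _) Hc _ He)) as (d & Hd & H).
  set (r := 1 - Rmin (d / 2) (/ 2)).
  assert (Hm : 0 < Rmin (d / 2) (/ 2)) by (apply Rmin_pos; lra).
  assert (M1 := Rmin_l (d / 2) (/ 2)). assert (M2 := Rmin_r (d / 2) (/ 2)).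
  assert (Hr : 0 < r < 1) by (unfold r; lra).
  specialize (H (RtoC r * z)%C).
  assert (Hrz : Cmod (RtoC r * z)%C < 1) by (rewrite Cmod_mult, Cmod_R, Rabs_pos_eq, Hz; lra).
  assert (Hd' : Cmod (RtoC r * z - z)%C < d).
  { replace (RtoC r * z - z)%C with (RtoC (r - 1) * z)%C by (rewrite RtoC_minus; ring).
    rewrite Cmod_mult, Cmod_R, Hz, Rabs_left1 by lra. unfold r. lra. }
  specialize (H Hd'). specialize (Hin _ Hrz).
  generalize (Re_cis_mult_diff t (h alpha (RtoC r * z)%C) (h alpha z)). intros Hdiff.
  generalize (Rle_abs (Re (cis t * h alpha (RtoC r * z))%C - Re (cis t * h alpha z)%C)). lra.
Qed.

Lemma Q_finite (m : R) :
  (forall z, Cmod z < 1 -> m <= Re (cis t * h alpha z)%C) ->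
  (forall e, 0 < e -> exists z, rim z /\ Re (cis t * h alpha z)%C < m + e) ->
  Q alpha t = Finite m.
Proof.
  intros Hlow Hup. apply is_glb_Rbar_unique. split.
  - intros x (f & z & Hf & Hz & ->). change (m <= Re (cis t * div_id f z)%C). now apply (convex_of_order_lower_bound alpha f Halpha Hf z Hz).
  - intros b Hb.
    assert (Hb' : forall f z, convex_of_order alpha f -> Cmod z < 1 -> Rbar_le b (Re (cis t * div_id f z)%C)).
    { intros f z Hf Hz. apply Hb. exists f, z. split; [exact Hf | split; [exact Hz | reflexivity]]. }
    destruct b as [b| |]; [|exact (Hb' (k alpha) (RtoC 0) (k_convex_of_order alpha Halpha) ltac:(rewrite Cmod_0; lra))|exact I].
    change (b <= m). apply Rnot_lt_le. intros Hlt. destruct (Hup (b - m)) as (z & Hz & H); [lra|].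
    generalize (lower_bound_on_rim b Hb' z Hz). lra.
Qed.

Lemma Q_minus_infinity :
  (forall B, exists z, rim z /\ Re (cis t * h alpha z)%C < B) -> Q alpha t = m_infty.
Proof.
  intros H. apply is_glb_Rbar_unique. split; [intros x _; exact I|].
  intros b Hb.
  assert (Hb' : forall f z, convex_of_order alpha f -> Cmod z < 1 -> Rbar_le b (Re (cis t * div_id f z)%C)).
  { intros f z Hf Hz. apply Hb. exists f, z. split; [exact Hf | split; [exact Hz | reflexivity]]. }
  destruct b as [b| |].
  - destruct (H b) as (z & Hz & Hlt). generalize (lower_bound_on_rim b Hb' z Hz). lra.
  - exact (Hb' (k alpha) (RtoC 0) (k_convex_of_order alpha Halpha) ltac:(rewrite Cmod_0; lra)).
  - exact I.
Qed.

End Infimum.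

(** * Conjugation symmetry, and bounds carried from the circle to the disc *)

Lemma Clog_conj (w : C) : 0 < Re w -> Clog (Cconj w) = Cconj (Clog w).
Proof.
  intros H. rewrite !Clog_right by (rewrite ?re_conj; exact H). rewrite re_conj, im_conj.
  unfold Cconj. simpl. f_equal.
  - do 2 f_equal. ring.
  - rewrite <- atan_opp. f_equal. unfold Re, Im in *. field. lra.
Qed.

Lemma Cexp_conj (w : C) : Cexp (Cconj w) = Cconj (Cexp w).
Proof.
  unfold Cexp. rewrite re_conj, im_conj, <- Cconj_cis, Cmult_conj. f_equal.
  apply C_ext; simpl; ring.
Qed.

Lemma pw_conj (c : R) (z : C) : 0 < Re (1 - z)%C -> pw c (Cconj z) = Cconj (pw c z).
Proof.
  intros H. unfold pw. rewrite <- Cexp_conj. f_equal.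
  replace (1 - Cconj z)%C with (Cconj (1 - z)%C) by (apply C_ext; simpl; ring).
  rewrite Clog_conj, Cmult_conj by exact H. f_equal. apply C_ext; simpl; ring.
Qed.

Lemma h_conj (alpha : R) (z : C) : 0 < Re (1 - z)%C -> h alpha (Cconj z) = Cconj (h alpha z).
Proof.
  intros H. rewrite !h_integral.
  - rewrite <- CInt_conj.
    + apply CInt_ext. intros s Hs. rewrite Rmin_left, Rmax_right in Hs by lra.
      rewrite <- pw_conj by (apply Re_one_minus_scaled; [lra | exact H]).
      f_equal. apply C_ext; simpl; ring.
    + apply ex_CInt_continuous. intros s Hs. rewrite Rmin_left, Rmax_right in Hs by lra.
      now apply continuous_pw_scaled.
  - exact H.
  - unfold Cminus in *. rewrite re_plus, re_opp in *. now rewrite re_conj.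
Qed.

Lemma h_lipschitz (alpha d : R) (z w : C) : 0 <= alpha < 1 -> 0 < d ->
  (forall s, 0 <= s <= 1 -> Cmod (z + RtoC s * (w - z))%C <= 1 /\
     0 < Re (1 - (z + RtoC s * (w - z)))%C /\ 2 * d <= Cmod (1 - (z + RtoC s * (w - z)))%C) ->
  Cmod (h alpha w - h alpha z)%C
    <= (2 - 2 * alpha) * exp (- (2 - 2 * alpha + 1) * ln d) * Cmod (w - z)%C.
Proof.
  intros Ha Hd H. set (p := 2 - 2 * alpha).
  destruct (H 0 ltac:(lra)) as (_ & Hz & _). destruct (H 1 ltac:(lra)) as (_ & Hw & _).
  replace (z + RtoC 0 * (w - z))%C with z in Hz by ring.
  replace (z + RtoC 1 * (w - z))%C with w in Hw by ring.
  rewrite !h_integral by assumption. fold p.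
  assert (X : forall v, 0 < Re (1 - v)%C -> ex_CInt (fun s => pw p (v * RtoC s)%C) 0 1).
  { intros v Hv. apply ex_CInt_continuous. intros s Hs. rewrite Rmin_left, Rmax_right in Hs by lra.
    now apply continuous_pw_scaled. }
  rewrite <- CInt_minus by (apply X; assumption).
  replace (p * exp (- (p + 1) * ln d) * Cmod (w - z)%C)
    with ((1 - 0) * (p * exp (- (p + 1) * ln d) * Cmod (w - z)%C)) by ring.
  apply CInt_norm_le; [lra | apply ex_CInt_minus; apply X; assumption|].
  intros s Hs.
  apply Rle_trans with (p * exp (- (p + 1) * ln d) * Cmod (w * RtoC s - z * RtoC s)%C).
  2:{ apply Rmult_le_compat_l.
      - apply Rmult_le_pos; [unfold p; lra | left; apply exp_pos].
      - replace (w * RtoC s - z * RtoC s)%C with (RtoC s * (w - z))%C by ring.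
        rewrite Cmod_mult, Cmod_R, Rabs_pos_eq by lra. generalize (Cmod_ge_0 (w - z)%C). nra. }
  assert (Hin : forall u, (z * RtoC s + RtoC u * (w * RtoC s - z * RtoC s))%C
    = ((z + RtoC u * (w - z)) * RtoC s)%C) by (intros; ring).
  apply (cder_mean_value (pw p) (fun x => RtoC p * pw (p + 1) x)%C); intros u Hu; rewrite Hin;
    destruct (H u Hu) as (H1 & H2 & H3); set (v := (z + RtoC u * (w - z))%C) in *.
  - apply cder_pw. now apply Re_one_minus_scaled.
  - rewrite Cmod_mult, Cmod_R, Rabs_pos_eq by (unfold p; lra).
    apply Rmult_le_compat_l; [unfold p; lra|]. rewrite Cmod_pw.
    (* The distance from the scaled point to 1 is at least 1 - s, since |v| <= 1, and at least |1 -
       v| - (1 - s). The two bounds add up to at least 2 d. *)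
    assert (Hds : d <= Cmod (1 - v * RtoC s)%C).
    { assert (B1 : 1 - s <= Cmod (1 - v * RtoC s)%C).
      { generalize (Cmod_triangle_rev 1 (v * RtoC s)%C). rewrite Cmod_1, Cmod_mult, Cmod_R, Rabs_pos_eq by lra.
        generalize (Cmod_ge_0 v). nra. }
      assert (B2 : Cmod (1 - v)%C - (1 - s) <= Cmod (1 - v * RtoC s)%C).
      { replace (1 - v)%C with ((1 - v * RtoC s) - v * RtoC (1 - s))%C by (rewrite RtoC_minus; ring).
        generalize (Cmod_triangle_minus (1 - v * RtoC s)%C (v * RtoC (1 - s))%C).
        rewrite (Cmod_mult v), Cmod_R, (Rabs_pos_eq (1 - s)) by lra. generalize (Cmod_ge_0 v). nra. }
      lra. }
    assert (Hln : ln d <= ln (Cmod (1 - v * RtoC s)%C)) by (apply Rcomplements.ln_le; assumption).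
    apply exp_le. unfold p. nra.
Qed.

(** h is the difference quotient at 0 of the primitive of k', so [holo_difference_quotient] covers
    the origin as well. *)
Lemma h_holo (alpha : R) : holo (h alpha).
Proof.
  assert (Hp : holo (pw (2 - 2 * alpha))).
  { intros w Hw. eexists. apply cder_pw, Re_one_minus, Hw. }
  assert (E : forall w, Cmod w < 1 -> disc_primitive (pw (2 - 2 * alpha)) w = k alpha w).
  { intros w Hw. rewrite (disc_primitive_eq (k alpha)); [rewrite k_0; ring | exact Hp | | exact Hw].
    intros x Hx. apply cder_k, Re_one_minus, Hx. }
  intros w Hw.
  assert (H0 : Cmod (RtoC 0) < 1) by (rewrite Cmod_0; lra).
  destruct (holo_difference_quotient _ (RtoC 0) Hp H0 w Hw) as [l Hl].
  exists l. revert Hl. apply der_ext_loc. generalize (locally_disc w Hw). apply filter_imp.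
  intros x Hx. unfold h, div_id. destruct (Ceq_dec x (RtoC 0)) as [_|Hn]; [apply pw_at_0|].
  rewrite !E, k_0 by assumption. f_equal; ring.
Qed.

(** The minimum principle on a circle of radius 1 - s. Its points close to 1 are covered by the
    first bound; the others are compared with the boundary point on the same radius, where h is
    Lipschitz with a constant governed by the distance to 1. *)
Lemma disc_lower_bound (alpha t m : R) : 0 <= alpha < 1 ->
  (forall e, 0 < e -> exists d, 0 < d /\ forall z, rim z -> Cmod (1 - z)%C < d ->
     m - e <= Re (cis t * h alpha z)%C) ->
  (forall theta, 0 < theta < 2 * PI -> m <= Re (cis t * h alpha (cis theta))%C) ->
  forall z, Cmod z < 1 -> m <= Re (cis t * h alpha z)%C.
Proof.
  intros Ha Hnear Hbd z Hz. apply Rnot_lt_le. intros Hlt.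
  set (e := (m - Re (cis t * h alpha z)%C) / 2). assert (He : 0 < e) by (unfold e; lra).
  destruct (Hnear e He) as (d & Hd & Hn).
  set (L := (2 - 2 * alpha) * exp (- (2 - 2 * alpha + 1) * ln (d / 4))).
  assert (HL : 0 < L) by (apply Rmult_lt_0_compat; [lra | apply exp_pos]).
  (* The three bounds keep the short radial segments at distance d/2 from 1, make the change of h
     along them at most [e], and keep [z] inside the circle. In [L] the value d/4 appears because
     [h_lipschitz] asks for twice its parameter as distance. *)
  set (s := Rmin (Rmin (d / 2) (e / L)) ((1 - Cmod z) / 2)).
  assert (HeL : 0 < e / L) by (apply Rdiv_lt_0_compat; assumption).
  assert (Hs : 0 < s) by (unfold s; repeat apply Rmin_pos; lra).
  assert (S1 : s <= d / 2) by (unfold s; eapply Rle_trans; [apply Rmin_l | apply Rmin_l]).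
  assert (S2 : s <= e / L) by (unfold s; eapply Rle_trans; [apply Rmin_l | apply Rmin_r]).
  assert (S3 : s <= (1 - Cmod z) / 2) by apply Rmin_r.
  assert (Hz0 := Cmod_ge_0 z).
  set (r := 1 - s). assert (Hr : Cmod z < r < 1) by (unfold r; lra).
  set (U := fun w => (cis t * h alpha w)%C).
  assert (HU : holo U).
  { intros w Hw. destruct (h_holo alpha w Hw) as [l Hl]. eexists. apply der_scal, Hl. }
  assert (Hmin : m - e <= Re (U z)).
  { apply (minimum_principle U r (m - e) z HU); [lra | lra|].
    intros theta Ht. unfold U. set (w := circle r theta).
    assert (Hw : Cmod w = r) by (apply Cmod_circle; lra).
    destruct (Rlt_dec (Cmod (1 - w)%C) d) as [Hc|Hc].
    - apply Hn; [|exact Hc]. split; [lra | apply Re_one_minus; lra].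
    - assert (Hseg : forall u, 0 <= u <= 1 -> (cis theta + RtoC u * (w - cis theta))%C = circle (1 - u * s) theta).
      { intros u Hu. unfold w, circle, r. rewrite !RtoC_minus, RtoC_mult. ring. }
      assert (Hfar : forall u, 0 <= u <= 1 -> d / 2 <= Cmod (1 - circle (1 - u * s) theta)%C).
      { intros u Hu.
        replace (1 - w)%C with ((1 - circle (1 - u * s) theta) + RtoC (s * (1 - u)) * cis theta)%C in Hc.
        2:{ unfold w, circle, r. rewrite !RtoC_minus, !RtoC_mult, !RtoC_minus. ring. }
        assert (Htri := Cmod_triangle (1 - circle (1 - u * s) theta)%C (RtoC (s * (1 - u)) * cis theta)%C).
        assert (0 <= s * (1 - u)) by (apply Rmult_le_pos; lra).
        rewrite (Cmod_mult (RtoC (s * (1 - u)))), Cmod_cis, Cmod_R, Rabs_pos_eq in Htri by assumption.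
        assert (s * (1 - u) <= s * 1) by (apply Rmult_le_compat_l; lra). lra. }
      assert (Htheta : 0 < theta < 2 * PI).
      { assert (H0 := Hfar 0 ltac:(lra)). replace (circle (1 - 0 * s) theta) with (cis theta) in H0.
        2:{ unfold circle. rewrite Rmult_0_l, Rminus_0_r. ring. }
        split; apply Rnot_le_lt; intros Hle.
        - replace theta with 0 in H0 by lra. rewrite cis_0 in H0.
          replace (1 - 1)%C with (RtoC 0) in H0 by ring. rewrite Cmod_0 in H0. lra.
        - replace theta with (2 * PI) in H0 by lra. rewrite cis_2PI in H0.
          replace (1 - 1)%C with (RtoC 0) in H0 by ring. rewrite Cmod_0 in H0. lra. }
      assert (HD : Cmod (h alpha w - h alpha (cis theta))%C <= L * Cmod (w - cis theta)%C).
      { apply h_lipschitz; [exact Ha | lra|]. intros u Hu. rewrite Hseg by exact Hu.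
        assert (Hus : 0 <= u * s <= s) by nra.
        assert (Hcm : Cmod (circle (1 - u * s) theta) = 1 - u * s) by (apply Cmod_circle; unfold r in Hr; lra).
        split; [lra|]. split.
        - destruct (Req_dec (u * s) 0) as [E|E].
          + rewrite E. replace (circle (1 - 0) theta) with (cis theta) by (unfold circle; rewrite Rminus_0_r; ring).
            now apply Re_one_minus_cis.
          + apply Re_one_minus. lra.
        - specialize (Hfar u Hu). lra. }
      assert (Hws : Cmod (w - cis theta)%C = s).
      { unfold w, circle. replace (RtoC r * cis theta - cis theta)%C with (RtoC (r - 1) * cis theta)%C
          by (rewrite RtoC_minus; ring).
        rewrite Cmod_mult, Cmod_cis, Cmod_R, Rabs_left1 by lra. unfold r. ring. }
      rewrite Hws in HD.
      assert (HLs : L * s <= e).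
      { apply Rle_trans with (L * (e / L)); [apply Rmult_le_compat_l; lra|]. right. field. lra. }
      assert (Hdiff := Re_cis_mult_diff t (h alpha (cis theta)) (h alpha w)).
      rewrite Cmod_minus_sym in HD.
      assert (Habs := Rle_abs (Re (cis t * h alpha (cis theta))%C - Re (cis t * h alpha w)%C)).
      specialize (Hbd theta Htheta). lra. }
  unfold U, e in *. lra.
Qed.

(** * Behaviour near 1 and minimum on the circle *)

Section NearOne.
Variables (alpha t : R).
Hypothesis Halpha : 0 < alpha < 1.

(** The difference is k (1 - z) / z, of order |1 - z|^(1 - g). Near 1 the function h may thus be
    replaced by k, whose rotated real part is explicit. *)
Lemma h_minus_k_small (e : R) : 0 < e -> exists d, 0 < d /\ forall z, 0 < Re (1 - z)%C ->
  Cmod (1 - z)%C < d -> Rabs (Re (cis t * h alpha z)%C - Re (cis t * k alpha z)%C) < e.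
Proof.
  intros He. destruct (k_growth alpha Halpha) as (K & g & HK & Hg & _ & Hk).
  destruct (rpower_small (1 + - g) (e / (2 * K))) as (d & Hd & Hs); [lra | apply Rdiv_lt_0_compat; lra|].
  exists (Rmin d (/ 2)). split; [apply Rmin_pos; lra|]. intros z Hre HD.
  assert (HD0 : 0 < Cmod (1 - z)%C) by now apply Re_le_Cmod_pos.
  set (D := Cmod (1 - z)%C) in *.
  assert (D1 : D < d) by (eapply Rlt_le_trans; [exact HD | apply Rmin_l]).
  assert (D2 : D < / 2) by (eapply Rlt_le_trans; [exact HD | apply Rmin_r]).
  assert (Hz : / 2 <= Cmod z).
  { generalize (Cmod_triangle_rev 1 (1 - z)%C). replace (1 - (1 - z))%C with z by ring.
    rewrite Cmod_1. fold D. lra. }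
  assert (Hz0 : z <> RtoC 0) by (apply Cmod_gt_0; lra).
  eapply Rle_lt_trans; [apply Re_cis_mult_diff|]. rewrite h_div by exact Hz0.
  replace (k alpha z / z - k alpha z)%C with (k alpha z * (1 - z) * / z)%C by (field; exact Hz0).
  rewrite !Cmod_mult, Cmod_inv by exact Hz0. fold D.
  specialize (Hk z Hre ltac:(fold D; lra)). fold D in Hk.
  assert (Hi : / Cmod z <= 2).
  { rewrite <- (Rinv_inv 2). apply Rinv_le_contravar; lra. }
  assert (Hi0 : 0 < / Cmod z) by (apply Rinv_0_lt_compat; lra).
  specialize (Hs D ltac:(lra)). rewrite <- exp_mult_ln in Hs by exact HD0.
  assert (HE := exp_pos (- g * ln D)).
  apply Rle_lt_trans with (K * exp (- g * ln D) * D * 2).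
  - apply Rmult_le_compat; [apply Rmult_le_pos; [apply Cmod_ge_0 | lra] | lra | | exact Hi].
    apply Rmult_le_compat_r; [lra | exact Hk].
  - apply Rmult_lt_compat_l with (r := 2 * K) in Hs; [|lra].
    replace (2 * K * (e / (2 * K))) with e in Hs by (field; lra). lra.
Qed.

Lemma near_one_lower (m : R) :
  (forall e, 0 < e -> exists d, 0 < d /\ forall z, 0 < Re (1 - z)%C -> Cmod (1 - z)%C < d ->
     m - e <= Re (cis t * k alpha z)%C) ->
  forall e, 0 < e -> exists d, 0 < d /\ forall z, 0 < Re (1 - z)%C -> Cmod (1 - z)%C < d ->
     m - e <= Re (cis t * h alpha z)%C.
Proof.
  intros H e He. destruct (H (e / 2)) as (d1 & Hd1 & H1); [lra|].
  destruct (h_minus_k_small (e / 2)) as (d2 & Hd2 & H2); [lra|].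
  exists (Rmin d1 d2). split; [now apply Rmin_pos|]. intros z Hz HD.
  specialize (H1 z Hz (Rlt_le_trans _ _ _ HD (Rmin_l _ _))).
  specialize (H2 z Hz (Rlt_le_trans _ _ _ HD (Rmin_r _ _))). apply Rabs_def2 in H2. lra.
Qed.

Lemma near_one_upper (m : R) :
  (forall e d, 0 < e -> 0 < d -> exists z, rim z /\ Cmod (1 - z)%C < d /\
     Re (cis t * k alpha z)%C < m + e) ->
  forall e, 0 < e -> exists z, rim z /\ Re (cis t * h alpha z)%C < m + e.
Proof.
  intros H e He. destruct (h_minus_k_small (e / 2)) as (d2 & Hd2 & H2); [lra|].
  destruct (H (e / 2) d2) as (z & Hz & HD & Hk); [lra|exact Hd2|]. exists z. split; [exact Hz|].
  specialize (H2 z (proj2 Hz) HD). apply Rabs_def2 in H2. lra.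
Qed.

Lemma near_one_minus_infinity :
  (forall B d, 0 < d -> exists z, rim z /\ Cmod (1 - z)%C < d /\ Re (cis t * k alpha z)%C < B) ->
  forall B, exists z, rim z /\ Re (cis t * h alpha z)%C < B.
Proof.
  intros H B. destruct (h_minus_k_small 1) as (d2 & Hd2 & H2); [lra|].
  destruct (H (B - 1) d2 Hd2) as (z & Hz & HD & Hk). exists z. split; [exact Hz|].
  specialize (H2 z (proj2 Hz) HD). apply Rabs_def2 in H2. lra.
Qed.

Definition psi (z : C) : R := Im (Clog (1 - z)%C).

Lemma Re_cis_k (z : C) : alpha <> 1 / 2 -> Re (cis t * k alpha z)%C
  = (exp (- (1 - 2 * alpha) * ln (Cmod (1 - z)%C)) * cos (t - (1 - 2 * alpha) * psi z) - cos t) / (1 - 2 * alpha).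
Proof.
  intros Hn. unfold k. destruct (Req_EM_T alpha (1 / 2)) as [E|_]; [contradiction|].
  unfold Cpowr, Cexp. rewrite re_scal_l, im_scal_l, Re_Clog. fold (psi z).
  replace ((2 * alpha - 1) * psi z) with (- ((1 - 2 * alpha) * psi z)) by ring.
  replace (2 * alpha - 1) with (- (1 - 2 * alpha)) by ring.
  set (E := exp (- (1 - 2 * alpha) * ln (Cmod (1 - z)%C))). set (x := (1 - 2 * alpha) * psi z).
  replace (t - x) with (t + - x) by ring. rewrite cos_plus, Re_cis_mult. simpl. field. lra.
Qed.

Lemma Re_cis_k_half (z : C) : alpha = 1 / 2 ->
  Re (cis t * k alpha z)%C = - ln (Cmod (1 - z)%C) * cos t + psi z * sin t.
Proof.
  intros Hn. unfold k. destruct (Req_EM_T alpha (1 / 2)) as [_|E]; [|contradiction].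
  rewrite Re_cis_mult, re_opp, im_opp, Re_Clog. fold (psi z). ring.
Qed.

Lemma psi_bound (z : C) : 0 < Re (1 - z)%C -> - (PI / 2) < psi z < PI / 2.
Proof. apply Im_Clog_bound. Qed.

Lemma psi_cis (theta : R) : 0 < theta < 2 * PI -> psi (cis theta) = (theta - PI) / 2.
Proof. apply Im_Clog_one_minus_cis. Qed.

Lemma rim_cis (theta : R) : 0 < theta < 2 * PI -> rim (cis theta).
Proof. intros H. split; [rewrite Cmod_cis; lra | now apply Re_one_minus_cis]. Qed.

Lemma ln_large (B : R) : exists d, 0 < d /\ forall D, 0 < D < d -> B < - ln D.
Proof.
  exists (exp (- B)). split; [apply exp_pos|]. intros D HD.
  assert (ln D < ln (exp (- B))) by (apply ln_increasing; lra). rewrite ln_exp in H. lra.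
Qed.

(** With b = 1 - 2 alpha > 0, the angle t - b psi stays in modulus below t + b PI/2, which is less
    than PI/2 exactly because t < alpha PI; its cosine is bounded below while the power tends to
    infinity. For alpha = 1/2 the logarithm takes the place of the power. *)
Lemma k_large_near_one (m : R) : alpha <= 1 / 2 -> 0 <= t < alpha * PI ->
  exists d, 0 < d /\ forall z, 0 < Re (1 - z)%C -> Cmod (1 - z)%C < d -> m <= Re (cis t * k alpha z)%C.
Proof.
  intros Ha Ht. assert (HPI := PI_RGT_0). destruct (Req_dec alpha (1 / 2)) as [E|Hn].
  - assert (Hc : 0 < cos t) by (apply cos_gt_0; rewrite E in Ht; lra).
    destruct (ln_large ((Rabs m + PI) / cos t)) as (d & Hd & H).
    exists d. split; [exact Hd|]. intros z Hz HD.
    assert (HD0 : 0 < Cmod (1 - z)%C) by now apply Re_le_Cmod_pos.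
    specialize (H _ (conj HD0 HD)). rewrite Re_cis_k_half by exact E.
    apply Rmult_lt_compat_r with (r := cos t) in H; [|exact Hc].
    replace ((Rabs m + PI) / cos t * cos t) with (Rabs m + PI) in H by (field; lra).
    assert (Hp := psi_bound z Hz). assert (Hs := SIN_bound t). assert (Hm := Rle_abs m).
    assert (- PI <= psi z * sin t) by nra. lra.
  - set (b := 1 - 2 * alpha). assert (Hb : 0 < b < 1) by (unfold b; lra).
    assert (Hangle : 0 <= t + b * (PI / 2) < PI / 2) by (unfold b; nra).
    assert (Hc : 0 < cos (t + b * (PI / 2))) by (apply cos_gt_0; lra).
    destruct (rpower_large b ((b * Rabs m + 1) / cos (t + b * (PI / 2)))) as (d & Hd & H); [lra|].
    exists d. split; [exact Hd|]. intros z Hz HD.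
    assert (HD0 : 0 < Cmod (1 - z)%C) by now apply Re_le_Cmod_pos.
    specialize (H _ (conj HD0 HD)). rewrite Re_cis_k by exact Hn. fold b.
    assert (Hp := psi_bound z Hz).
    assert (Hcos : cos (t + b * (PI / 2)) <= cos (t - b * psi z)).
    { destruct (Rle_dec 0 (t - b * psi z)) as [H0|H0].
      - apply cos_decr_1; nra.
      - rewrite <- (cos_neg (t - b * psi z)). apply cos_decr_1; nra. }
    set (E := exp (- b * ln (Cmod (1 - z)%C))) in *. assert (HE : 0 < E) by apply exp_pos.
    apply Rmult_lt_compat_r with (r := cos (t + b * (PI / 2))) in H; [|exact Hc].
    replace ((b * Rabs m + 1) / cos (t + b * (PI / 2)) * cos (t + b * (PI / 2)))
      with (b * Rabs m + 1) in H by (field; lra).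
    assert (Ht1 := COS_bound t). assert (Hm := Rle_abs m).
    assert (E * cos (t + b * (PI / 2)) <= E * cos (t - b * psi z)) by (apply Rmult_le_compat_l; lra).
    apply Rmult_le_reg_r with b; [lra|]. unfold Rdiv. rewrite Rmult_assoc, Rinv_l, Rmult_1_r by lra.
    assert (m * b <= Rabs m * b) by (apply Rmult_le_compat_r; lra). lra.
Qed.

(** At t = alpha PI the extreme angle t + b PI/2 is exactly PI/2, so the term with the power is
    still nonnegative. *)
Lemma k_lower_critical (z : C) : alpha < 1 / 2 -> t = alpha * PI -> 0 < Re (1 - z)%C ->
  / (2 * alpha - 1) * cos (alpha * PI) <= Re (cis t * k alpha z)%C.
Proof.
  intros Ha Ht Hz. assert (HPI := PI_RGT_0). rewrite Re_cis_k by lra. rewrite <- Ht.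
  set (b := 1 - 2 * alpha). assert (Hb : 0 < b) by (unfold b; lra).
  replace (/ (2 * alpha - 1) * cos t) with ((0 - cos t) / b) by (unfold b; field; lra).
  apply Rmult_le_compat_r; [left; now apply Rinv_0_lt_compat|].
  assert (Hp := psi_bound z Hz).
  assert (0 <= cos (t - b * psi z)).
  { assert (B1 : - (PI / 2) <= t - b * psi z <= PI / 2) by (rewrite Ht; unfold b; nra).
    apply cos_ge_0; lra. }
  assert (0 <= exp (- b * ln (Cmod (1 - z)%C)) * cos (t - b * psi z)).
  { apply Rmult_le_pos; [left; apply exp_pos | assumption]. }
  lra.
Qed.

Lemma k_lower_critical_half (z : C) : alpha = 1 / 2 -> t = PI / 2 -> 0 < Re (1 - z)%C ->
  - (PI / 2) <= Re (cis t * k alpha z)%C.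
Proof.
  intros Ha Ht Hz. rewrite Re_cis_k_half by exact Ha. rewrite Ht, cos_PI2, sin_PI2.
  generalize (psi_bound z Hz). lra.
Qed.

(** For alpha > 1/2 the power has the positive exponent 2 alpha - 1 and vanishes at 1, so k tends to
    1 / (2 alpha - 1). *)
Lemma k_limit_one (e : R) : 1 / 2 < alpha -> 0 < e -> exists d, 0 < d /\
  forall z, 0 < Re (1 - z)%C -> Cmod (1 - z)%C < d ->
    Rabs (Re (cis t * k alpha z)%C - / (2 * alpha - 1) * cos t) < e.
Proof.
  intros Ha He. set (b := 2 * alpha - 1). assert (Hb : 0 < b) by (unfold b; lra).
  destruct (rpower_small b (b * e) Hb) as (d & Hd & H); [apply Rmult_lt_0_compat; lra|].
  exists d. split; [exact Hd|]. intros z Hz HD.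
  assert (HD0 : 0 < Cmod (1 - z)%C) by now apply Re_le_Cmod_pos.
  specialize (H _ (conj HD0 HD)). rewrite Re_cis_k by lra.
  set (c := cos (t - (1 - 2 * alpha) * psi z)).
  replace (- (1 - 2 * alpha)) with b by (unfold b; ring).
  set (E := exp (b * ln (Cmod (1 - z)%C))) in *. assert (HE : 0 < E) by apply exp_pos.
  replace ((E * c - cos t) / (1 - 2 * alpha) - / b * cos t) with (- (E * c / b))
    by (unfold b; field; lra).
  rewrite Rabs_Ropp. unfold Rdiv. rewrite !Rabs_mult, (Rabs_pos_eq E), (Rabs_pos_eq (/ b))
    by (try (left; apply Rinv_0_lt_compat); lra).
  assert (Hc : Rabs c <= 1) by (apply Rabs_le; generalize (COS_bound (t - (1 - 2 * alpha) * psi z)); unfold c; lra).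
  apply Rmult_lt_reg_r with b; [exact Hb|]. rewrite Rmult_assoc, Rinv_l, Rmult_1_r by lra.
  generalize (Rabs_pos c). nra.
Qed.

Lemma small_angle (d e : R) : 0 < d -> 0 < e -> exists theta, 0 < theta /\ theta < e /\ theta < PI /\
  rim (cis theta) /\ 0 < Cmod (1 - cis theta)%C /\ Cmod (1 - cis theta)%C < d.
Proof.
  intros Hd He. assert (HPI := PI_RGT_0). set (x := Rmin (Rmin d e) PI / 2).
  assert (Hm : 0 < Rmin (Rmin d e) PI) by (repeat apply Rmin_pos; lra).
  assert (A1 : Rmin (Rmin d e) PI <= d) by (eapply Rle_trans; [apply Rmin_l | apply Rmin_l]).
  assert (A2 : Rmin (Rmin d e) PI <= e) by (eapply Rle_trans; [apply Rmin_l | apply Rmin_r]).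
  assert (A3 : Rmin (Rmin d e) PI <= PI) by apply Rmin_r.
  exists x. assert (Hx : 0 < x) by (unfold x; lra).
  assert (H2 : 0 < x < 2 * PI) by (unfold x; lra).
  destruct (Cmod_one_minus_cis_le x H2) as [HD0 HD].
  assert (Hrim : rim (cis x)) by now apply rim_cis.
  assert (Hxd : x < d) by (unfold x; lra). assert (Hxe : x < e) by (unfold x; lra).
  assert (HxPI : x < PI) by (unfold x; lra).
  do 4 (split; [assumption|]). split; lra.
Qed.

(** Along the circle the angle is PI/2 - b theta/2. Its cosine is at most |1 - z|, which beats the
    power |1 - z|^(-b) since b < 1. *)
Lemma k_upper_critical (e d : R) : alpha < 1 / 2 -> t = alpha * PI -> 0 < e -> 0 < d ->
  exists z, rim z /\ Cmod (1 - z)%C < d /\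
    Re (cis t * k alpha z)%C < / (2 * alpha - 1) * cos (alpha * PI) + e.
Proof.
  intros Ha Ht He Hd. assert (HPI := PI_RGT_0).
  set (b := 1 - 2 * alpha). assert (Hb : 0 < b < 1) by (unfold b; lra).
  destruct (rpower_small (1 + - b) (b * e)) as (d' & Hd' & H); [lra | apply Rmult_lt_0_compat; lra|].
  destruct (small_angle (Rmin d d') PI) as (x & Hx & _ & HxPI & Hrim & HD0 & HD); [now apply Rmin_pos | exact HPI|].
  exists (cis x). split; [exact Hrim|]. split; [eapply Rlt_le_trans; [exact HD | apply Rmin_l]|].
  specialize (H _ (conj HD0 (Rlt_le_trans _ _ _ HD (Rmin_r _ _)))).
  rewrite Re_cis_k, psi_cis by lra. rewrite <- Ht. fold b.
  replace (/ (2 * alpha - 1) * cos t) with (- cos t / b) by (unfold b; field; lra).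
  replace (t - b * ((x - PI) / 2)) with (PI / 2 - b * x / 2) by (rewrite Ht; unfold b; field).
  rewrite cos_shift.
  assert (Hsin : sin (b * x / 2) <= Cmod (1 - cis x)%C).
  { rewrite Cmod_one_minus_cis by lra.
    assert (sin (b * x / 2) <= sin (x / 2)) by (apply sin_incr_1; nra).
    assert (0 <= sin (x / 2)) by (apply sin_ge_0; lra). lra. }
  rewrite <- exp_mult_ln in H by exact HD0.
  set (E := exp (- b * ln (Cmod (1 - cis x)%C))) in *. assert (HE : 0 < E) by apply exp_pos.
  apply Rmult_lt_reg_r with b; [lra|].
  replace ((E * sin (b * x / 2) - cos t) / b * b) with (E * sin (b * x / 2) - cos t) by (field; lra).
  replace ((- cos t / b + e) * b) with (b * e - cos t) by (field; lra).
  assert (E * sin (b * x / 2) <= E * Cmod (1 - cis x)%C) by (apply Rmult_le_compat_l; lra). lra.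
Qed.

Lemma k_upper_critical_half (e d : R) : alpha = 1 / 2 -> t = PI / 2 -> 0 < e -> 0 < d ->
  exists z, rim z /\ Cmod (1 - z)%C < d /\ Re (cis t * k alpha z)%C < - (PI / 2) + e.
Proof.
  intros Ha Ht He Hd. destruct (small_angle d e Hd He) as (x & Hx & Hxe & HxPI & Hrim & HD0 & HD).
  exists (cis x). split; [exact Hrim|]. split; [exact HD|].
  rewrite Re_cis_k_half, psi_cis, Ht, cos_PI2, sin_PI2 by (trivial; lra). lra.
Qed.

Lemma k_upper_limit (e d : R) : 1 / 2 < alpha -> 0 < e -> 0 < d ->
  exists z, rim z /\ Cmod (1 - z)%C < d /\ Re (cis t * k alpha z)%C < / (2 * alpha - 1) * cos t + e.
Proof.
  intros Ha He Hd. destruct (k_limit_one e Ha He) as (d' & Hd' & H).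
  destruct (small_angle (Rmin d d') PI) as (x & Hx & _ & HxPI & Hrim & HD0 & HD);
    [now apply Rmin_pos | exact PI_RGT_0|].
  exists (cis x). split; [exact Hrim|]. split; [eapply Rlt_le_trans; [exact HD | apply Rmin_l]|].
  specialize (H _ (proj2 Hrim) (Rlt_le_trans _ _ _ HD (Rmin_r _ _))). apply Rabs_def2 in H. lra.
Qed.

Lemma rim_real (D : R) : 0 < D < 1 ->
  rim (RtoC (1 - D)) /\ Cmod (1 - RtoC (1 - D))%C = D /\ psi (RtoC (1 - D)) = 0.
Proof.
  intros HD. assert (E : (1 - RtoC (1 - D))%C = RtoC D) by (rewrite RtoC_minus; ring).
  split; [|split].
  - split; [rewrite Cmod_R, Rabs_pos_eq; lra | rewrite E; simpl; lra].
  - rewrite E, Cmod_R, Rabs_pos_eq; lra.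
  - unfold psi. rewrite E, Clog_right by (simpl; lra). simpl.
    replace (0 / D) with 0 by (field; lra). apply atan_0.
Qed.

(* Towards 1 along the unit circle [Re (e^(it) k)] tends to [-oo] if
   [alpha PI < t <= PI / 2], and along the radius if [PI / 2 < t <= PI]. *)
Lemma k_minus_infinity (B d : R) : alpha <= 1 / 2 -> alpha * PI < t <= PI -> 0 < d ->
  exists z, rim z /\ Cmod (1 - z)%C < d /\ Re (cis t * k alpha z)%C < B.
Proof.
  intros Ha Ht Hd. assert (HPI := PI_RGT_0). assert (HB := Rle_abs (- B)). rewrite Rabs_Ropp in HB.
  destruct (Rle_dec t (PI / 2)) as [Hle|Hgt].
  - assert (Hn : alpha <> 1 / 2) by (intros E; rewrite E in Ht; lra).
    set (b := 1 - 2 * alpha). assert (Hb : 0 < b < 1) by (unfold b; lra).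
    (* [a0] is the limit of the angle along the circle; it exceeds PI/2 because t > alpha PI. The
       midpoint [a1] between PI/2 and [a0] gives a fixed negative upper bound for the cosine of all
       angles slightly below [a0]. *)
    set (a0 := t + b * (PI / 2)).
    assert (Ha0 : PI / 2 < a0 <= PI) by (unfold a0, b in *; nra).
    set (a1 := (a0 + PI / 2) / 2).
    assert (Hc : cos a1 < 0) by (apply cos_lt_0; unfold a1; lra).
    destruct (rpower_large b ((b * Rabs B + 1) / - cos a1)) as (d' & Hd' & H); [lra|].
    destruct (small_angle (Rmin d d') (a0 - PI / 2)) as (x & Hx & Hxe & HxPI & Hrim & HD0 & HD);
      [now apply Rmin_pos | lra|].
    exists (cis x). split; [exact Hrim|]. split; [eapply Rlt_le_trans; [exact HD | apply Rmin_l]|].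
    specialize (H _ (conj HD0 (Rlt_le_trans _ _ _ HD (Rmin_r _ _)))).
    rewrite Re_cis_k, psi_cis by (trivial; lra). fold b.
    replace (t - b * ((x - PI) / 2)) with (a0 - b * x / 2) by (unfold a0; field).
    assert (Hcos : cos (a0 - b * x / 2) <= cos a1) by (apply cos_decr_1; unfold a1; nra).
    set (E := exp (- b * ln (Cmod (1 - cis x)%C))) in *. assert (HE : 0 < E) by apply exp_pos.
    apply Rmult_lt_compat_r with (r := - cos a1) in H; [|lra].
    replace ((b * Rabs B + 1) / - cos a1 * - cos a1) with (b * Rabs B + 1) in H by (field; lra).
    assert (E * cos (a0 - b * x / 2) <= E * cos a1) by (apply Rmult_le_compat_l; lra).
    apply Rmult_lt_reg_r with b; [lra|].
    replace ((E * cos (a0 - b * x / 2) - cos t) / b * b) with (E * cos (a0 - b * x / 2) - cos t) by (field; lra).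
    generalize (COS_bound t). assert (- B * b <= Rabs B * b) by (apply Rmult_le_compat_r; lra). lra.
  - assert (Hc : cos t < 0) by (apply cos_lt_0; lra).
    destruct (Req_dec alpha (1 / 2)) as [Ea|Hn].
    + destruct (ln_large (Rabs B / - cos t)) as (d' & Hd' & H).
      set (D := Rmin (Rmin d d') 1 / 2). assert (Hm : 0 < Rmin (Rmin d d') 1) by (repeat apply Rmin_pos; lra).
      assert (A1 : Rmin (Rmin d d') 1 <= d) by (eapply Rle_trans; [apply Rmin_l | apply Rmin_l]).
      assert (A2 : Rmin (Rmin d d') 1 <= d') by (eapply Rle_trans; [apply Rmin_l | apply Rmin_r]).
      assert (A3 : Rmin (Rmin d d') 1 <= 1) by apply Rmin_r.
      destruct (rim_real D) as (Hrim & ED & Epsi); [unfold D; lra|].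
      exists (RtoC (1 - D)). split; [exact Hrim|]. rewrite Re_cis_k_half, ED, Epsi by exact Ea.
      split; [unfold D; lra|]. specialize (H D ltac:(unfold D; lra)).
      apply Rmult_lt_compat_r with (r := - cos t) in H; [|lra].
      replace (Rabs B / - cos t * - cos t) with (Rabs B) in H by (field; lra). lra.
    + set (b := 1 - 2 * alpha). assert (Hb : 0 < b < 1) by (unfold b; lra).
      destruct (rpower_large b ((b * Rabs B + 1) / - cos t)) as (d' & Hd' & H); [lra|].
      set (D := Rmin (Rmin d d') 1 / 2). assert (Hm : 0 < Rmin (Rmin d d') 1) by (repeat apply Rmin_pos; lra).
      assert (A1 : Rmin (Rmin d d') 1 <= d) by (eapply Rle_trans; [apply Rmin_l | apply Rmin_l]).
      assert (A2 : Rmin (Rmin d d') 1 <= d') by (eapply Rle_trans; [apply Rmin_l | apply Rmin_r]).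
      assert (A3 : Rmin (Rmin d d') 1 <= 1) by apply Rmin_r.
      destruct (rim_real D) as (Hrim & ED & Epsi); [unfold D; lra|].
      exists (RtoC (1 - D)). split; [exact Hrim|]. rewrite Re_cis_k, ED, Epsi by exact Hn.
      split; [unfold D; lra|]. specialize (H D ltac:(unfold D; lra)). fold b.
      rewrite Rmult_0_r, Rminus_0_r.
      set (E := exp (- b * ln D)) in *.
      apply Rmult_lt_compat_r with (r := - cos t) in H; [|lra].
      replace ((b * Rabs B + 1) / - cos t * - cos t) with (b * Rabs B + 1) in H by (field; lra).
      apply Rmult_lt_reg_r with b; [lra|].
      replace ((E * cos t - cos t) / b * b) with (E * cos t - cos t) by (field; lra).
      generalize (COS_bound t). assert (- B * b <= Rabs B * b) by (apply Rmult_le_compat_r; lra). lra.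
Qed.

Definition boundary_value (theta : R) : R := Re (cis t * h alpha (cis theta))%C.

Lemma is_derive_boundary_value (theta : R) : 0 < theta <= PI ->
  is_derive boundary_value theta (- Cmod (Mcurve alpha theta) * sin (t + phi0 alpha theta)).
Proof.
  intros H. assert (HPI := PI_RGT_0).
  replace (- Cmod (Mcurve alpha theta) * sin (t + phi0 alpha theta))
    with (Re (cis t * (Ci * Mcurve alpha theta))%C).
  - apply (rder_Re (fun s => cis t * h alpha (cis s))%C), der_scal, rder_h_cis; trivial. lra.
  - rewrite (Mcurve_phi0 alpha Halpha theta H) at 1. rewrite sin_plus.
    set (m := Cmod (Mcurve alpha theta)). simpl. ring.
Qed.

Lemma boundary_value_MVT (x y : R) : 0 < x -> x < y -> y <= PI -> exists c, x <= c <= y /\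
  boundary_value y - boundary_value x
    = - Cmod (Mcurve alpha c) * sin (t + phi0 alpha c) * (y - x).
Proof.
  intros Hx Hxy Hy.
  destruct (MVT_gen boundary_value x y (fun c => - Cmod (Mcurve alpha c) * sin (t + phi0 alpha c)))
    as (c & Hc & E).
  - intros s Hs. rewrite Rmin_left, Rmax_right in Hs by lra. apply is_derive_boundary_value. lra.
  - intros s Hs. rewrite Rmin_left, Rmax_right in Hs by lra.
    apply continuity_pt_filterlim. eapply is_derive_continuous_R, is_derive_boundary_value. lra.
  - rewrite Rmin_left, Rmax_right in Hc by lra. now exists c.
Qed.

Lemma phi0_le (x y : R) : 0 < x -> x <= y -> y <= PI -> phi0 alpha x <= phi0 alpha y.
Proof. intros Hx [Hxy | ->] Hy; [left; now apply phi0_increasing | apply Rle_refl]. Qed.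

(** The angle t + phi increases inside (0, 2 PI) and reaches PI at theta0, where the sign of the
    derivative changes from minus to plus. *)
Lemma boundary_value_min (theta0 theta : R) : 0 <= t -> 0 < theta0 <= PI -> phi0 alpha theta0 = PI - t ->
  0 < theta <= PI -> boundary_value theta0 <= boundary_value theta.
Proof.
  intros Ht H0 Hphi H. assert (HPI := PI_RGT_0).
  destruct (Rtotal_order theta theta0) as [Hlt|[->|Hgt]]; [| lra |].
  - destruct (boundary_value_MVT theta theta0) as (c & Hc & E); [lra | exact Hlt | lra|].
    assert (P1 := phi0_le c theta0 ltac:(lra) ltac:(lra) ltac:(lra)).
    assert (P2 := phi0_lower alpha Halpha c ltac:(lra)).
    assert (Hs : 0 <= sin (t + phi0 alpha c)).
    { apply sin_ge_0; [|lra]. assert (0 <= PI * (1 - alpha)) by (apply Rmult_le_pos; lra). lra. }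
    assert (0 <= Cmod (Mcurve alpha c) * sin (t + phi0 alpha c) * (theta0 - theta)).
    { apply Rmult_le_pos; [apply Rmult_le_pos; [apply Cmod_ge_0 | exact Hs] | lra]. }
    lra.
  - destruct (boundary_value_MVT theta0 theta) as (c & Hc & E); [lra | exact Hgt | lra|].
    assert (P1 := phi0_le theta0 c ltac:(lra) ltac:(lra) ltac:(lra)).
    assert (P2 := phi0_le c PI ltac:(lra) ltac:(lra) ltac:(lra)). rewrite phi0_PI in P2 by exact Halpha.
    assert (P3 := phi0_lower alpha Halpha theta0 H0).
    assert (Hs : sin (t + phi0 alpha c) <= 0).
    { apply sin_le_0; [lra|]. assert (0 <= PI * (1 - alpha)) by (apply Rmult_le_pos; lra). lra. }
    assert (0 <= Cmod (Mcurve alpha c) * - sin (t + phi0 alpha c) * (theta - theta0)).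
    { apply Rmult_le_pos; [apply Rmult_le_pos; [apply Cmod_ge_0 | lra] | lra]. }
    lra.
Qed.

(** For t >= alpha PI the angle t + phi is above PI on the whole half circle, so the derivative no
    longer changes sign and the infimum moves to the end theta = 0. *)
Lemma boundary_value_increasing (x y : R) : alpha * PI <= t <= PI -> 0 < x -> x <= y -> y <= PI ->
  boundary_value x <= boundary_value y.
Proof.
  intros Ht Hx [Hxy | ->] Hy; [|lra]. assert (HPI := PI_RGT_0).
  destruct (boundary_value_MVT x y) as (c & Hc & E); trivial.
  assert (P2 := phi0_le c PI ltac:(lra) ltac:(lra) ltac:(lra)). rewrite phi0_PI in P2 by exact Halpha.
  assert (P3 := phi0_lower alpha Halpha c ltac:(lra)).
  assert (Hs : sin (t + phi0 alpha c) <= 0) by (apply sin_le_0; lra).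
  assert (0 <= Cmod (Mcurve alpha c) * - sin (t + phi0 alpha c) * (y - x)).
  { apply Rmult_le_pos; [apply Rmult_le_pos; [apply Cmod_ge_0 | lra] | lra]. }
  lra.
Qed.

(** Conjugate points have conjugate values, and Im h > 0 on the upper half; since sin t >= 0, the
    term - sin t Im h is smaller there. *)
Lemma boundary_value_reflect (theta : R) : 0 <= t <= PI -> PI < theta < 2 * PI ->
  boundary_value (2 * PI - theta) <= boundary_value theta.
Proof.
  intros Ht H. unfold boundary_value.
  assert (Hre := Re_one_minus_cis (2 * PI - theta) ltac:(lra)).
  replace (cis theta) with (Cconj (cis (2 * PI - theta))).
  - rewrite h_conj by exact Hre. rewrite !Re_cis_mult, re_conj, im_conj.
    assert (Hi : 0 < Im (h alpha (cis (2 * PI - theta)))).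
    { apply Im_h_pos; [lra | exact Hre|]. simpl. apply sin_gt_0; lra. }
    assert (Hs : 0 <= sin t) by (apply sin_ge_0; lra). nra.
  - rewrite Cconj_cis. replace (- (2 * PI - theta)) with (theta + - (2 * PI)) by ring.
    rewrite cis_plus, cis_opp, cis_2PI. field.
Qed.

Lemma boundary_lower_full (m : R) : 0 <= t <= PI ->
  (forall theta, 0 < theta <= PI -> m <= boundary_value theta) ->
  forall theta, 0 < theta < 2 * PI -> m <= boundary_value theta.
Proof.
  intros Ht H theta Hth. destruct (Rle_dec theta PI) as [Hle|Hgt]; [apply H; lra|].
  eapply Rle_trans; [apply (H (2 * PI - theta)); lra|]. apply boundary_value_reflect; lra.
Qed.

Lemma boundary_lower_from_limit (m : R) : alpha * PI <= t <= PI ->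
  (forall e, 0 < e -> exists d, 0 < d /\ forall z, 0 < Re (1 - z)%C -> Cmod (1 - z)%C < d ->
     m - e <= Re (cis t * h alpha z)%C) ->
  forall theta, 0 < theta <= PI -> m <= boundary_value theta.
Proof.
  intros Ht Hnear theta Hth. apply Rnot_lt_le. intros Hlt.
  destruct (Hnear ((m - boundary_value theta) / 2)) as (d & Hd & H); [lra|].
  destruct (small_angle d theta Hd (proj1 Hth)) as (x & Hx & Hxt & _ & Hrim & _ & HD).
  specialize (H _ (proj2 Hrim) HD).
  assert (boundary_value x <= boundary_value theta) by (apply boundary_value_increasing; lra).
  unfold boundary_value in *. lra.
Qed.

(** The cases in which the infimum is the lower limit at 1: a bound near 1 spreads over the circle
    by monotonicity and reflection, then over the disc by the minimum principle. *)
Lemma Q_critical (m : R) : 0 <= t <= PI -> alpha * PI <= t ->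
  (forall e, 0 < e -> exists d, 0 < d /\ forall z, 0 < Re (1 - z)%C -> Cmod (1 - z)%C < d ->
     m - e <= Re (cis t * k alpha z)%C) ->
  (forall e d, 0 < e -> 0 < d -> exists z, rim z /\ Cmod (1 - z)%C < d /\
     Re (cis t * k alpha z)%C < m + e) ->
  Q alpha t = Finite m.
Proof.
  intros Ht Hcr Hlow Hup. assert (Hnear := near_one_lower m Hlow).
  apply Q_finite; [lra | | now apply near_one_upper].
  apply disc_lower_bound; [lra | |].
  - intros e He. destruct (Hnear e He) as (d & Hd & H). exists d. split; [exact Hd|].
    intros z [_ Hz]. now apply H.
  - apply boundary_lower_full; [exact Ht|]. apply boundary_lower_from_limit; [lra | exact Hnear].
Qed.

Lemma Q_subcritical (theta0 : R) : 0 <= t < alpha * PI -> 0 < theta0 <= PI ->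
  phi0 alpha theta0 = PI - t ->
  Q alpha t = Finite (Re (cis (t - theta0) * k alpha (cis theta0))%C).
Proof.
  intros Ht H0 Hphi. assert (HPI := PI_RGT_0).
  assert (HtPI : t <= PI) by nra.
  replace (Re (cis (t - theta0) * k alpha (cis theta0))%C) with (boundary_value theta0).
  2:{ unfold boundary_value. rewrite h_div by apply cis_neq_0.
      unfold Rminus. rewrite cis_plus, cis_opp. f_equal. unfold Cdiv. ring. }
  set (m := boundary_value theta0).
  assert (Hmin : forall theta, 0 < theta <= PI -> m <= boundary_value theta)
    by (intros; apply boundary_value_min; trivial; lra).
  apply Q_finite; [lra | |].
  - apply disc_lower_bound; [lra | |].
    + assert (Hlow : forall e, 0 < e -> exists d, 0 < d /\ forall z, 0 < Re (1 - z)%C -> Cmod (1 - z)%C < d ->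
        m - e <= Re (cis t * k alpha z)%C).
      { intros e He. destruct (Rle_dec alpha (1 / 2)) as [Ha|Ha].
        - destruct (k_large_near_one m Ha Ht) as (d & Hd & H). exists d. split; [exact Hd|].
          intros z Hz HD. specialize (H z Hz HD). lra.
        (* Here the rotated real part of k has a finite limit at 1. It is also a limit of boundary
           values of h, hence not below their minimum [m]. *)
        - assert (Hm : m <= / (2 * alpha - 1) * cos t).
          { apply Rnot_lt_le. intros Hlt.
            set (g := (m - / (2 * alpha - 1) * cos t) / 2). assert (Hg : 0 < g) by (unfold g; lra).
            destruct (k_limit_one g ltac:(lra) Hg) as (d1 & Hd1 & K1).
            destruct (h_minus_k_small g Hg) as (d2 & Hd2 & K2).
            destruct (small_angle (Rmin d1 d2) PI) as (x & Hx & _ & HxPI & Hrim & _ & HD);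
              [now apply Rmin_pos | exact HPI|].
            specialize (K1 _ (proj2 Hrim) (Rlt_le_trans _ _ _ HD (Rmin_l _ _))).
            specialize (K2 _ (proj2 Hrim) (Rlt_le_trans _ _ _ HD (Rmin_r _ _))).
            apply Rabs_def2 in K1, K2. specialize (Hmin x ltac:(lra)).
            unfold boundary_value in Hmin. unfold g in *. lra. }
          destruct (k_limit_one e ltac:(lra) He) as (d & Hd & H). exists d. split; [exact Hd|].
          intros z Hz HD. specialize (H z Hz HD). apply Rabs_def2 in H. lra. }
      intros e He. destruct (near_one_lower m Hlow e He) as (d & Hd & H). exists d. split; [exact Hd|].
      intros z [_ Hz]. now apply H.
    + apply boundary_lower_full; [lra | exact Hmin].
  - intros e He. exists (cis theta0). split; [apply rim_cis; lra|].
    change (m < m + e). lra.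
Qed.

Lemma Q_supercritical : alpha <= 1 / 2 -> alpha * PI < t <= PI -> Q alpha t = m_infty.
Proof.
  intros Ha Ht. apply Q_minus_infinity; [lra|]. apply near_one_minus_infinity.
  intros B d Hd. now apply k_minus_infinity.
Qed.

End NearOne.

(** * The case alpha = 0, and the final assembly *)

Lemma h_0 (z : C) : 0 < Re (1 - z)%C -> h 0 z = (/ (1 - z))%C.
Proof.
  intros Hz. destruct (Ceq_dec z (RtoC 0)) as [->|Hn].
  - rewrite h_at_0. field.
  - rewrite h_div by exact Hn. unfold k. destruct (Req_EM_T 0 (1 / 2)) as [E|_]; [lra|].
    replace (Cpowr (1 - z) (2 * 0 - 1)) with (pw 1 z).
    2:{ unfold Cpowr, pw. do 3 f_equal. ring. }
    rewrite pw_1 by exact Hz. replace (/ (1 - 2 * 0)) with 1 by field.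
    field. split; [now apply one_minus_neq_0 | exact Hn].
Qed.

Lemma Q_zero_zero : Q 0 0 = Finite (1 / 2).
Proof.
  apply Q_finite; [lra | |].
  - intros z Hz. assert (Hre := Re_one_minus z Hz).
    rewrite h_0, cis_0, Cmult_1_l, Re_inv_one_minus by exact Hre.
    assert (0 < (1 - Cmod z ^ 2) / (2 * Cmod (1 - z)%C ^ 2)); [|lra].
    apply Rdiv_lt_0_compat; [generalize (Cmod_ge_0 z); nra|].
    apply Rmult_lt_0_compat; [lra | apply pow_lt; now apply Re_le_Cmod_pos].
  (* Every boundary point other than 1 would do, since Re (1 / (1 - z)) = 1/2 all along the
     circle. *)
  - intros e He. assert (HPI := PI_RGT_0). exists (cis PI). split; [apply rim_cis; lra|].
    assert (Hre := Re_one_minus_cis PI ltac:(lra)).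
    rewrite h_0, cis_0, Cmult_1_l, Re_inv_one_minus, Cmod_cis by exact Hre.
    replace ((1 - 1 ^ 2) / (2 * Cmod (1 - cis PI)%C ^ 2)) with 0; [lra|].
    unfold Rdiv. ring.
Qed.

(** The range of h is the half-plane Re > 1/2. After rotation by t in (0, PI] its real part is
    unbounded below: along the border line if t <= PI/2, along the real axis otherwise. *)
Lemma Q_zero_pos (t : R) : 0 < t <= PI -> Q 0 t = m_infty.
Proof.
  intros Ht. apply Q_minus_infinity; [lra|]. intros B. assert (HPI := PI_RGT_0).
  destruct (Rle_dec t (PI / 2)) as [Hle|Hgt].
  - assert (Hs : 0 < sin t) by (apply sin_gt_0; lra).
    assert (Hb := Rle_abs (- B)). rewrite Rabs_Ropp in Hb.
    set (G := (Rabs B + 1) / sin t).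
    assert (HG : 0 < G) by (apply Rdiv_lt_0_compat; [generalize (Rabs_pos B); lra | exact Hs]).
    (* 1 / (1 - e^(i theta)) = 1/2 + i v for the point with v = G. *)
    set (z := (1 - / (RtoC (/ 2) + Ci * RtoC G))%C).
    assert (Hw : (RtoC (/ 2) + Ci * RtoC G)%C <> RtoC 0).
    { intros E. apply (f_equal Re) in E. simpl in E. lra. }
    assert (E1 : (1 - z = / (RtoC (/ 2) + Ci * RtoC G))%C) by (unfold z; ring).
    assert (Hq : 0 < / 2 * / 2 + G * G) by nra.
    assert (Hre : 0 < Re (1 - z)%C).
    { rewrite E1. simpl. apply Rdiv_lt_0_compat; [lra|]. nra. }
    assert (Hz : Cmod z <= 1).
    { assert (E2 := Re_inv_one_minus z Hre).
      replace (/ (1 - z))%C with (RtoC (/ 2) + Ci * RtoC G)%C in E2 by (rewrite E1; field; exact Hw).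
      assert (E3 : Re (RtoC (/ 2) + Ci * RtoC G)%C = / 2) by (simpl; ring). rewrite E3 in E2.
      assert (Hp : 0 < 2 * Cmod (1 - z)%C ^ 2).
      { apply Rmult_lt_0_compat; [lra | apply pow_lt; now apply Re_le_Cmod_pos]. }
      assert (E4 : 1 - Cmod z ^ 2 = 0).
      { apply Rmult_eq_reg_r with (/ (2 * Cmod (1 - z)%C ^ 2)); [unfold Rdiv in E2; lra|].
        apply Rinv_neq_0_compat. lra. }
      generalize (Cmod_ge_0 z). nra. }
    exists z. split; [now split|].
    rewrite h_0 by exact Hre. rewrite E1.
    replace (/ / (RtoC (/ 2) + Ci * RtoC G))%C with (RtoC (/ 2) + Ci * RtoC G)%C by (field; exact Hw).
    rewrite Re_cis_mult. simpl.
    assert (EG : sin t * G = Rabs B + 1) by (unfold G; field; lra).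
    generalize (COS_bound t). nra.
  - assert (Hc : cos t < 0) by (apply cos_lt_0; lra).
    (* At the real point 1 - D the value of h is 1/D, which makes the rotated real part - |B| + 2
       cos t, less than [B]. *)
    set (D := / (Rabs B / - cos t + 2)).
    assert (HB : 0 <= Rabs B / - cos t).
    { apply Rmult_le_pos; [apply Rabs_pos | left; apply Rinv_0_lt_compat; lra]. }
    assert (HD : 0 < D < 1).
    { unfold D. split; [apply Rinv_0_lt_compat; lra|]. rewrite <- Rinv_1. apply Rinv_lt_contravar; lra. }
    destruct (rim_real D HD) as (Hrim & _ & _). exists (RtoC (1 - D)). split; [exact Hrim|].
    rewrite h_0 by apply Hrim.
    replace (/ (1 - RtoC (1 - D)))%C with (RtoC (/ D)).
    2:{ rewrite RtoC_inv by lra. f_equal. rewrite RtoC_minus. ring. }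
    rewrite Re_cis_mult. simpl. unfold D. rewrite Rinv_inv.
    replace (cos t * (Rabs B / - cos t + 2) - sin t * 0) with (- Rabs B + 2 * cos t) by (field; lra).
    generalize (Rle_abs (- B)). rewrite Rabs_Ropp. lra.
Qed.

(** The inverse of phi enters through the equation [phi a theta0 = PI - t]. By the first clause it
    has exactly one solution for 0 <= t < alpha PI, as then PI - t lies in (PI (1 - alpha), PI]; the
    existence of a branch is part of that clause. *)
Theorem theorem3p3 :
  (forall alpha : R, 0 < alpha < 1 ->
     (exists a : R -> R, is_arg_branch alpha a) /\
     (forall a : R -> R, is_arg_branch alpha a ->
        maps_homeomorphically (Ioc 0 PI) (Ioc (PI * (1 - alpha)) PI) (phi a)))
  /\
  (forall t : R, 0 <= t <= PI ->
     (* (i) *)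
     ((t = 0 -> Q 0 t = Finite (1 / 2)) /\
      (0 < t -> Q 0 t = m_infty))
     /\
     (* (ii) *)
     (forall alpha : R, 0 < alpha < 1 / 2 ->
        (t < alpha * PI ->
           forall (a : R -> R) (theta0 : R), is_arg_branch alpha a ->
             Ioc 0 PI theta0 -> phi a theta0 = PI - t ->
             Q alpha t =
               Finite (Re (cis (t - theta0) * k alpha (cis theta0))%C)) /\
        (t = alpha * PI ->
           Q alpha t = Finite (/ (2 * alpha - 1) * cos (alpha * PI))) /\
        (alpha * PI < t -> Q alpha t = m_infty))
     /\
     (* (iii) *)
     ((t < PI / 2 ->
         forall (a : R -> R) (theta0 : R), is_arg_branch (1 / 2) a ->
           Ioc 0 PI theta0 -> phi a theta0 = PI - t ->
           Q (1 / 2) t =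
             Finite (Re (cis (t - theta0) * k (1 / 2) (cis theta0))%C)) /\
      (t = PI / 2 -> Q (1 / 2) t = Finite (- (PI / 2))) /\
      (PI / 2 < t -> Q (1 / 2) t = m_infty))
     /\
     (* (iv) *)
     (forall alpha : R, 1 / 2 < alpha < 1 ->
        (t < alpha * PI ->
           forall (a : R -> R) (theta0 : R), is_arg_branch alpha a ->
             Ioc 0 PI theta0 -> phi a theta0 = PI - t ->
             Q alpha t =
               Finite (Re (cis (t - theta0) * k alpha (cis theta0))%C)) /\
        (alpha * PI <= t ->
           Q alpha t = Finite (/ (2 * alpha - 1) * cos t)))).
Proof.
  assert (HPI := PI_RGT_0).
  assert (Sub : forall alpha t, 0 < alpha < 1 -> 0 <= t < alpha * PI ->
    forall (a : R -> R) (theta0 : R), is_arg_branch alpha a ->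
      Ioc 0 PI theta0 -> phi a theta0 = PI - t ->
      Q alpha t = Finite (Re (cis (t - theta0) * k alpha (cis theta0))%C)).
  { intros alpha t Ha Ht a theta0 Hbr Hth Hphi. apply Q_subcritical; trivial.
    now rewrite <- (arg_branch_unique alpha Ha a theta0 Hbr Hth). }
  split.
  { intros alpha Ha. split.
    - eexists. now apply arg_branch_exists.
    - intros a Hbr. now apply phi_homeomorphism. }
  intros t Ht. split; [|split; [|split]].
  - split; [intros ->; exact Q_zero_zero | intros H0; apply Q_zero_pos; lra].
  - intros alpha Ha. split; [|split].
    + intros H. apply Sub; lra.
    + intros H. apply Q_critical; [lra | exact Ht | lra | |].
      * intros e He. exists 1. split; [lra|]. intros z Hz _.
        generalize (k_lower_critical alpha t ltac:(lra) z ltac:(lra) H Hz). lra.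
      * intros e d He Hd. apply k_upper_critical; trivial; lra.
    + intros H. apply Q_supercritical; lra.
  - split; [|split].
    + intros H. apply Sub; lra.
    + intros H. apply Q_critical; [lra | exact Ht | lra | |].
      * intros e He. exists 1. split; [lra|]. intros z Hz _.
        generalize (k_lower_critical_half (1 / 2) t z eq_refl H Hz). lra.
      * intros e d He Hd. apply k_upper_critical_half; trivial; lra.
    + intros H. apply Q_supercritical; lra.
  - intros alpha Ha. split.
    + intros H. apply Sub; lra.
    + intros H. apply Q_critical; [lra | exact Ht | lra | |].
      * intros e He. destruct (k_limit_one alpha t e) as (d & Hd & Hk); [lra | exact He|].
        exists d. split; [exact Hd|]. intros z Hz HD. specialize (Hk z Hz HD).
        apply Rabs_def2 in Hk. lra.
      * intros e d He Hd. apply k_upper_limit; trivial; lra.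
Qed.
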